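(* Let $n\ge1$. The canonical images of the elements $$\{x^\alpha\mathbf{b}\pi\mid\alpha\in\mathbb{N}^n\text{ with }\alpha_1,\dots,\alpha_n<d_{\mathbf{C}},\ \mathbf{b}\in B^{\otimes n},\ \pi\in S_n\}$$ form a basis (over $\Bbbk$) for the cyclotomic wreath product algebra $\mathcal{A}_n^{\mathbf{C}}(F)$.
   Context: $\Bbbk$ is a commutative ring of characteristic not equal to $2$; $\mathbb{N}$ is the set of nonnegative integers. ''Algebra'' means associative unital $\mathbb{Z}$-graded $\Bbbk$-superalgebra; $|a|$ is the degree and $\bar a$ the parity. Tensor products are over $\Bbbk$, with $(a_1\otimes a_2)(b_1\otimes b_2)=(-1)^{\bar a_2\bar b_1}a_1b_1\otimes a_2b_2$. $F$ is an $\mathbb{N}$-graded Frobenius superalgebra, free of finite rank over $\Bbbk$: there is a parity-preserving linear trace map $\operatorname{tr}\colon F\to\Bbbk$, homogeneous in degree, such that $f\mapsto(g\mapsto(-1)^{\bar f\bar g}\operatorname{tr}(gf))$ is an isomorphism $F\to\operatorname{Hom}_\Bbbk(F,\Bbbk)$. The Nakayama automorphism $\psi$ is defined by $\operatorname{tr}(fg)=(-1)^{\bar f\bar g}\operatorname{tr}(g\psi(f))$. $\delta$ is the maximum degree of elements of $F$. It is assumed that $\psi$ has finite order $\theta$, that the characteristic of $\Bbbk$ does not divide $\theta$, and that $F$ has a basis of eigenvectors of $\psi$. $B$ is a homogeneous basis of $F$ and $\{b^\vee\}$ its left dual basis: $\operatorname{tr}(b^\vee c)=\delta_{b,c}$.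 $B^{\otimes n}$ is the basis $\{b_1\otimes\cdots\otimes b_n\mid b_i\in B\}$ of $F^{\otimes n}$. For $f\in F$: $f_i=1^{\otimes(i-1)}\otimes f\otimes1^{\otimes(n-i)}\in F^{\otimes n}$ and $\psi_i=\operatorname{id}^{\otimes(i-1)}\otimes\psi\otimes\operatorname{id}^{\otimes(n-i)}$. $S_n$ acts on $F^{\otimes n}$ by superpermuting factors, written ${}^\pi\mathbf{f}$: ${}^{s_i}(f_1\otimes\cdots\otimes f_n)=(-1)^{\bar f_i\bar f_{i+1}}f_1\otimes\cdots\otimes f_{i+1}\otimes f_i\otimes\cdots\otimes f_n$, with $s_i$ the transposition of $i,i+1$. The affine wreath product algebra $\mathcal{A}_n(F)$ is the free product $\Bbbk[x_1,\dots,x_n]\star F^{\otimes n}\star\Bbbk S_n$ modulo the relations: $\mathbf{f}x_i=x_i\psi_i(\mathbf{f})$; $s_ix_j=x_js_i$ ($j\ne i,i+1$); $s_ix_i=x_{i+1}s_i-t_{i,i+1}$; $\pi\mathbf{f}={}^\pi\mathbf{f}\,\pi$ ($\pi\in S_n$), where $t_{i,j}=\sum_{b\in B}b_i(b^\vee)_j$ for $i\neq j$. Gradings: $|x_i|=\delta$, $\bar x_i=0$; $f_i$ has the degree and parity of $f$; $\pi\in S_n$ has degree and parity $0$. For $\alpha\in\mathbb{N}^n$, $x^\alpha=x_1^{\alpha_1}\cdots x_n^{\alpha_n}$. For $k\in\mathbb{Z}$: $F_\psi=\{f\in F\mid\psi(f)=f\}$, $F^{(k)}=\{f\in F\mid gf=(-1)^{\bar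 f\bar g}f\psi^k(g)\ \forall g\in F\}$, $F_\psi^{(k)}=F^{(k)}\cap F_\psi$. $\mathbf{F}_1^{(k)}$ is the set of elements of $F_\psi^{(k)}\otimes(F_\psi^{(0)})^{\otimes(n-1)}\subseteq F^{\otimes n}$ invariant under $\{\pi\in S_n\mid\pi(1)=1\}$. For $1\le k\le\theta$ choose $e_k\in\mathbb{N}$ and even elements $\mathbf{c}^{(k,1)},\dots,\mathbf{c}^{(k,e_k)}\in\mathbf{F}_1^{(k)}$ of degree $k\delta$, and let $\mathbf{C}$ be the tuple of all these elements. Let $\chi_{\mathbf{C}}=\prod_{k=1}^\theta\prod_{j=1}^{e_k}(x_1^k-\mathbf{c}^{(k,j)})$, let $J_{\mathbf{C}}$ be the two-sided ideal of $\mathcal{A}_n(F)$ generated by $\chi_{\mathbf{C}}$, and $\mathcal{A}_n^{\mathbf{C}}(F)=\mathcal{A}_n(F)/J_{\mathbf{C}}$. The level is $d_{\mathbf{C}}=\sum_{k=1}^\theta ke_k$. *)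

(* Defs.v *)
From HB Require Import structures.
From mathcomp Require Import all_boot all_fingroup all_algebra.
From mathcomp Require Import boolp generic_quotient.

Set Implicit Arguments.
Unset Strict Implicit.
Unset Printing Implicit Defensive.

Import GRing.Theory.

Local Open Scope quotient_scope.
Local Open Scope ring_scope.

Definition is_basis (k : comNzRingType) (V : lmodType k) (I : finType)
    (b : I -> V) : Prop :=
  forall v : V, exists! c : {ffun I -> k}, v = \sum_i c i *: b i.

(* [pchar k] only sees prime characteristics; a general commutative ring needs
   the nonnegative generator of the kernel of the map from the integers. *)
Definition has_characteristic (k : comNzRingType) (p : nat) : Prop :=
  forall m : nat, (m%:R == 0 :> k) = (p %| m)%N.

(* presAlg rel is the unital associative k-algebra with generators G and
   relations rel: formal expressions modulo the least congruence containing rel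
   and the algebra axioms.  It may be the zero ring, whereas algType requires
   1 != 0: the structures are pzRingType and lmodType k, with
   pres_scaleAl/pres_scaleAr. *)

Section PresentedAlgebra.
Variables (k : comNzRingType) (G : Type).

Inductive term : Type :=
| Tgen of G
| Tzero
| Tone
| Topp of term
| Tadd of term & term
| Tmul of term & term
| Tscale of k & term.

HB.instance Definition _ := gen_eqMixin term.
HB.instance Definition _ := gen_choiceMixin term.

Variable rel : term -> term -> Prop.

Inductive teq : term -> term -> Prop :=
| teq_rel s t : rel s t -> teq s t
| teq_refl s : teq s s
| teq_sym s t : teq s t -> teq t s
| teq_trans s t u : teq s t -> teq t u -> teq s u
| teq_opp s s' : teq s s' -> teq (Topp s) (Topp s')
| teq_add s s' t t' : teq s s' -> teq t t' -> teq (Tadd s t) (Tadd s' t')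
| teq_mul s s' t t' : teq s s' -> teq t t' -> teq (Tmul s t) (Tmul s' t')
| teq_scale a s s' : teq s s' -> teq (Tscale a s) (Tscale a s')
| teq_addA s t u : teq (Tadd s (Tadd t u)) (Tadd (Tadd s t) u)
| teq_addC s t : teq (Tadd s t) (Tadd t s)
| teq_add0 s : teq (Tadd Tzero s) s
| teq_addN s : teq (Tadd (Topp s) s) Tzero
| teq_mulA s t u : teq (Tmul s (Tmul t u)) (Tmul (Tmul s t) u)
| teq_mul1l s : teq (Tmul Tone s) s
| teq_mul1r s : teq (Tmul s Tone) s
| teq_mulDl s t u : teq (Tmul (Tadd s t) u) (Tadd (Tmul s u) (Tmul t u))
| teq_mulDr s t u : teq (Tmul s (Tadd t u)) (Tadd (Tmul s t) (Tmul s u))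
| teq_scaleA a b s : teq (Tscale a (Tscale b s)) (Tscale (a * b) s)
| teq_scale1 s : teq (Tscale 1 s) s
| teq_scaleDr a s t : teq (Tscale a (Tadd s t)) (Tadd (Tscale a s) (Tscale a t))
| teq_scaleDl a b s : teq (Tscale (a + b) s) (Tadd (Tscale a s) (Tscale b s))
| teq_scaleAl a s t : teq (Tscale a (Tmul s t)) (Tmul (Tscale a s) t)
| teq_scaleAr a s t : teq (Tscale a (Tmul s t)) (Tmul s (Tscale a t)).

Definition teqb (s t : term) : bool := `[< teq s t >].

Lemma teqb_equiv : equiv_class_of teqb.
Proof.
split=> [s|s t|t s u].
- by apply/asboolP; exact: teq_refl.
- by apply/asboolP/asboolP; exact: teq_sym.
- by move=> /asboolP st /asboolP tu; apply/asboolP; exact: teq_trans st tu.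
Qed.

Canonical teqb_equivRel := EquivRelPack teqb_equiv.

Definition presAlg : Type := {eq_quot teqb}.

HB.instance Definition _ : EqQuotient term teqb presAlg := EqQuotient.on presAlg.
HB.instance Definition _ := Choice.on presAlg.

Lemma presAlg_eqP (s t : term) : \pi_presAlg s = \pi_presAlg t <-> teq s t.
Proof.
by split=> [/eqP|st]; [rewrite piE => /asboolP|apply/eqP; rewrite piE; apply/asboolP].
Qed.

Lemma teq_repr (s : term) : teq (repr (\pi_presAlg s)) s.
Proof. by apply/presAlg_eqP; rewrite reprK. Qed.

Definition pres_opp (x : presAlg) : presAlg := \pi_presAlg (Topp (repr x)).
Definition pres_add (x y : presAlg) : presAlg := \pi_presAlg (Tadd (repr x) (repr y)).
Definition pres_mul (x y : presAlg) : presAlg := \pi_presAlg (Tmul (repr x) (repr y)).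
Definition pres_scale (a : k) (x : presAlg) : presAlg := \pi_presAlg (Tscale a (repr x)).

Lemma pi_oppE s : pres_opp (\pi_presAlg s) = \pi_presAlg (Topp s).
Proof. by apply/presAlg_eqP/teq_opp/teq_repr. Qed.
Lemma pi_addE s t : pres_add (\pi_presAlg s) (\pi_presAlg t) = \pi_presAlg (Tadd s t).
Proof. by apply/presAlg_eqP/teq_add; exact: teq_repr. Qed.
Lemma pi_mulE s t : pres_mul (\pi_presAlg s) (\pi_presAlg t) = \pi_presAlg (Tmul s t).
Proof. by apply/presAlg_eqP/teq_mul; exact: teq_repr. Qed.
Lemma pi_scaleE a s : pres_scale a (\pi_presAlg s) = \pi_presAlg (Tscale a s).
Proof. by apply/presAlg_eqP/teq_scale/teq_repr. Qed.

Lemma presW (P : presAlg -> Prop) : (forall s, P (\pi_presAlg s)) -> forall x, P x.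
Proof. by move=> h; elim/quotW => s; exact: h. Qed.

Let piE4 := (pi_oppE, pi_addE, pi_mulE, pi_scaleE).

Lemma pres_addA : associative pres_add.
Proof. by elim/presW=> s; elim/presW=> t; elim/presW=> u; rewrite !piE4; apply/presAlg_eqP/teq_addA. Qed.
Lemma pres_addC : commutative pres_add.
Proof. by elim/presW=> s; elim/presW=> t; rewrite !piE4; apply/presAlg_eqP/teq_addC. Qed.
Lemma pres_add0 : left_id (\pi_presAlg Tzero) pres_add.
Proof. by elim/presW=> s; rewrite !piE4; apply/presAlg_eqP/teq_add0. Qed.
Lemma pres_addN : left_inverse (\pi_presAlg Tzero) pres_opp pres_add.
Proof. by elim/presW=> s; rewrite !piE4; apply/presAlg_eqP/teq_addN. Qed.
HB.instance Definition _ :=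
  GRing.isZmodule.Build presAlg pres_addA pres_addC pres_add0 pres_addN.

Lemma pres_mulA : associative pres_mul.
Proof. by elim/presW=> s; elim/presW=> t; elim/presW=> u; rewrite !piE4; apply/presAlg_eqP/teq_mulA. Qed.
Lemma pres_mul1l : left_id (\pi_presAlg Tone) pres_mul.
Proof. by elim/presW=> s; rewrite !piE4; apply/presAlg_eqP/teq_mul1l. Qed.
Lemma pres_mul1r : right_id (\pi_presAlg Tone) pres_mul.
Proof. by elim/presW=> s; rewrite !piE4; apply/presAlg_eqP/teq_mul1r. Qed.
Lemma pres_mulDl : left_distributive pres_mul pres_add.
Proof. by elim/presW=> s; elim/presW=> t; elim/presW=> u; rewrite !piE4; apply/presAlg_eqP/teq_mulDl. Qed.
Lemma pres_mulDr : right_distributive pres_mul pres_add.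
Proof. by elim/presW=> s; elim/presW=> t; elim/presW=> u; rewrite !piE4; apply/presAlg_eqP/teq_mulDr. Qed.
HB.instance Definition _ := GRing.Zmodule_isPzRing.Build presAlg
  pres_mulA pres_mul1l pres_mul1r pres_mulDl pres_mulDr.

Lemma pres_scaleA a b x : pres_scale a (pres_scale b x) = pres_scale (a * b) x.
Proof. by elim/presW: x => s; rewrite !piE4; apply/presAlg_eqP/teq_scaleA. Qed.
Lemma pres_scale1 : left_id 1 pres_scale.
Proof. by elim/presW=> s; rewrite !piE4; apply/presAlg_eqP/teq_scale1. Qed.
Lemma pres_scaleDr : right_distributive pres_scale pres_add.
Proof. by move=> a; elim/presW=> s; elim/presW=> t; rewrite !piE4; apply/presAlg_eqP/teq_scaleDr. Qed.
Lemma pres_scaleDl x : {morph pres_scale^~ x : a b / a + b >-> pres_add a b}.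
Proof. by move=> a b; elim/presW: x => s; rewrite !piE4; apply/presAlg_eqP/teq_scaleDl. Qed.
HB.instance Definition _ := GRing.Zmodule_isLmodule.Build k presAlg
  pres_scaleA pres_scale1 pres_scaleDr pres_scaleDl.

Lemma pres_scaleAl (a : k) (x y : presAlg) : a *: (x * y) = (a *: x) * y.
Proof. by elim/presW: x => s; elim/presW: y => t; rewrite /GRing.scale/= /GRing.mul/= !piE4; apply/presAlg_eqP/teq_scaleAl. Qed.
Lemma pres_scaleAr (a : k) (x y : presAlg) : a *: (x * y) = x * (a *: y).
Proof. by elim/presW: x => s; elim/presW: y => t; rewrite /GRing.scale/= /GRing.mul/= !piE4; apply/presAlg_eqP/teq_scaleAr. Qed.

Definition pgen (g : G) : presAlg := \pi_presAlg (Tgen g).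

End PresentedAlgebra.

Arguments Tzero {k G}.
Arguments Tone {k G}.


Record two_sided_ideal (R : pzRingType) (I : R -> Prop) : Prop := TwoSidedIdeal {
  ideal0 : I 0;
  idealB : forall x y, I x -> I y -> I (x - y);
  idealMl : forall a x, I x -> I (a * x);
  idealMr : forall a x, I x -> I (x * a) }.

Definition ideal_gen (R : pzRingType) (z : R) (x : R) : Prop :=
  forall I : R -> Prop, two_sided_ideal I -> I z -> I x.

Section QuotientRing.
Variables (R : pzRingType) (z : R).

Lemma ideal_genP : two_sided_ideal (ideal_gen z).
Proof.
split=> [I /ideal0|x y Ix Iy I hI hz|a x Ix I hI hz|a x Ix I hI hz] //.
- by apply: (idealB hI); [exact: Ix|exact: Iy].
- by apply: (idealMl hI); exact: Ix.
- by apply: (idealMr hI); exact: Ix.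
Qed.

Definition ideal_genb : {pred R} := fun x => `[< ideal_gen z x >].

Lemma ideal_genb_zmod : zmod_closed ideal_genb.
Proof.
split=> [|x y /asboolP Ix /asboolP Iy]; apply/asboolP.
  exact: (ideal0 ideal_genP).
exact: (idealB ideal_genP).
Qed.
HB.instance Definition _ := GRing.isZmodClosed.Build R ideal_genb ideal_genb_zmod.

Definition quotRing : Type := Quotient.quot ideal_genb.
HB.instance Definition _ := GRing.Zmodule.on quotRing.

Definition qpi (x : R) : quotRing := \pi_(Quotient.quot ideal_genb) x.

Lemma qpi_eqP x y : qpi x = qpi y <-> ideal_gen z (x - y).
Proof.
rewrite /qpi; split=> [/eqP|h]; last apply/eqP.
  by rewrite -Quotient.idealrBE => /asboolP.
by rewrite -Quotient.idealrBE; apply/asboolP.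
Qed.

Lemma qpiW (P : quotRing -> Prop) : (forall x, P (qpi x)) -> forall q, P q.
Proof. by move=> h; elim/quotW => x; exact: h. Qed.

Lemma qpi_repr x : qpi (repr (qpi x)) = qpi x.
Proof. by rewrite /qpi reprK. Qed.

Lemma qpiD x y : qpi (x + y) = qpi x + qpi y.
Proof. by rewrite /qpi Quotient.pi_add. Qed.

Definition quot_mul (p q : quotRing) : quotRing := qpi (repr p * repr q).

Lemma quot_mulE x y : quot_mul (qpi x) (qpi y) = qpi (x * y).
Proof.
rewrite /quot_mul; set x' := repr _; set y' := repr _.
have Ix : ideal_gen z (x' - x) by apply/qpi_eqP; exact: qpi_repr.
have Iy : ideal_gen z (y' - y) by apply/qpi_eqP; exact: qpi_repr.
apply/qpi_eqP.
have -> : x' * y' - x * y = x' * (y' - y) - (x - x') * y.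
  by rewrite mulrBr mulrBl opprB addrA subrK.
apply: (idealB ideal_genP); first exact: (idealMl ideal_genP).
apply: (idealMr ideal_genP); rewrite -opprB -sub0r.
by apply: (idealB ideal_genP) => //; exact: (ideal0 ideal_genP).
Qed.

Lemma quot_mulA : associative quot_mul.
Proof. by elim/qpiW=> x; elim/qpiW=> y; elim/qpiW=> t; rewrite !quot_mulE mulrA. Qed.
Lemma quot_mul1l : left_id (qpi 1) quot_mul.
Proof. by elim/qpiW=> x; rewrite quot_mulE mul1r. Qed.
Lemma quot_mul1r : right_id (qpi 1) quot_mul.
Proof. by elim/qpiW=> x; rewrite quot_mulE mulr1. Qed.
Lemma quot_mulDl : left_distributive quot_mul +%R.
Proof. by elim/qpiW=> x; elim/qpiW=> y; elim/qpiW=> t; rewrite -qpiD !quot_mulE mulrDl qpiD. Qed.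
Lemma quot_mulDr : right_distributive quot_mul +%R.
Proof. by elim/qpiW=> x; elim/qpiW=> y; elim/qpiW=> t; rewrite -qpiD !quot_mulE mulrDr qpiD. Qed.
HB.instance Definition _ := GRing.Zmodule_isPzRing.Build quotRing
  quot_mulA quot_mul1l quot_mul1r quot_mulDl quot_mulDr.

End QuotientRing.

Section QuotientAlgebra.
Variables (k : comNzRingType) (G : Type) (rel : term k G -> term k G -> Prop).
Local Notation A := (presAlg rel).
Variable z : A.
Local Notation Q := (quotRing z).

Definition quot_scale (a : k) (q : Q) : Q := qpi z (a *: repr q).

Lemma quot_scaleE a x : quot_scale a (qpi z x) = qpi z (a *: x).
Proof.
apply/qpi_eqP; rewrite -scalerBr -[_ - x]mul1r pres_scaleAl.
by apply: (idealMl (ideal_genP z)); apply/qpi_eqP; exact: qpi_repr.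
Qed.

Lemma quot_scaleA a b q : quot_scale a (quot_scale b q) = quot_scale (a * b) q.
Proof. by elim/qpiW: q => x; rewrite !quot_scaleE scalerA. Qed.
Lemma quot_scale1 : left_id 1 quot_scale.
Proof. by elim/qpiW=> x; rewrite quot_scaleE scale1r. Qed.
Lemma quot_scaleDr : right_distributive quot_scale +%R.
Proof. by move=> a; elim/qpiW=> x; elim/qpiW=> y; rewrite -qpiD !quot_scaleE scalerDr qpiD. Qed.
Lemma quot_scaleDl q : {morph quot_scale^~ q : a b / a + b}.
Proof. by move=> a b; elim/qpiW: q => x; rewrite !quot_scaleE scalerDl qpiD. Qed.
HB.instance Definition _ := GRing.Zmodule_isLmodule.Build k Q
  quot_scaleA quot_scale1 quot_scaleDr quot_scaleDl.

End QuotientAlgebra.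

(* Gradings are given by their projections: gs_deg d on the component of degree
   d, gs_par false and gs_par true on the even and odd parts. *)

Record gradedSuperalgebra (k : comNzRingType) := GradedSuperalgebra {
  gs_alg :> algType k;
  gs_deg : nat -> {linear gs_alg -> gs_alg};
  gs_par : bool -> {linear gs_alg -> gs_alg};
  gs_deg_proj : forall d d' f,
    gs_deg d (gs_deg d' f) = if d == d' then gs_deg d f else 0;
  gs_deg_sum : forall f, exists N, f = \sum_(d < N) gs_deg d f;
  gs_par_proj : forall e e' f,
    gs_par e (gs_par e' f) = if e == e' then gs_par e f else 0;
  gs_par_sum : forall f, f = gs_par false f + gs_par true f;
  gs_deg_par : forall d e f, gs_deg d (gs_par e f) = gs_par e (gs_deg d f);
  gs_deg1 : gs_deg 0 1 = 1;
  gs_par1 : gs_par false 1 = 1;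
  gs_degM : forall d d' f g, gs_deg d f = f -> gs_deg d' g = g ->
    gs_deg (d + d')%N (f * g) = f * g;
  gs_parM : forall e e' f g, gs_par e f = f -> gs_par e' g = g ->
    gs_par (e (+) e') (f * g) = f * g }.

Definition has_degree k (F : gradedSuperalgebra k) (d : nat) (f : F) : Prop :=
  gs_deg F d f = f.
Definition has_parity k (F : gradedSuperalgebra k) (e : bool) (f : F) : Prop :=
  gs_par F e f = f.

Definition is_max_degree k (F : gradedSuperalgebra k) (delta : nat) : Prop :=
  (exists f : F, f <> 0 /\ has_degree delta f) /\
  (forall d (f : F), f <> 0 -> has_degree d f -> (d <= delta)%N).

(* For h biadditive: (f, g) |-> (-1)^(e e') h f g for f of parity e and g of
   parity e', extended additively to all f and g *)
Definition superize k (F : gradedSuperalgebra k) (V : zmodType)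
    (h : F -> F -> V) (f g : F) : V :=
  \sum_(e : bool) \sum_(e' : bool)
    (if e && e' then - h (gs_par F e f) (gs_par F e' g)
     else h (gs_par F e f) (gs_par F e' g)).

Record frobeniusSuperalgebra (k : comNzRingType) := FrobeniusSuperalgebra {
  fr_gs :> gradedSuperalgebra k;
  fr_tr : {linear fr_gs -> k^o};
  fr_tr_parity : forall f : fr_gs, has_parity true f -> fr_tr f = 0;
  (* tr is homogeneous of degree m, where k is in degree 0 *)
  fr_tr_degree : exists m : int, forall d (f : fr_gs),
    has_degree d f -> d%:Z + m <> 0 -> fr_tr f = 0;
  fr_tr_iso : forall phi : {linear fr_gs -> k^o}, exists! f : fr_gs,
    forall g, superize (fun f g => fr_tr (g * f)) f g = phi g }.

Definition is_nakayama k (F : frobeniusSuperalgebra k) (psi : F -> F) : Prop :=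
  forall f g : F, fr_tr F (f * g) = superize (fun f g => fr_tr F (g * psi f)) f g.

Definition has_order (T : Type) (h : T -> T) (m : nat) : Prop :=
  [/\ (0 < m)%N, iter m h =1 id &
      forall m', (0 < m' < m)%N -> ~ (iter m' h =1 id)].

Definition has_eigenbasis (k : comNzRingType) (V : lmodType k) (h : V -> V) :=
  exists (r : nat) (v : 'I_r -> V) (lam : 'I_r -> k),
    is_basis v /\ forall i, h (v i) = lam i *: v i.

Record homogBasis k (F : gradedSuperalgebra k) := HomogBasis {
  hb_idx :> finType;
  hb_vec : hb_idx -> F;
  hb_deg : hb_idx -> nat;
  hb_par : hb_idx -> bool;
  hb_basis : is_basis hb_vec;
  hb_degP : forall b, has_degree (hb_deg b) (hb_vec b);
  hb_parP : forall b, has_parity (hb_par b) (hb_vec b) }.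

Definition is_left_dual k (F : frobeniusSuperalgebra k) (B : homogBasis F)
    (bd : B -> F) : Prop :=
  forall b c : B, fr_tr F (bd b * hb_vec c) = (b == c)%:R.

Section TwistedCentres.
Variables (k : comNzRingType) (F : gradedSuperalgebra k) (psi : F -> F).

(* F^(r), for r >= 0 *)
Definition in_F (r : nat) (f : F) : Prop :=
  forall g : F, g * f = superize (fun f g => f * iter r psi g) f g.

Definition in_Fpsi (r : nat) (f : F) : Prop := in_F r f /\ psi f = f.

End TwistedCentres.

(* F^(⊗n) in coordinates: the free module on B^n, J : 'I_n -> B standing for the
   basis tensor b_(J 0) ⊗ ... ⊗ b_(J (n-1)).  Positions are numbered from 0. *)

Section TensorPower.
Variables (k : comNzRingType) (F : gradedSuperalgebra k) (B : homogBasis F).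
Variable n : nat.

Definition hb_coord (f : F) : {ffun B -> k} := sval (cid (@hb_basis _ _ B f)).

Definition tensorPower : Type := {ffun {ffun 'I_n -> B} -> k^o}.
HB.instance Definition _ := GRing.Lmodule.on tensorPower.

Definition tens (f : 'I_n -> F) : tensorPower :=
  [ffun J : {ffun 'I_n -> B} => \prod_i hb_coord (f i) (J i)].

Definition btens (J : {ffun 'I_n -> B}) : tensorPower :=
  tens (fun i => hb_vec (J i)).

Definition tone : tensorPower := tens (fun=> 1).

(* The sign of (f_1 ⊗ ... ⊗ f_n)(g_1 ⊗ ... ⊗ g_n) comes from moving each g_j
   to the left past the f_i with i > j. *)
Definition tmul (u v : tensorPower) : tensorPower :=
  \sum_(J : {ffun 'I_n -> B}) \sum_(K : {ffun 'I_n -> B})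
    (u J * v K *
     (-1) ^+ (\sum_(i < n) \sum_(j < n | (j < i)%N)
                (hb_par (J i) && hb_par (K j)))) *:
    tens (fun i => hb_vec (J i) * hb_vec (K i)).

Definition tat (i : 'I_n) (f : F) : tensorPower :=
  tens (fun l => if l == i then f else 1).

Definition tmap_at (psi : F -> F) (i : 'I_n) (u : tensorPower) : tensorPower :=
  \sum_(J : {ffun 'I_n -> B}) u J *:
    tens (fun l => if l == i then psi (hb_vec (J l)) else hb_vec (J l)).

(* The factor in position i moves to position p i, with a sign for each pair of
   odd factors whose order is reversed. *)
Definition tperm_act (p : 'S_n) (u : tensorPower) : tensorPower :=
  \sum_(J : {ffun 'I_n -> B})
    (u J * (-1) ^+ (\sum_(i < n) \sum_(j < n | (i < j)%N && (p j < p i)%N)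
                      (hb_par (J i) && hb_par (J j)))) *:
    tens (fun l => hb_vec (J (p^-1%g l))).

Definition t_has_degree (d : nat) (u : tensorPower) : Prop :=
  forall J : {ffun 'I_n -> B}, u J <> 0 -> (\sum_i hb_deg (J i))%N = d.

Definition t_even (u : tensorPower) : Prop :=
  forall J : {ffun 'I_n -> B}, u J <> 0 -> ~~ odd (\sum_i hb_par (J i)).

(* The first condition describes the image in F^(⊗n) of
   F_psi^(r) ⊗ (F_psi^(0))^(⊗(n-1)), i0 being the first position. *)
Definition in_F1 (psi : F -> F) (i0 : 'I_n) (r : nat) (u : tensorPower) : Prop :=
  (exists (m : nat) (f : 'I_m -> 'I_n -> F),
     (forall l i, in_Fpsi psi (if i == i0 then r else 0%N) (f l i)) /\
     u = \sum_l tens (f l)) /\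
  (forall p : 'S_n, p i0 = i0 -> tperm_act p u = u).

End TensorPower.


Section AffineWreath.
Variables (k : comNzRingType) (F : gradedSuperalgebra k) (B : homogBasis F).
Variables (psi : F -> F) (bd : B -> F) (n : nat).
Local Notation T := (tensorPower B n).

Definition t_elt (i j : 'I_n) : T :=
  \sum_(b : B) tmul (tat B i (hb_vec b)) (tat B j (bd b)).

Inductive awp_gen : Type :=
| Gx of 'I_n
| Gtens of T
| Gperm of 'S_n.

Local Notation xg i := (Tgen k (Gx i)).
Local Notation tg u := (Tgen k (Gtens u)).
Local Notation pg p := (Tgen k (Gperm p)).
Local Notation "s · t" := (Tmul s t) (at level 40, left associativity).

(* In mathcomp (p * q)%g is "p, then q", whereas permutations are composed here
   as functions acting on the left: the product p q of S_n is (q * p)%g.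
   The relations up to awp_p1 are those of the free product of
   k[x_1, ..., x_n], F^(⊗n) and k S_n. *)
Reserved Notation "s ≡ t" (at level 70, no associativity).
Inductive awp_rel : term k awp_gen -> term k awp_gen -> Prop :=
| awp_xx i j : xg i · xg j ≡ xg j · xg i
| awp_tD u v : tg (u + v) ≡ Tadd (tg u) (tg v)
| awp_tZ a u : tg (a *: u) ≡ Tscale a (tg u)
| awp_tM u v : tg (tmul u v) ≡ tg u · tg v
| awp_t1 : tg (tone B n) ≡ Tone
| awp_pM p q : pg (q * p)%g ≡ pg p · pg q
| awp_p1 : pg 1%g ≡ Tone
| awp_tx u i : tg u · xg i ≡ xg i · tg (tmap_at psi i u)
| awp_sx (i i' j : 'I_n) : i' = i.+1 :> nat -> j <> i -> j <> i' ->
    pg (tperm i i') · xg j ≡ xg j · pg (tperm i i')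
| awp_sxx (i i' : 'I_n) : i' = i.+1 :> nat ->
    pg (tperm i i') · xg i ≡
      Tadd (xg i' · pg (tperm i i')) (Topp (tg (t_elt i i')))
| awp_pt p u : pg p · tg u ≡ tg (tperm_act p u) · pg p
where "s ≡ t" := (awp_rel s t).

Definition affineWreath : Type := presAlg awp_rel.
HB.instance Definition _ := GRing.PzRing.on affineWreath.
HB.instance Definition _ := GRing.Lmodule.on affineWreath.

Definition aw_x (i : 'I_n) : affineWreath := pgen awp_rel (Gx i).
Definition aw_tens (u : T) : affineWreath := pgen awp_rel (Gtens u).
Definition aw_perm (p : 'S_n) : affineWreath := pgen awp_rel (Gperm p).

Definition aw_monomial d (alpha : {ffun 'I_n -> 'I_d}) (J : {ffun 'I_n -> B})
    (p : 'S_n) : affineWreath :=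
  (\prod_(i < n) aw_x i ^+ alpha i) * aw_tens (btens J) * aw_perm p.

(* The tuple C is given by its lengths e r and entries c r j, of which only
   those with 1 <= r <= theta and j < e r matter. *)
Variables (i0 : 'I_n) (theta : nat) (e : nat -> nat) (c : nat -> nat -> T).

Definition chi : affineWreath :=
  \prod_(1 <= r < theta.+1) \prod_(j < e r) (aw_x i0 ^+ r - aw_tens (c r j)).

Definition level : nat := (\sum_(1 <= r < theta.+1) r * e r)%N.

Definition cyclotomicWreath : Type := quotRing (chi : presAlg awp_rel).
HB.instance Definition _ := GRing.PzRing.on cyclotomicWreath.
HB.instance Definition _ := GRing.Lmodule.on cyclotomicWreath.

Definition cw_monomial
    (a : {ffun 'I_n -> 'I_level} * {ffun 'I_n -> B} * 'S_n) : cyclotomicWreath :=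
  qpi chi (aw_monomial a.1.1 a.1.2 a.2).

End AffineWreath.

Arguments aw_tens {k F B psi bd n} u.
Arguments chi {k F B} psi bd {n} i0 theta e c.
Arguments cyclotomicWreath {k F B} psi bd {n} i0 theta e c.
Arguments cw_monomial {k F B} psi bd {n} i0 theta e c a.

(* Main.v *)
Require Import Defs.
From HB Require Import structures.
From mathcomp Require Import all_boot all_fingroup all_algebra.
From mathcomp Require Import boolp functions generic_quotient zify.

(** Write R for the n-th tensor power of F, W for the skew group ring R # S_n,
    and A for the affine wreath product algebra.  As chi is monic in x_1, with
    conjugates that are monic in the other variables, the given elements span
    the quotient.  The substance is that no further relation appears.

    First, A is a free right W-module on the monomials x^al.  To see it, A acts
    from the right on functions phi from words in the letters 1, ..., n to W,
    where phi stands for a right W-linear function on A and the word for the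
    product of its x_i.  How p in S_n acts is forced by the identity
      p x_i = x_(p i) p + p J_i - J_(p i) p,
    with J_i the sum over j < i of t_(j,i) (j i), a Jucys-Murphy element.  Used
    as a recursion on words, this identity defines the action of all
    permutations at once, and p q acts as it should because the corrections
    telescope (p_opM).  The x_i commute on functions that only depend on the
    letters of a word and not on their order; that S_n preserves these
    (symmetric_p) is a computation with adjacent transpositions, where
    psi_j(t_(i,j)) = t_(j,i) is what makes it work.  Evaluating dual functions
    gives the coefficient of x^al in an element of A (aw_coefE).

    Second, let chi_i = p chi p^-1 for p(1) = i.  This is well defined, because
    the elements c are invariant under the stabilizer of 1.  Since chi commutes
    with every x_j and normalizes R, the two-sided ideal generated by chi is the
    sum of the k[x] chi_i W (ideal_gen_chi_span).  Moreover chi_m is x_m^d plus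
    terms of lower degree in x_m that only involve the first m positions
    (chi_at_low).  Let K_m (chi_span m) be the sum of the k[x] chi_i W over the
    first m positions i, a right ideal, and U_m the span of the x^al W whose
    first m exponents are below d.  Then A is the direct sum of K_m and U_m, by
    induction on m.  That they span is division by the chi_i (box_reduce).  That
    they meet trivially (chi_span_box) follows by comparing leading terms: in
    A / K_m, which is U_m, the map x^al w |-> x^al chi w, with chi conjugated to
    the next position, is monic of degree d in the next variable.  For m = n
    this is the theorem.

    What remains is to see that R, with its signs, satisfies the identities used
    above: that t_(i,j) intertwines the two tensor factors up to psi (telt_comm)
    and that an even c in F_1^(r) satisfies f c = c psi_1^r(f) (F1_comm). *)

Set Implicit Arguments.
Unset Strict Implicit.
Unset Printing Implicit Defensive.

Import GRing.Theory.

Local Open Scope quotient_scope.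
Local Open Scope ring_scope.

(** * Modules of functions on words *)

Section Adjacent.
Variable n : nat.

(** A transposition of two positions is conjugate, by an adjacent transposition,
    to a transposition of closer positions. *)
Lemma adjacent_ind (P : 'S_n -> Prop) :
  P 1%g ->
  (forall (i i' : 'I_n) p, i' = i.+1 :> nat -> P p -> P (p * tperm i i')%g) ->
  forall p, P p.
Proof.
pose adj (q : 'S_n) := forall P : 'S_n -> Prop,
  (forall (i i' : 'I_n) p, i' = i.+1 :> nat -> P p -> P (p * tperm i i')%g) ->
  forall p, P p -> P (p * q)%g.
have adj1 : adj 1%g by move=> Q _ p; rewrite mulg1.
have adjM q q' : adj q -> adj q' -> adj (q * q')%g.
  by move=> aq aq' Q hQ p Qp; rewrite mulgA; apply: (aq' _ hQ); apply: aq.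
have adjt d : forall i j : 'I_n, (j = i + d.+1 :> nat)%N -> adj (tperm i j).
  elim: d => [|d IHd] i j; first by rewrite addn1 => ij Q hQ p; exact: hQ.
  rewrite addnS => ij.
  have lt_j' : (i + d.+1 < n)%N by rewrite (leq_trans _ (ltn_ord j)) // ij.
  pose j' := Ordinal lt_j'.
  have sj : adj (tperm j' j) by move=> Q hQ p; exact: hQ.
  have -> : (tperm i j = tperm j' j * tperm i j' * tperm j' j)%g.
    have ne_ij' : j' != i.
      apply/negP => /eqP/(congr1 val)/= /eqP.
      by rewrite -{2}[val i]addn0 eqn_add2l.
    have ne_ij : j != i.
      apply/negP => /eqP/(congr1 val)/= /eqP.
      by rewrite ij -addnS -{2}[val i]addn0 eqn_add2l.
    have := tpermJ i j' (tperm j' j).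
    by rewrite /conjg tpermV tpermL tpermD // mulgA => ->.
  exact: adjM _ _ (adjM _ _ sj (IHd i j' erefl)) sj.
move=> P1 hP p.
have [ts -> ts_ne] := prod_tpermP p.
suff: adj (\prod_(t <- ts) tperm t.1 t.2)%g by move=> /(_ P hP 1%g P1); rewrite mul1g.
elim: ts ts_ne => [|[i j] ts IHts] /=; first by rewrite big_nil.
case/andP=> ne_ij /IHts ats; rewrite big_cons; apply: adjM => //=.
case: (ltngtP i j) => [lt_ij|lt_ji|/val_inj eq_ij]; last by rewrite /= eq_ij eqxx in ne_ij.
- by apply: (adjt (j - i.+1)%N); rewrite addnS -addSn subnKC.
- by rewrite tpermC; apply: (adjt (i - j.+1)%N); rewrite addnS -addSn subnKC.
Qed.

End Adjacent.

(** The coefficient ring R of an affine wreath product algebra.  The last three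
    fields make the relation s x_i = x_(i+1) s - t_(i,i+1) compatible with
    r x_i = x_i psi_i(r) and with x_i x_j = x_j x_i. *)
Record wreathDatum (n : nat) (R : pzRingType) := WreathDatum {
  wd_act : 'S_n -> {rmorphism R -> R};
  wd_twist : 'I_n -> {rmorphism R -> R};
  wd_t : 'I_n -> 'I_n -> R;
  wd_act1 : forall r, wd_act 1%g r = r;
  wd_actM : forall p q r, wd_act (q * p)%g r = wd_act p (wd_act q r);
  wd_twistC : forall i j r, wd_twist i (wd_twist j r) = wd_twist j (wd_twist i r);
  wd_act_twist : forall p i r,
    wd_act p (wd_twist i r) = wd_twist (p i) (wd_act p r);
  wd_act_t : forall p i j, i != j -> wd_act p (wd_t i j) = wd_t (p i) (p j);
  wd_t_comm : forall i j r, i != j ->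
    r * wd_t i j = wd_t i j * wd_act (tperm i j) (wd_twist j r);
  wd_twist_t : forall i j l, i != j -> l != i -> l != j ->
    wd_twist l (wd_t i j) = wd_t i j;
  wd_twist_tr : forall i j, i != j -> wd_twist j (wd_t i j) = wd_t j i }.

Section WordModule.
Variables (n : nat) (R : pzRingType) (D : wreathDatum n R).
Local Notation act := (wd_act D).
Local Notation twist := (wd_twist D).
Local Notation t := (wd_t D).

(** w stands for the sum of the w q * q in the skew group ring R # S_n. *)
Notation smash := ({ffun 'S_n -> R}).

Definition smash_r (w : smash) (r : R) : smash := [ffun q => w q * act q r].
Definition smash_p (w : smash) (p : 'S_n) : smash := [ffun q => w (p^-1 * q)%g].

Lemma smash_r1 w : smash_r w 1 = w.
Proof. by apply/ffunP => q; rewrite !ffunE rmorph1 mulr1. Qed.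
Lemma smash_rM w r s : smash_r w (r * s) = smash_r (smash_r w r) s.
Proof. by apply/ffunP => q; rewrite !ffunE rmorphM mulrA. Qed.
Lemma smash_rD w r s : smash_r w (r + s) = smash_r w r + smash_r w s.
Proof. by apply/ffunP => q; rewrite !ffunE rmorphD mulrDr. Qed.
Lemma smash_rB v w r : smash_r (v - w) r = smash_r v r - smash_r w r.
Proof. by apply/ffunP => q; rewrite !ffunE mulrBl. Qed.
Lemma smash_p1 w : smash_p w 1%g = w.
Proof. by apply/ffunP => q; rewrite !ffunE invg1 mul1g. Qed.
Lemma smash_pM w p q : smash_p (smash_p w p) q = smash_p w (q * p)%g.
Proof. by apply/ffunP => s; rewrite !ffunE invMg mulgA. Qed.
Lemma smash_pB v w p : smash_p (v - w) p = smash_p v p - smash_p w p.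
Proof. by apply/ffunP => q; rewrite !ffunE. Qed.
Lemma smash_pr w p r : smash_r (smash_p w p) r = smash_p (smash_r w (act p r)) p.
Proof. by apply/ffunP => q; rewrite !ffunE -wd_actM mulKVg. Qed.

Local Notation Phi := (seq 'I_n -> smash).

(** phi is read as a right linear function on the affine algebra, known by its
    values on the products of the x_i along a word; the operators x_op, r_op and
    p_op turn phi into phi (a * _) for a generator a.  For a = r this uses
    r x_u = x_u psi_u(r), where psi_u is the product of the psi_i along u. *)
Definition x_op (i : 'I_n) (phi : Phi) : Phi := fun u => phi (i :: u).

Definition r_op (r : R) (phi : Phi) : Phi :=
  fun u => smash_r (phi u) (foldl (fun s i => twist i s) r u).

(** The value of phi at p x_i x_u', with p moved to the right by the identity
      p x_i = x_(p i) p + p J_i - J_(p i) p,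
    where J_i is the sum over j < i of t_(j,i) (j i).  The correction terms act
    on the shorter word u', so this is a recursion for all p together. *)
Fixpoint p_act (u : seq 'I_n) (p : 'S_n) (phi : Phi) : smash :=
  if u is i :: u' then
    p_act u' p (x_op (p i) phi)
    + \sum_(j < n | (j < i)%N) p_act u' (tperm j i * p)%g (r_op (t (p j) (p i)) phi)
    - \sum_(l < n | (l < p i)%N) p_act u' (p * tperm l (p i))%g (r_op (t l (p i)) phi)
  else smash_p (phi [::]) p.

Definition p_op (p : 'S_n) (phi : Phi) : Phi := fun u => p_act u p phi.

Lemma x_opB i : {morph x_op i : f g / f - g}.
Proof. by []. Qed.
HB.instance Definition _ i := GRing.isZmodMorphism.Build Phi Phi (x_op i) (x_opB i).

Lemma r_opB r : {morph r_op r : f g / f - g}.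
Proof. by move=> f g; apply/funext => u; rewrite /r_op smash_rB. Qed.
HB.instance Definition _ r := GRing.isZmodMorphism.Build Phi Phi (r_op r) (r_opB r).

Lemma p_actB u p : {morph p_act u p : f g / f - g}.
Proof.
elim: u p => [|i u IHu] p f g; first by rewrite /= smash_pB.
rewrite [LHS]/= x_opB IHu /=.
under eq_bigr do rewrite r_opB IHu; rewrite sumrB.
under [X in _ - X]eq_bigr do rewrite r_opB IHu; rewrite sumrB.
by rewrite !opprD !opprK [X in X + _ = _]addrACA [LHS]addrACA.
Qed.

Lemma p_opB p : {morph p_op p : f g / f - g}.
Proof. by move=> f g; apply/funext => u; apply: p_actB. Qed.
HB.instance Definition _ p := GRing.isZmodMorphism.Build Phi Phi (p_op p) (p_opB p).

Lemma r_op_comm (g : smash -> smash) r phi :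
  (forall w s, g (smash_r w s) = smash_r (g w) s) ->
  r_op r (g \o phi) = g \o r_op r phi.
Proof. by move=> gr; apply/funext => u; rewrite /r_op /= gr. Qed.

(** Applied to scalar multiplications, this gives the linearity of p_op. *)
Lemma p_op_comm (g : smash -> smash) p phi : {morph g : v w / v - w} ->
  (forall w s, g (smash_r w s) = smash_r (g w) s) ->
  (forall w q, g (smash_p w q) = smash_p (g w) q) ->
  p_op p (g \o phi) = g \o p_op p phi.
Proof.
move=> gB gr gp; apply/funext => u; rewrite /p_op /=.
have g0 : g 0 = 0 by rewrite -(subrr 0) gB !subrr.
have gD : {morph g : v w / v + w}.
  by move=> v w; rewrite -{1}[w]opprK gB -{1}[- w]sub0r gB g0 sub0r opprK.
elim: u p phi => [|i u IHu] p phi /=; first by rewrite gp.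
rewrite gB gD !(big_morph g gD g0) -IHu; congr (_ + _ - _);
  by apply: eq_bigr => j _; rewrite -IHu r_op_comm.
Qed.

Lemma x_p_op i p phi : x_op i (p_op p phi) =
  p_op p (x_op (p i) phi)
  + \sum_(j < n | (j < i)%N) p_op (tperm j i * p)%g (r_op (t (p j) (p i)) phi)
  - \sum_(l < n | (l < p i)%N) p_op (p * tperm l (p i))%g (r_op (t l (p i)) phi).
Proof. by apply/funext => u; rewrite !fct_sumE. Qed.

Lemma x_r_op i r phi : x_op i (r_op r phi) = r_op (twist i r) (x_op i phi).
Proof. by []. Qed.

Lemma foldl_twist1 u : foldl (fun s i => twist i s) 1 u = 1.
Proof. by elim: u => //= i u; rewrite rmorph1. Qed.
Lemma foldl_twistM u r s : foldl (fun s i => twist i s) (r * s) u =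
  foldl (fun s i => twist i s) r u * foldl (fun s i => twist i s) s u.
Proof. by elim: u r s => //= i u IHu r s; rewrite rmorphM. Qed.
Lemma foldl_twistD u r s : foldl (fun s i => twist i s) (r + s) u =
  foldl (fun s i => twist i s) r u + foldl (fun s i => twist i s) s u.
Proof. by elim: u r s => //= i u IHu r s; rewrite rmorphD. Qed.

Lemma r_op1 phi : r_op 1 phi = phi.
Proof. by apply/funext => u; rewrite /r_op foldl_twist1 smash_r1. Qed.
Lemma r_opM r s phi : r_op (r * s) phi = r_op s (r_op r phi).
Proof. by apply/funext => u; rewrite /r_op foldl_twistM smash_rM. Qed.
Lemma r_opD r s phi : r_op (r + s) phi = r_op r phi + r_op s phi.
Proof. by apply/funext => u; rewrite /r_op foldl_twistD smash_rD. Qed.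

Lemma ltn_neq_ord (i j : 'I_n) : (i < j)%N -> i != j.
Proof. by apply: contraTneq => ->; rewrite ltnn. Qed.

(** The corrections match because r J_i = J_i psi_i(r), summand by summand. *)
Lemma r_p_op p r phi : r_op r (p_op p phi) = p_op p (r_op (act p r) phi).
Proof.
apply/funext => u; elim: u p r phi => [|i u IHu] p r phi.
  by rewrite /r_op /p_op /= smash_pr.
rewrite -[LHS]/(x_op i _ u) x_r_op x_p_op -[RHS]/(x_op i _ u) x_p_op.
rewrite raddfB raddfD /= !raddf_sum /= ?sumrN x_r_op.
rewrite !(addrfctE, opprfctE, fct_sumE) /=; congr (_ + _ - _).
- by rewrite IHu wd_act_twist.
- apply: eq_bigr => j /ltn_neq_ord ne_ji; rewrite IHu /p_op -!r_opM.
  by rewrite wd_actM -wd_act_t // -!rmorphM -wd_t_comm.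
- apply: eq_bigr => l /ltn_neq_ord ne_li; rewrite IHu /p_op -!r_opM.
  by rewrite wd_actM wd_act_twist -wd_t_comm.
Qed.

(** The corrections telescope: p q J_i - J_(p q i) p q is the sum of
    p (q J_i - J_(q i) q) and (p J_(q i) - J_(p q i) p) q. *)
Lemma p_opM p q phi : p_op q (p_op p phi) = p_op (q * p)%g phi.
Proof.
apply/funext => u; elim: u p q phi => [|i u IHu] p q phi.
  by rewrite /p_op /= smash_pM.
rewrite -[LHS]/(x_op i _ u) x_p_op -[RHS]/(x_op i _ u) x_p_op.
rewrite x_p_op raddfB raddfD /= !raddf_sum /= ?sumrN !permM.
rewrite !(addrfctE, opprfctE, fct_sumE) /=.
set S1 := \sum_(j < n | (j < q i)%N) _; set S2 := \sum_(l < n | (l < p _)%N) _.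
set S3 := \sum_(j < n | (j < i)%N) _; set S4 := \sum_(l < n | (l < q i)%N) _.
have -> : S4 = S1.
  apply: eq_bigr => l /ltn_neq_ord ne_li.
  by rewrite r_p_op !IHu wd_act_t // -mulgA.
rewrite addrAC [X in X + S3]addrAC addrK IHu [LHS]addrAC; congr (_ + _ - _).
  apply: eq_bigr => j /ltn_neq_ord ne_ji.
  by rewrite r_p_op IHu wd_act_t ?(inj_eq perm_inj) // !permM mulgA.
by apply: eq_bigr => l _; rewrite IHu /p_op mulgA.
Qed.

Lemma p_op1 phi : p_op 1%g phi = phi.
Proof.
apply/funext => u; elim: u phi => [|i u IHu] phi; first by rewrite /p_op /= smash_p1.
rewrite -[LHS]/(x_op i _ u) x_p_op perm1 !(addrfctE, opprfctE, fct_sumE) /=.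
under eq_bigr do rewrite perm1 mulg1.
under [X in _ - X]eq_bigr do rewrite mul1g.
by rewrite addrK IHu.
Qed.

(** The set of the l < j is stable under the transposition of i and i + 1, so
    the corrections cancel in pairs. *)
Lemma x_s_op (i i' j : 'I_n) phi : i' = i.+1 :> nat -> j <> i -> j <> i' ->
  x_op j (p_op (tperm i i') phi) = p_op (tperm i i') (x_op j phi).
Proof.
move=> i'E /eqP ne_ji /eqP ne_ji'.
have sj : tperm i i' j = j by rewrite tpermD 1?eq_sym.
rewrite x_p_op sj -addrA [X in _ + X](_ : _ = 0) ?addr0 //; apply/eqP.
rewrite subr_eq0; apply/eqP.
rewrite [RHS](reindex_inj (@perm_inj _ (tperm i i'))).
apply: eq_big => l; last first.
  move=> _; congr (p_op _ _).
  by rewrite [LHS]conjgC tpermJ sj.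
have lt_i'j : (i' < j)%N = (i < j)%N.
  rewrite -[RHS]/(i.+1 <= j)%N -i'E [RHS]leq_eqVlt (inj_eq val_inj).
  by rewrite [i' == j]eq_sym (negPf ne_ji').
by case: tpermP => [->|->|//]; rewrite lt_i'j.
Qed.

(** Of the corrections, only the summand l = i of J_(i+1) survives. *)
Lemma x_s_op_l (i i' : 'I_n) phi : i' = i.+1 :> nat ->
  x_op i (p_op (tperm i i') phi) =
  p_op (tperm i i') (x_op i' phi) - r_op (t i i') phi.
Proof.
move=> i'E; rewrite x_p_op tpermL.
have lt_ii' : (i < i')%N by rewrite i'E.
rewrite [X in _ - X](bigD1 i) //= tperm2 p_op1 opprD addrA addrAC.
congr (_ - _); rewrite -addrA [X in _ + X](_ : _ = 0) ?addr0 //.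
apply/eqP; rewrite subr_eq0; apply/eqP.
have ne_i' (l : 'I_n) : (l < i)%N -> i' != l.
  by move=> lt_li; rewrite eq_sym ltn_neq_ord // i'E ltnW.
apply: eq_big => l; first by rewrite i'E ltnS ltn_neqAle andbC.
move=> lt_li; have /ltn_neq_ord ne_li := lt_li.
rewrite (tpermD (z := l)) 1?eq_sym ?(eq_sym l) ?ne_i' 1?eq_sym //.
congr (p_op _ _).
by rewrite [LHS]conjgC tpermJ tpermL tpermD 1?eq_sym ?(eq_sym l) ?ne_i' 1?eq_sym.
Qed.

Lemma x_s_op_r (i i' : 'I_n) phi : i' = i.+1 :> nat ->
  x_op i' (p_op (tperm i i') phi) =
  p_op (tperm i i') (x_op i phi) + r_op (t i' i) phi.
Proof.
move=> i'E; have lt_ii' : (i < i')%N by rewrite i'E.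
have := x_s_op_l (p_op (tperm i i') phi) i'E.
rewrite p_opM tperm2 p_op1 r_p_op wd_act_t ?ltn_neq_ord // tpermL tpermR.
move/(congr1 (p_op (tperm i i'))); rewrite raddfB /= !p_opM tperm2 !p_op1.
by move=> ->; rewrite subrK.
Qed.

(** The operators x_op only commute on functions that do not see the order of
    the letters of a word. *)
Definition symmetric_fun (phi : Phi) := forall w i j u,
  phi (w ++ [:: i, j & u]) = phi (w ++ [:: j, i & u]).

Lemma symmetric_xx phi i j : symmetric_fun phi ->
  x_op i (x_op j phi) = x_op j (x_op i phi).
Proof. by move=> sphi; apply/funext => u; exact: (sphi [::]). Qed.

Lemma symmetric_x phi i : symmetric_fun phi -> symmetric_fun (x_op i phi).
Proof. by move=> sphi w j l u; exact: (sphi (i :: w)). Qed.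

Lemma symmetric_r phi r : symmetric_fun phi -> symmetric_fun (r_op r phi).
Proof.
move=> sphi w i j u; rewrite /r_op sphi; congr (smash_r _ _).
by rewrite !foldl_cat /= wd_twistC.
Qed.

Lemma symmetric_N phi : symmetric_fun phi -> symmetric_fun (- phi).
Proof. by move=> s w i j u; rewrite opprfctE s. Qed.

Lemma symmetric_D phi phi' :
  symmetric_fun phi -> symmetric_fun phi' -> symmetric_fun (phi + phi').
Proof. by move=> s s' w i j u; rewrite addrfctE s s'. Qed.

(** At the head of a word, x_a and x_b give the same correction in either order
    because psi_b(t_(a,b)) = t_(b,a).  Further inside, the relations move s past
    the first letter, which shortens the prefix w. *)
Lemma symmetric_s phi (a b : 'I_n) : b = a.+1 :> nat ->
  symmetric_fun phi -> symmetric_fun (p_op (tperm a b) phi).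
Proof.
move=> bE.
have ne_ab : a != b by rewrite ltn_neq_ord // bE.
have ne_ba : b != a by rewrite eq_sym.
have xab f : symmetric_fun f ->
    x_op b (x_op a (p_op (tperm a b) f)) = x_op a (x_op b (p_op (tperm a b) f)).
  move=> sf; rewrite x_s_op_l // x_s_op_r // raddfB raddfD /=.
  rewrite x_s_op_l // x_s_op_r // !x_r_op !wd_twist_tr // addrK subrK.
  by rewrite symmetric_xx.
have xal f l : symmetric_fun f -> l <> a -> l <> b ->
    x_op l (x_op a (p_op (tperm a b) f)) = x_op a (x_op l (p_op (tperm a b) f)).
  move=> sf la lb; rewrite x_s_op_l // raddfB /= !(x_s_op _ bE la lb) x_s_op_l // x_r_op.
  by rewrite wd_twist_t //; [rewrite symmetric_xx|apply/eqP|apply/eqP].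
have xbl f l : symmetric_fun f -> l <> a -> l <> b ->
    x_op l (x_op b (p_op (tperm a b) f)) = x_op b (x_op l (p_op (tperm a b) f)).
  move=> sf la lb; rewrite x_s_op_r // raddfD /= !(x_s_op _ bE la lb) x_s_op_r // x_r_op.
  rewrite wd_twist_t //; [by rewrite symmetric_xx|exact/eqP|exact/eqP].
have xx f i j : symmetric_fun f ->
    x_op i (x_op j (p_op (tperm a b) f)) = x_op j (x_op i (p_op (tperm a b) f)).
  move=> sf.
  have [->|/eqP nja] := eqVneq j a; last have [->|/eqP njb] := eqVneq j b.
  - have [->|/eqP nia] := eqVneq i a; last have [->|/eqP nib] := eqVneq i b.
    + by [].
    + exact: xab.
    + exact: xal.
  - have [->|/eqP nia] := eqVneq i a; last have [->|/eqP nib] := eqVneq i b.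
    + by rewrite xab.
    + by [].
    + exact: xbl.
  - have [->|/eqP nia] := eqVneq i a; last have [->|/eqP nib] := eqVneq i b.
    + by rewrite xal.
    + by rewrite xbl.
    + by rewrite !(x_s_op _ bE) // symmetric_xx.
move=> sphi w i j u; elim: w phi sphi => [|l w IHw] phi sphi.
  by rewrite -[LHS]/(x_op j (x_op i _) u) xx.
rewrite -[LHS]/(x_op l _ (w ++ _)) -[RHS]/(x_op l _ (w ++ _)).
have [->|/eqP la] := eqVneq l a.
  rewrite x_s_op_l // addrfctE opprfctE; congr (_ - _).
    exact/IHw/symmetric_x.
  exact: symmetric_r.
have [->|/eqP lb] := eqVneq l b.
  rewrite x_s_op_r // addrfctE; congr (_ + _); first exact/IHw/symmetric_x.
  exact: symmetric_r.
by rewrite x_s_op //; exact/IHw/symmetric_x.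
Qed.

Lemma symmetric_p phi p : symmetric_fun phi -> symmetric_fun (p_op p phi).
Proof.
move=> sphi; have: forall phi, symmetric_fun phi -> symmetric_fun (p_op p phi).
  elim/adjacent_ind: p => [f|i i' p i'E IHp f]; first by rewrite p_op1.
  by move=> /(symmetric_s i'E)/IHp; rewrite p_opM.
exact.
Qed.

End WordModule.

(** * Normal forms in affine wreath product algebras *)

(** Additive spans are enough: scalars act through the coefficient ring. *)
Inductive add_span (V : zmodType) (Q : V -> Prop) : V -> Prop :=
| add_span0 : add_span Q 0
| add_span_gen x : Q x -> add_span Q x
| add_spanB x y : add_span Q x -> add_span Q y -> add_span Q (x - y).

Section AdditiveSpan.
Variable V : zmodType.
Implicit Types Q : V -> Prop.

Lemma add_spanN Q x : add_span Q x -> add_span Q (- x).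
Proof. by move=> Qx; rewrite -sub0r; apply: add_spanB => //; apply: add_span0. Qed.
Lemma add_spanD Q x y : add_span Q x -> add_span Q y -> add_span Q (x + y).
Proof. by move=> Qx Qy; rewrite -[y]opprK; apply: add_spanB => //; apply: add_spanN. Qed.
Lemma add_span_sum Q (I : Type) (s : seq I) (P : pred I) (f : I -> V) :
  (forall i, P i -> add_span Q (f i)) -> add_span Q (\sum_(i <- s | P i) f i).
Proof. by move=> h; apply: big_ind => //; [exact: add_span0|exact: add_spanD]. Qed.
Lemma add_span_map (V' : zmodType) Q (Q' : V' -> Prop) (f : V -> V') x :
  {morph f : a b / a - b} -> (forall y, Q y -> add_span Q' (f y)) ->
  add_span Q x -> add_span Q' (f x).
Proof.
move=> fB h; elim=> [|y /h//|y z _ Qy _ Qz]; last by rewrite fB; apply: add_spanB.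
by rewrite -(subrr 0) fB subrr; apply: add_span0.
Qed.
Lemma add_spanS Q Q' x : (forall y, Q y -> add_span Q' y) -> add_span Q x -> add_span Q' x.
Proof. by move=> h; apply: (add_span_map (f := id)). Qed.
End AdditiveSpan.

Lemma add_span_mul (A : pzRingType) (Q Q' : A -> Prop) a c x :
  (forall y, Q y -> add_span Q' (a * y * c)) -> add_span Q x -> add_span Q' (a * x * c).
Proof.
by apply: (add_span_map (f := fun y => a * y * c)) => y z; rewrite mulrBr mulrBl.
Qed.
Lemma add_span_mull (A : pzRingType) (Q Q' : A -> Prop) a x :
  (forall y, Q y -> add_span Q' (a * y)) -> add_span Q x -> add_span Q' (a * x).
Proof. by apply: (add_span_map (f := fun y => a * y)) => y z; rewrite mulrBr. Qed.
Lemma add_span_mulr (A : pzRingType) (Q Q' : A -> Prop) c x :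
  (forall y, Q y -> add_span Q' (y * c)) -> add_span Q x -> add_span Q' (x * c).
Proof. by apply: (add_span_map (f := fun y => y * c)) => y z; rewrite mulrBl. Qed.

Section Exponents.
Variable n : nat.
Local Notation E := ({ffun 'I_n -> nat}).

Definition expo0 : E := [ffun=> 0%N].
Definition expo_add (a b : E) : E := [ffun i => (a i + b i)%N].
Definition expo_at (i : 'I_n) (m : nat) : E := [ffun j => if j == i then m else 0%N].

Lemma expo_ind (P : E -> Prop) :
  P expo0 -> (forall i a, P a -> P (expo_add (expo_at i 1) a)) -> forall a, P a.
Proof.
move=> P0 hP a; have [m] := ubnP (\sum_i a i)%N.
elim: m a => // m IHm a; rewrite ltnS => lea.
have [/forallP a0|] := boolP [forall i, a i == 0%N].
  suff -> : a = expo0 by [].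
  by apply/ffunP => i; rewrite ffunE (eqP (a0 i)).
rewrite negb_forall => /existsP[i ai].
pose a' : E := [ffun j => (a j - (j == i))%N].
have -> : a = expo_add (expo_at i 1) a'.
  apply/ffunP => j; rewrite !ffunE; case: eqVneq => [->|_]; last by rewrite subn0.
  by rewrite subnKC // lt0n.
apply/hP/IHm; apply: leq_trans lea.
rewrite (bigD1 i) //= [X in (_ < X)%N](bigD1 i) //= ffunE eqxx.
rewrite -addSn -subSn ?lt0n // subn1 leq_add2l.
by apply: leq_sum => j ne_ji; rewrite ffunE (negPf ne_ji) subn0.
Qed.
End Exponents.
Arguments expo0 {n}.

(** A ring with the relations and generators of an affine wreath product
    algebra.  The field ad_coefE is the independence half of the normal form
    theorem: the coefficient of x^al is well defined. *)
Record affineDatum (n : nat) (R : pzRingType) (D : wreathDatum n R)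
    (A : pzRingType) := AffineDatum {
  ad_x : 'I_n -> A;
  ad_r : {rmorphism R -> A};
  ad_p : 'S_n -> A;
  ad_coef : {ffun 'I_n -> nat} -> A -> {ffun 'S_n -> R};
  ad_xx : forall i j, ad_x i * ad_x j = ad_x j * ad_x i;
  ad_pM : forall p q, ad_p (q * p)%g = ad_p p * ad_p q;
  ad_p1 : ad_p 1%g = 1;
  ad_rx : forall r i, ad_r r * ad_x i = ad_x i * ad_r (wd_twist D i r);
  ad_sx : forall i i' j : 'I_n, i' = i.+1 :> nat -> j <> i -> j <> i' ->
    ad_p (tperm i i') * ad_x j = ad_x j * ad_p (tperm i i');
  ad_sxx : forall i i' : 'I_n, i' = i.+1 :> nat ->
    ad_p (tperm i i') * ad_x i =
    ad_x i' * ad_p (tperm i i') - ad_r (wd_t D i i');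
  ad_pr : forall p r, ad_p p * ad_r r = ad_r (wd_act D p r) * ad_p p;
  ad_gen : forall Q : A -> Prop, Q 1 -> (forall a b, Q a -> Q b -> Q (a - b)) ->
    (forall i a, Q a -> Q (ad_x i * a)) -> (forall r a, Q a -> Q (ad_r r * a)) ->
    (forall p a, Q a -> Q (ad_p p * a)) -> forall a, Q a;
  ad_coefB : forall al, {morph ad_coef al : a b / a - b};
  ad_coefE : forall (al be : {ffun 'I_n -> nat}) r p,
    ad_coef al ((\prod_i ad_x i ^+ be i) * ad_r r * ad_p p) =
    if al == be then [ffun q => if q == p then r else 0] else 0 }.

Section Affine.
Variables (n : nat) (R : pzRingType) (D : wreathDatum n R) (A : pzRingType).
Variable X : affineDatum D A.
Local Notation E := ({ffun 'I_n -> nat}).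
Local Notation x := (ad_x X).
Local Notation rr := (ad_r X).
Local Notation pp := (ad_p X).
Local Notation act := (wd_act D).
Local Notation twist := (wd_twist D).
Local Notation t := (wd_t D).

Definition xmon (al : E) : A := \prod_i x i ^+ al i.

Lemma comm_xX i j a b : x i ^+ a * x j ^+ b = x j ^+ b * x i ^+ a.
Proof. by apply/commrX/commr_sym/commrX; exact: ad_xx. Qed.

Lemma xmonD al be : xmon (expo_add al be) = xmon al * xmon be.
Proof.
rewrite /xmon; elim: (index_enum _) => [|i s IHs]; first by rewrite !big_nil mulr1.
rewrite !big_cons IHs ffunE exprD -!mulrA; congr (_ * _); rewrite !mulrA.
congr (_ * _); apply: commr_prod => j _; exact: comm_xX.
Qed.

Lemma xmon0 : xmon expo0 = 1.
Proof. by rewrite /xmon big1 // => i _; rewrite ffunE expr0. Qed.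

Lemma xmon_at i m : xmon (expo_at i m) = x i ^+ m.
Proof.
rewrite /xmon; transitivity (\prod_(j < n | j == i) x j ^+ m); last exact: big_pred1_eq.
rewrite [RHS]big_mkcond.
by apply: eq_bigr => j _; rewrite ffunE /=; case: eqP => // ->.
Qed.

Lemma xmon_x i al : xmon (expo_add (expo_at i 1) al) = x i * xmon al.
Proof. by rewrite xmonD xmon_at expr1. Qed.

Lemma xmonC al be : xmon al * xmon be = xmon be * xmon al.
Proof.
by rewrite -!xmonD; congr xmon; apply/ffunP => i; rewrite !ffunE addnC.
Qed.

Lemma r_xmon r al : exists r', rr r * xmon al = xmon al * rr r'.
Proof.
elim/expo_ind: al r => [|i al IHal] r; first by exists r; rewrite xmon0 mulr1 mul1r.
have [r' Er'] := IHal (twist i r); exists r'.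
by rewrite xmon_x mulrA ad_rx -!mulrA Er'.
Qed.

(** The corrections that make the x_i - J_i permutable, see pp_x. *)
Definition jucys_murphy (i : 'I_n) : A :=
  \sum_(j < n | (j < i)%N) rr (t j i) * pp (tperm j i).

Lemma pp_jucys_murphy (a b : 'I_n) : b = a.+1 :> nat ->
  pp (tperm a b) * jucys_murphy a =
  (jucys_murphy b - rr (t a b) * pp (tperm a b)) * pp (tperm a b).
Proof.
move=> bE; rewrite /jucys_murphy [\sum_(j < n | (j < b)%N) _](bigD1 a) ?bE //=.
rewrite addrC addrK mulr_sumr mulr_suml.
have ne_b (l : 'I_n) : (l < a)%N -> b != l.
  by move=> lt_la; rewrite eq_sym ltn_neq_ord // bE ltnW.
apply: eq_big => l; first by rewrite ltnS ltn_neqAle andbC.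
move=> lt_la; have ne_la := ltn_neq_ord lt_la.
have sl : tperm a b l = l by rewrite tpermD ?ne_b // eq_sym.
rewrite mulrA ad_pr wd_act_t // tpermL sl -!mulrA -!ad_pM; congr (_ * pp _).
by rewrite [LHS]conjgC tpermJ tpermL sl.
Qed.

Lemma pp_jucys_murphy_fix (a b i : 'I_n) : b = a.+1 :> nat -> i <> a -> i <> b ->
  pp (tperm a b) * jucys_murphy i = jucys_murphy i * pp (tperm a b).
Proof.
move=> bE /eqP ne_ia /eqP ne_ib.
have si : tperm a b i = i by rewrite tpermD 1?eq_sym.
rewrite /jucys_murphy mulr_sumr mulr_suml [RHS](reindex_inj (@perm_inj _ (tperm a b))).
have lt_bi : (b < i)%N = (a < i)%N.
  rewrite -[RHS]/(a.+1 <= i)%N -bE [RHS]leq_eqVlt (inj_eq val_inj).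
  by rewrite [b == i]eq_sym (negPf ne_ib).
apply: eq_big => l; first by case: tpermP => [->|->|//]; rewrite lt_bi.
move=> /ltn_neq_ord ne_li.
rewrite mulrA ad_pr wd_act_t // si -!mulrA -!ad_pM; congr (_ * pp _).
by rewrite [LHS]conjgC tpermJ si.
Qed.

Lemma ppK i j : pp (tperm i j) * pp (tperm i j) = 1.
Proof. by rewrite -ad_pM tperm2 ad_p1. Qed.

Lemma ad_sxx_r (a b : 'I_n) : b = a.+1 :> nat ->
  pp (tperm a b) * x b = x a * pp (tperm a b) + rr (t b a).
Proof.
move=> bE; have lt_ab : (a < b)%N by rewrite bE.
have /(congr1 (fun z => pp (tperm a b) * z * pp (tperm a b))) := ad_sxx X bE.
rewrite mulrA ppK mul1r mulrBr mulrBl -!mulrA ppK mulr1 [in X in _ - X]mulrA.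
rewrite ad_pr wd_act_t ?ltn_neq_ord // tpermL tpermR -mulrA ppK mulr1.
by move=> ->; rewrite subrK.
Qed.

(** Equivalently, p (x_i - J_i) = (x_(p i) - J_(p i)) p, which only has to be
    checked on adjacent transpositions. *)
Lemma pp_x p i : pp p * x i =
  x (p i) * pp p + (pp p * jucys_murphy i - jucys_murphy (p i) * pp p).
Proof.
suff: forall i, pp p * (x i - jucys_murphy i) = (x (p i) - jucys_murphy (p i)) * pp p.
  move=> /(_ i); rewrite mulrBr mulrBl => /eqP.
  by rewrite subr_eq => /eqP ->; rewrite addrAC addrA.
move: i => _; elim/adjacent_ind: p => [|a b p bE IHp] i.
  by rewrite ad_p1 perm1 mul1r mulr1.
rewrite ad_pM -mulrA IHp mulrA permM; set j := p i; rewrite [RHS]mulrA.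
congr (_ * _); rewrite mulrBr mulrBl.
have [->|/eqP nja] := eqVneq j a; last have [->|/eqP njb] := eqVneq j b.
- rewrite tpermL ad_sxx // pp_jucys_murphy // mulrBl -mulrA ppK mulr1 opprB addrA.
  by rewrite subrK.
- rewrite tpermR ad_sxx_r //.
  have := pp_jucys_murphy bE.
  move/(congr1 (fun z => pp (tperm a b) * z * pp (tperm a b))).
  rewrite mulrA ppK mul1r -!mulrA ppK mulr1 mulrBr => ->.
  rewrite mulrA ad_pr wd_act_t ?ltn_neq_ord ?bE // tpermL tpermR -mulrA ppK mulr1.
  by rewrite opprB addrA addrAC.
- by rewrite tpermD 1?eq_sym; [rewrite ad_sx // pp_jucys_murphy_fix|apply/eqP|apply/eqP].
Qed.

Definition is_rp (a : A) := exists r p, a = rr r * pp p.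
Definition is_xrp (a : A) := exists al r p, a = xmon al * rr r * pp p.

Lemma jucys_murphy_span i : add_span is_rp (jucys_murphy i).
Proof. by apply: add_span_sum => j _; apply: add_span_gen; do 2!eexists. Qed.

Lemma pp_x_span p i : add_span is_rp (pp p * x i - x (p i) * pp p).
Proof.
rewrite pp_x addrC addKr; apply: add_spanB.
  apply: add_span_mull (jucys_murphy_span i) => _ [r [q ->]]; apply: add_span_gen.
  by exists (act p r), (q * p)%g; rewrite mulrA ad_pr ad_pM mulrA.
apply: add_span_mulr (jucys_murphy_span _) => _ [r [q ->]]; apply: add_span_gen.
by exists r, (p * q)%g; rewrite -mulrA ad_pM.
Qed.

Lemma is_xrp_r a r : is_xrp a -> is_xrp (a * rr r).
Proof.
case=> al [s [p ->]]; exists al, (s * act p r), p.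
by rewrite -!mulrA ad_pr rmorphM !mulrA.
Qed.
Lemma is_xrp_p a p : is_xrp a -> is_xrp (a * pp p).
Proof. by case=> al [s [q ->]]; exists al, s, (p * q)%g; rewrite ad_pM !mulrA. Qed.
Lemma is_xrp_rl a r : is_xrp a -> is_xrp (rr r * a).
Proof.
case=> al [s [p ->]]; have [r' Er'] := r_xmon r al; exists al, (r' * s), p.
by rewrite !mulrA Er' rmorphM !mulrA.
Qed.
Lemma is_xrp_xl a i : is_xrp a -> is_xrp (x i * a).
Proof.
by case=> al [s [p ->]]; exists (expo_add (expo_at i 1) al), s, p; rewrite xmon_x !mulrA.
Qed.

(** The coefficients are forgotten, but the permutations stay in {s, 1}: this
    keeps track of which positions are moved. *)
Lemma s_xmon (a b : 'I_n) al : b = a.+1 :> nat ->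
  add_span (fun z => exists ga r q, [/\ z = xmon ga * rr r * pp q &
    q = tperm a b \/ q = 1%g]) (pp (tperm a b) * xmon al).
Proof.
move=> bE; elim/expo_ind: al => [|i al IHal].
  rewrite xmon0 mulr1; apply: add_span_gen; exists expo0, 1, (tperm a b).
  by split; [rewrite xmon0 mul1r rmorph1 mul1r|left].
set Q := (fun z => _) in IHal *.
have xQ j : add_span Q (x j * (pp (tperm a b) * xmon al)).
  apply: add_span_mull IHal => _ [ga [r [q [-> hq]]]]; apply: add_span_gen.
  by exists (expo_add (expo_at j 1) ga), r, q; rewrite xmon_x !mulrA.
have rQ r : add_span Q (rr r * xmon al).
  have [r' ->] := r_xmon r al; apply: add_span_gen; exists al, r', 1%g.
  by rewrite ad_p1 mulr1; split=> //; right.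
rewrite xmon_x mulrA.
have [->|/eqP nia] := eqVneq i a; last have [->|/eqP nib] := eqVneq i b.
- by rewrite ad_sxx // mulrBl -mulrA; apply: add_spanB.
- by rewrite ad_sxx_r // mulrDl -mulrA; apply: add_spanD.
- by rewrite ad_sx // -mulrA.
Qed.

Lemma p_xmon p al : add_span is_xrp (pp p * xmon al).
Proof.
elim/adjacent_ind: p => [|a b p bE IHp].
  rewrite ad_p1 mul1r; apply: add_span_gen; exists al, 1, 1%g.
  by rewrite rmorph1 ad_p1 !mulr1.
rewrite ad_pM -mulrA; apply: add_span_mull IHp => _ [ga [r [q ->]]].
rewrite !mulrA; apply: (@add_span_mulr _ is_xrp).
  by move=> y hy; apply/add_span_gen/is_xrp_p.
apply: (@add_span_mulr _ is_xrp).
  by move=> y hy; apply/add_span_gen/is_xrp_r.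
apply: add_spanS (s_xmon ga bE) => _ [de [s [q' [-> _]]]].
by apply: add_span_gen; exists de, s, q'.
Qed.

Lemma span_xrp a : add_span is_xrp a.
Proof.
move: a; apply: (@ad_gen _ _ _ _ X (add_span is_xrp)) => [|a b||r a|p a].
- by apply: add_span_gen; exists expo0, 1, 1%g; rewrite xmon0 rmorph1 ad_p1 !mulr1.
- exact: add_spanB.
- by move=> i a; apply: add_span_mull => y /(is_xrp_xl i) hy; apply: add_span_gen.
- by apply: add_span_mull => y /(is_xrp_rl r) hy; apply: add_span_gen.
- apply: add_span_mull => _ [al [r [q ->]]]; rewrite !mulrA.
  apply: (@add_span_mulr _ is_xrp) => [y hy|]; first exact/add_span_gen/is_xrp_p.
  apply: (@add_span_mulr _ is_xrp) => [y hy|]; first exact/add_span_gen/is_xrp_r.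
  exact: p_xmon.
Qed.

Definition of_smash (w : {ffun 'S_n -> R}) : A := \sum_p rr (w p) * pp p.

Lemma of_smashB v w : of_smash (v - w) = of_smash v - of_smash w.
Proof.
by rewrite /of_smash -sumrB; apply: eq_bigr => p _; rewrite !ffunE rmorphB mulrBl.
Qed.
Lemma of_smash0 : of_smash 0 = 0.
Proof. by rewrite -(subrr 0) of_smashB subrr. Qed.

Definition smash_delta p r : {ffun 'S_n -> R} := [ffun q => if q == p then r else 0].

Lemma of_smash_delta p r : of_smash (smash_delta p r) = rr r * pp p.
Proof.
rewrite /of_smash (bigD1 p) //= ffunE eqxx big1 ?addr0 // => q /negPf ne_qp.
by rewrite ffunE ne_qp rmorph0 mul0r.
Qed.

Local Notation coef := (ad_coef X).

Lemma ad_coef0 al : coef al 0 = 0.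
Proof. by rewrite -(subrr 0) ad_coefB subrr. Qed.
Lemma ad_coefN al a : coef al (- a) = - coef al a.
Proof. by rewrite -sub0r ad_coefB ad_coef0 sub0r. Qed.
Lemma ad_coefD al a b : coef al (a + b) = coef al a + coef al b.
Proof. by rewrite -{1}[b]opprK ad_coefB ad_coefN opprK. Qed.
Lemma ad_coef_sum al (I : Type) (s : seq I) (P : pred I) (f : I -> A) :
  coef al (\sum_(i <- s | P i) f i) = \sum_(i <- s | P i) coef al (f i).
Proof. by apply: (big_morph (coef al)); [exact: ad_coefD|exact: ad_coef0]. Qed.

Lemma coef_xmon al be r p :
  coef al (xmon be * rr r * pp p) = if al == be then smash_delta p r else 0.
Proof. exact: ad_coefE. Qed.

Lemma coef_xmon_smash al be w : coef al (xmon be * of_smash w) = if al == be then w else 0.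
Proof.
rewrite /of_smash mulr_sumr ad_coef_sum.
under eq_bigr do rewrite mulrA coef_xmon.
case: eqP => _; last by rewrite big1.
apply/ffunP => p; rewrite sum_ffunE (bigD1 p) //= ffunE eqxx big1 ?addr0 // => q.
by rewrite ffunE eq_sym => /negPf ->.
Qed.

Lemma finite_support a :
  exists2 L : seq E, uniq L & forall al, al \notin L -> coef al a = 0.
Proof.
elim: (span_xrp a) => [|_ [al [r [p ->]]]|b c _ [L1 u1 h1] _ [L2 u2 h2]].
- by exists [::] => // al _; rewrite ad_coef0.
- by exists [:: al] => // be; rewrite inE coef_xmon => /negPf ->.
- exists (undup (L1 ++ L2)) => [|al]; first exact: undup_uniq.
  rewrite mem_undup mem_cat => /norP[/h1 al1 /h2 al2].
  by rewrite ad_coefB al1 al2 subrr.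
Qed.

Definition supp a : seq E := s2val (cid2 (finite_support a)).
Lemma supp_uniq a : uniq (supp a).
Proof. exact: (s2valP (cid2 (finite_support a))). Qed.
Lemma coef_supp a al : al \notin supp a -> coef al a = 0.
Proof. exact: (s2valP' (cid2 (finite_support a))). Qed.

(** The right R # S_n-linear map that sends x^al to g al. *)
Definition xlift (g : E -> A) (a : A) : A :=
  \sum_(al <- supp a) g al * of_smash (coef al a).

Lemma xlift_seq g a L : uniq L -> {subset supp a <= L} ->
  xlift g a = \sum_(al <- L) g al * of_smash (coef al a).
Proof.
move=> uL sL; rewrite /xlift [RHS](bigID (mem (supp a))) /=.
rewrite [X in _ + X]big1 ?addr0 => [|al /coef_supp ->]; last by rewrite of_smash0 mulr0.
rewrite -[RHS]big_filter; apply: perm_big; apply: uniq_perm.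
- exact: supp_uniq.
- exact: filter_uniq.
- by move=> al; rewrite mem_filter /= andb_idr // => /sL.
Qed.

Lemma xliftB g : {morph xlift g : a b / a - b}.
Proof.
move=> a b; pose L := undup (supp a ++ supp b ++ supp (a - b)).
have uL : uniq L by exact: undup_uniq.
rewrite !(@xlift_seq g _ L) // => [|al|al|al]; last 3 first.
- by rewrite mem_undup !mem_cat => ->; rewrite ?orbT.
- by rewrite mem_undup !mem_cat => ->; rewrite ?orbT.
- by rewrite mem_undup !mem_cat => ->; rewrite ?orbT.
by rewrite -sumrB; apply: eq_bigr => al _; rewrite ad_coefB of_smashB mulrBr.
Qed.

Lemma xlift_xrp g al r p : xlift g (xmon al * rr r * pp p) = g al * rr r * pp p.
Proof.
pose L := undup (al :: supp (xmon al * rr r * pp p)).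
have uL : uniq L by exact: undup_uniq.
rewrite (@xlift_seq g _ L) // => [|be]; last by rewrite mem_undup inE => ->; rewrite orbT.
rewrite (bigD1_seq al) //=; last by rewrite mem_undup inE eqxx.
rewrite coef_xmon eqxx of_smash_delta big1 ?addr0 ?mulrA // => be /negPf ne.
by rewrite coef_xmon ne of_smash0 mulr0.
Qed.

Lemma xlift_id a : xlift xmon a = a.
Proof.
elim: (span_xrp a) => [|_ [al [r [p ->]]]|b c _ hb _ hc].
- by rewrite -(subrr 0) xliftB !subrr.
- by rewrite xlift_xrp.
- by rewrite xliftB hb hc.
Qed.

Lemma coef_inj a : (forall al, coef al a = 0) -> a = 0.
Proof.
by move=> h; rewrite -[a]xlift_id /xlift big1 // => al _; rewrite h of_smash0 mulr0.
Qed.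

End Affine.

(** * The ideal generated by a cyclotomic polynomial *)

(** These properties pass to products, so for chi they only have to be checked
    on the factors x_1^r - c. *)
Record cyclotomicPoly (n : nat) (R : pzRingType) (D : wreathDatum n R)
    (A : pzRingType) (X : affineDatum D A) (i0 : 'I_n) (d : nat) (z : A) : Prop :=
  CyclotomicPoly {
  cp_x : forall j, z * ad_x X j = ad_x X j * z;
  cp_r : forall r, exists r', ad_r X r * z = z * ad_r X r';
  cp_p : forall p : 'S_n, p i0 = i0 -> ad_p X p * z = z * ad_p X p;
  cp_lead : add_span (fun y => exists j r, [/\ (j < d)%N & y = ad_x X i0 ^+ j * ad_r X r])
    (z - ad_x X i0 ^+ d) }.

Section Cyclotomic.
Variables (n : nat) (R : pzRingType) (D : wreathDatum n R) (A : pzRingType).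
Variable X : affineDatum D A.
Variables (i0 : 'I_n) (i0E : i0 = 0%N :> nat) (d : nat) (z : A).
Hypothesis zP : cyclotomicPoly X i0 d z.
Local Notation E := ({ffun 'I_n -> nat}).
Local Notation x := (ad_x X).
Local Notation rr := (ad_r X).
Local Notation pp := (ad_p X).
Local Notation xmon := (xmon X).
Local Notation of_smash := (of_smash X).
Local Notation coef := (ad_coef X).
Local Notation act := (wd_act D).

(** The conjugate of z that belongs to position i.  It is locked because
    rewriting by associativity would otherwise open the product. *)
Definition chi_at (i : 'I_n) : A := locked (pp (tperm i0 i) * z * pp (tperm i0 i)).

Lemma chi_at0 : chi_at i0 = z.
Proof. by rewrite /chi_at -!lock tperm1 ad_p1 mul1r mulr1. Qed.

(** Two permutations that send i0 to the same position differ by a permutation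
    that fixes i0, with which z commutes. *)
Lemma p_chi_at q i : pp q * chi_at i = chi_at (q i) * pp q.
Proof.
pose p := (tperm i0 i * q * tperm i0 (q i))%g.
have p0 : p i0 = i0 by rewrite !permM tpermL tpermR.
have := cp_p zP p0; rewrite /p !ad_pM.
move/(congr1 (fun y => pp (tperm i0 (q i)) * y * pp (tperm i0 i))).
rewrite -!mulrA ppK mulr1 [X in X = _]mulrA ppK mul1r => pz.
by rewrite /chi_at -!lock -!mulrA pz.
Qed.

Lemma r_chi_at i r : exists r', rr r * chi_at i = chi_at i * rr r'.
Proof.
have [r1 E1] := cp_r zP (act (tperm i0 i) r).
exists (act (tperm i0 i) r1); rewrite /chi_at -!lock.
have rK s : act (tperm i0 i) (act (tperm i0 i) s) = s.
  by rewrite -wd_actM tperm2 wd_act1.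
by rewrite -{1}[r]rK !mulrA -ad_pr -[_ * _ * z]mulrA E1 -!mulrA ad_pr rK.
Qed.

Definition is_chi_term (m : nat) (a : A) := exists al (i : 'I_n) r p,
  (i < m)%N /\ a = xmon al * chi_at i * rr r * pp p.
(** This grows with m from 0 to the ideal generated by z, see
    ideal_gen_chi_span. *)
Definition chi_span m := add_span (is_chi_term m).

Lemma chi_span_le m m' a : (m <= m')%N -> chi_span m a -> chi_span m' a.
Proof.
move=> le_mm'; apply: add_spanS => _ [al [i [r [p [lt_im ->]]]]].
by apply: add_span_gen; exists al, i, r, p; split=> //; exact: leq_trans le_mm'.
Qed.

Lemma chi_span_chi_at m (i : 'I_n) : (i < m)%N -> chi_span m (chi_at i).
Proof.
move=> lt_im; apply: add_span_gen; exists expo0, i, 1, 1%g; split=> //.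
by rewrite xmon0 rmorph1 ad_p1 mul1r !mulr1.
Qed.

Lemma chi_span_xml m al a : chi_span m a -> chi_span m (xmon al * a).
Proof.
apply: add_span_mull => _ [be [i [r [p [lt_im ->]]]]]; apply: add_span_gen.
by exists (expo_add al be), i, r, p; rewrite xmonD !mulrA.
Qed.

Lemma chi_span_xl m j a : chi_span m a -> chi_span m (x j * a).
Proof. by rewrite -[x j]expr1 -xmon_at; apply: chi_span_xml. Qed.

Lemma chi_span_rl m r a : chi_span m a -> chi_span m (rr r * a).
Proof.
apply: add_span_mull => _ [be [i [s [p [lt_im ->]]]]]; apply: add_span_gen.
have [r1 E1] := r_xmon X r be; have [r2 E2] := r_chi_at i r1.
exists be, i, (r2 * s), p; split=> //.
by rewrite !mulrA E1 -(mulrA (xmon be) (rr r1)) E2 rmorphM !mulrA.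
Qed.

Lemma chi_span_rr m r a : chi_span m a -> chi_span m (a * rr r).
Proof.
apply: add_span_mulr => _ [be [i [s [p [lt_im ->]]]]]; apply: add_span_gen.
by exists be, i, (s * act p r), p; rewrite rmorphM -!mulrA ad_pr.
Qed.

Lemma chi_span_pr m q a : chi_span m a -> chi_span m (a * pp q).
Proof.
apply: add_span_mulr => _ [be [i [s [p [lt_im ->]]]]]; apply: add_span_gen.
by exists be, i, s, (q * p)%g; rewrite ad_pM mulrA.
Qed.

Lemma chi_span_rpr m y a : add_span (is_rp X) y -> chi_span m a -> chi_span m (a * y).
Proof.
move=> hy Ka; move: hy; apply: add_span_mull => _ [r [p ->]]; rewrite mulrA.
exact/chi_span_pr/chi_span_rr.
Qed.

Lemma chi_span_s m (a b : 'I_n) y : b = a.+1 :> nat -> (b < m)%N ->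
  chi_span m y -> chi_span m (pp (tperm a b) * y).
Proof.
move=> bE lt_bm; apply: add_span_mull => _ [be [i [s [p [lt_im ->]]]]].
rewrite !mulrA; apply/chi_span_pr/chi_span_rr.
have := s_xmon X be bE; apply: add_span_mulr => _ [ga [r [q [-> hq]]]].
have lt_qi : (q i < m)%N.
  case: hq => ->; last by rewrite perm1.
  by case: tpermP => // _; rewrite // (leq_trans _ lt_bm) // bE.
rewrite -!mulrA p_chi_at; apply/chi_span_xml/chi_span_rl/chi_span_pr.
exact: chi_span_chi_at.
Qed.

(** z commutes with the x_l.  The conjugate by s = (i - 1, i) commutes with x_l
    up to terms s chi_(i-1) r p = chi_i r' p', once chi_(i-1) commutes with the
    x_l up to terms chi_j with j < i. *)
Lemma chi_span_chi_at_x (i l : 'I_n) : chi_span i.+1 (chi_at i * x l).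
Proof.
case: i => i lt_in; elim: i lt_in l => [|i IHi] lt_in l.
  have -> : Ordinal lt_in = i0 by apply: val_inj; rewrite /= i0E.
  rewrite {1}chi_at0 (cp_x zP); apply: chi_span_xl; rewrite -{1}chi_at0.
  by apply: chi_span_chi_at; rewrite i0E.
set b := Ordinal lt_in; pose a := Ordinal (ltnW lt_in).
have bE : b = a.+1 :> nat by [].
have -> : chi_at b * x l = pp (tperm a b) * (chi_at a * (pp (tperm a b) * x l)).
  rewrite mulrA p_chi_at tpermL -!mulrA; congr (_ * _); rewrite mulrA ppK.
  by rewrite mul1r.
apply: (chi_span_s bE) => //.
rewrite -[pp _ * x l](subrK (x (tperm a b l) * pp (tperm a b))) mulrDr.
apply: add_spanD; first by apply: chi_span_rpr (pp_x_span _ _ _) _; exact: chi_span_chi_at.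
by rewrite mulrA; apply: chi_span_pr; apply: chi_span_le (IHi _ _).
Qed.

Lemma chi_span_xr m l a : chi_span m a -> chi_span m (a * x l).
Proof.
apply: add_span_mulr => _ [be [i [s [p [lt_im ->]]]]].
rewrite -mulrA -[pp p * x l](subrK (x (p l) * pp p)) mulrDr; apply: add_spanD.
  apply: chi_span_rpr (pp_x_span _ _ _) _; rewrite -mulrA; apply: chi_span_xml.
  exact/chi_span_rr/chi_span_chi_at.
rewrite mulrA; apply: chi_span_pr.
rewrite -mulrA ad_rx mulrA; apply: chi_span_rr; rewrite -mulrA; apply: chi_span_xml.
exact: chi_span_le (chi_span_chi_at_x _ _).
Qed.

Lemma chi_span_mulr m a b : chi_span m a -> chi_span m (a * b).
Proof.
move=> Ka; have := span_xrp X b; apply: add_span_mull => _ [al [r [p ->]]].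
rewrite !mulrA; apply/chi_span_pr/chi_span_rr.
elim/expo_ind: al a Ka => [|i al IHal] a Ka; first by rewrite xmon0 mulr1.
by rewrite xmon_x mulrA; apply/IHal/chi_span_xr.
Qed.

(** Since z commutes with the x_j, the ideal A z A is k[x] W z W, where W is
    the image of R # S_n; and W z W is the sum of the chi_i W. *)
Lemma ideal_gen_chi_span a : ideal_gen z a <-> chi_span n a.
Proof.
split=> [|Ka I hI Iz]; last first.
  elim: Ka => [|_ [al [i [r [p [_ ->]]]]]|b c _ Ib _ Ic].
  - exact: Defs.ideal0 hI.
  - rewrite /chi_at -!lock; do 2!apply: (Defs.idealMr hI).
    apply: (Defs.idealMl hI); apply: (Defs.idealMr hI).
    exact: (Defs.idealMl hI).
  - exact: (Defs.idealB hI).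
apply; last by rewrite -chi_at0; apply: chi_span_chi_at; exact: ltn_ord.
split=> [|b c|b c Kc|b c].
- exact: add_span0.
- exact: add_spanB.
- move: b; apply: (@ad_gen _ _ _ _ X (fun b => chi_span n (b * c))).
  + by rewrite mul1r.
  + by move=> b b' Kb Kb'; rewrite mulrBl; apply: add_spanB.
  + by move=> i b Kb; rewrite -mulrA; apply: chi_span_xl.
  + by move=> r b Kb; rewrite -mulrA; apply: chi_span_rl.
  move=> p b; rewrite -mulrA; elim/adjacent_ind: p => [|i i' p i'E IHp] Kb.
    by rewrite ad_p1 mul1r.
  by rewrite ad_pM -mulrA; apply: (chi_span_s i'E) => //; exact: IHp.
- exact: chi_span_mulr.
Qed.

Definition fixes (m : nat) (q : 'S_n) := forall j : 'I_n, (m <= j)%N -> q j = j.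

Lemma fixes1 m : fixes m 1%g.
Proof. by move=> j _; rewrite perm1. Qed.
Lemma fixesM m p q : fixes m p -> fixes m q -> fixes m (p * q)%g.
Proof. by move=> fp fq j lt_mj; rewrite permM fp ?fq. Qed.
Lemma fixes_le m m' q : (m <= m')%N -> fixes m q -> fixes m' q.
Proof. by move=> le_mm' fq j le_m'j; apply: fq; exact: leq_trans le_m'j. Qed.
Lemma fixes_tperm m (a b : 'I_n) : (a < m)%N -> (b < m)%N -> fixes m (tperm a b).
Proof.
by move=> lt_am lt_bm j le_mj; rewrite tpermD ?ltn_neq_ord //; exact: leq_trans le_mj.
Qed.

Lemma rp_mul a r p s q :
  a * rr r * pp p * rr s * pp q = a * rr (r * act p s) * pp (q * p)%g.
Proof.
by rewrite rmorphM ad_pM -!mulrA; congr (_ * (_ * _)); rewrite mulrA ad_pr !mulrA.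
Qed.

Definition is_low (m : 'I_n) (a : A) := exists (be : E) r q,
  [/\ a = xmon be * rr r * pp q, (be m < d)%N,
      forall j : 'I_n, (m < j)%N -> be j = 0%N & fixes m.+1 q].

(** All powers of x_b that appear in the difference are below k; this is what
    keeps the degree of chi_m in x_m equal to d. *)
Lemma s_pow (a b : 'I_n) k : b = a.+1 :> nat ->
  add_span (fun y => exists i j r, (i < k)%N /\ y = x b ^+ i * x a ^+ j * rr r)
    (pp (tperm a b) * x a ^+ k - x b ^+ k * pp (tperm a b)).
Proof.
move=> bE; elim: k => [|k IHk].
  by rewrite !expr0 mulr1 mul1r subrr; apply: add_span0.
rewrite [x a ^+ _]exprS [x b ^+ _]exprS mulrA ad_sxx // mulrBl -!mulrA.
rewrite addrAC -mulrBr; apply: add_spanB.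
  apply: add_span_mull IHk => _ [i [j [r [lt_ik ->]]]]; apply: add_span_gen.
  by exists i.+1, j, r; rewrite exprS !mulrA.
have [r' ->] : exists r', rr (wd_t D a b) * x a ^+ k = x a ^+ k * rr r'.
  by rewrite -xmon_at; exact: r_xmon.
by apply: add_span_gen; exists 0%N, k, r'; rewrite expr0 mul1r.
Qed.

Lemma s_xmon_fix (a b : 'I_n) (al : E) : b = a.+1 :> nat -> al a = 0%N -> al b = 0%N ->
  pp (tperm a b) * xmon al = xmon al * pp (tperm a b).
Proof.
move=> bE ala alb; apply: commr_prod => i _.
have [->|/eqP nia] := eqVneq i a; first by rewrite ala expr0; apply: commr1.
have [->|/eqP nib] := eqVneq i b; first by rewrite alb expr0; apply: commr1.
by apply: commrX; exact: ad_sx.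
Qed.

(** Induction along chi_(m+1) = s chi_m s, with s the transposition of m and
    m + 1: a power of x_m becomes the same power of x_(m+1) up to lower powers of
    x_(m+1), and the other variables of a lower term commute with s. *)
Lemma chi_at_low m : add_span (is_low m) (chi_at m - x m ^+ d).
Proof.
case: m => m lt_mn; elim: m lt_mn => [|m IHm] lt_mn.
  have -> : Ordinal lt_mn = i0 by apply: val_inj; rewrite /= i0E.
  rewrite chi_at0; apply: add_spanS (cp_lead zP) => _ [j [r [lt_jd ->]]].
  apply: add_span_gen; exists (expo_at i0 j), r, 1%g; split.
  - by rewrite xmon_at ad_p1 mulr1.
  - by rewrite ffunE eqxx.
  - by move=> i lt_0i; rewrite ffunE eq_sym (negPf (ltn_neq_ord lt_0i)).
  - exact: fixes1.
set b := Ordinal lt_mn; pose a := Ordinal (ltnW lt_mn).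
have bE : b = a.+1 :> nat by [].
have lt_ab : (a < b)%N by rewrite bE.
pose s := pp (tperm a b).
have fs : fixes b.+1 (tperm a b) by apply: fixes_tperm => //; rewrite ltnS ltnW.
have -> : chi_at b - x b ^+ d =
    s * (chi_at a - x a ^+ d) * s + (s * x a ^+ d - x b ^+ d * s) * s.
  rewrite mulrBr mulrBl mulrBl p_chi_at tpermL -!mulrA !ppK !mulr1.
  by rewrite addrA subrK.
have lowM y r q : fixes b.+1 q -> is_low b y -> is_low b (y * rr r * pp q).
  move=> fq [be [r1 [q1 [-> be1 be2 fq1]]]].
  exists be, (r1 * wd_act D q1 r), (q * q1)%g; split=> //; last exact: fixesM.
  exact: rp_mul.
have lowS y r q : fixes b.+1 q -> add_span (is_low b) y ->
    add_span (is_low b) (y * rr r * pp q).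
  move=> fq; rewrite -mulrA; apply: add_span_mulr => y' ly'; rewrite mulrA.
  by apply: add_span_gen; exact: lowM.
have low_pow (be : E) k : be a = 0%N -> (forall j : 'I_n, (a < j)%N -> be j = 0%N) ->
    (k <= d)%N -> add_span (is_low b) (xmon be * (s * x a ^+ k - x b ^+ k * s)).
  move=> bea bej le_kd; have := s_pow k bE.
  apply: add_span_mull => _ [i [j [r [lt_ik ->]]]]; apply: add_span_gen.
  exists (expo_add be (expo_add (expo_at b i) (expo_at a j))), r, 1%g; split.
  - by rewrite !xmonD !xmon_at ad_p1 mulr1 !mulrA.
  - rewrite !ffunE eqxx bej // [b == a]eq_sym (negPf (ltn_neq_ord lt_ab)) addn0.
    by rewrite add0n; exact: leq_trans le_kd.
  - move=> l lt_bl; have lt_al := ltn_trans lt_ab lt_bl.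
    rewrite !ffunE bej // [l == b]eq_sym [l == a]eq_sym.
    by rewrite (negPf (ltn_neq_ord lt_al)) (negPf (ltn_neq_ord lt_bl)).
  - exact: fixes1.
apply: add_spanD; last first.
  have := lowS (xmon expo0 * (s * x a ^+ d - x b ^+ d * s)) 1 _ fs.
  rewrite xmon0 mul1r rmorph1 mulr1 -{1}[_ - _]mul1r -{1}(xmon0 X).
  by apply; apply: low_pow => // *; rewrite ffunE.
have := IHm (ltnW lt_mn); rewrite -/a.
apply: add_span_mul => _ [be [r [q [-> be1 be2 fq]]]].
pose be0 : E := [ffun j => if j == a then 0%N else be j].
have be0a : be0 a = 0%N by rewrite ffunE eqxx.
have be0j (j : 'I_n) : (a < j)%N -> be0 j = 0%N.
  by move=> lt_aj; rewrite ffunE eq_sym (negPf (ltn_neq_ord lt_aj)) be2.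
have {1}-> : be = expo_add be0 (expo_at a (be a)).
  apply/ffunP => j; rewrite !ffunE; case: eqP => [->|]; first by rewrite add0n.
  by rewrite addn0.
rewrite xmonD xmon_at !mulrA s_xmon_fix ?be0a ?(be0j b) // -/s -[xmon be0 * s * _]mulrA.
rewrite -(mulrA _ (pp q)) -ad_pM.
have fsq : fixes b.+1 (tperm a b * q)%g.
  by apply: fixesM => //; apply: fixes_le fq; rewrite ltnS ltnW.
apply: lowS => //; rewrite -[s * _](subrK (x b ^+ be a * s)) mulrDr.
apply: add_spanD; first by apply: low_pow => //; exact: ltnW.
apply: add_span_gen; exists (expo_add be0 (expo_at b (be a))), 1, (tperm a b); split=> //.
- by rewrite xmonD xmon_at rmorph1 mulr1 mulrA.
- by rewrite !ffunE eqxx [b == a]eq_sym (negPf (ltn_neq_ord lt_ab)) be2.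
- move=> l lt_bl; have lt_al := ltn_trans lt_ab lt_bl.
  rewrite ffunE be0j // ffunE [l == b]eq_sym.
  by rewrite (negPf (ltn_neq_ord lt_bl)).
Qed.

Definition box (m : nat) (al : E) := [forall i : 'I_n, (i < m)%N ==> (al i < d)%N].

Lemma boxP m (al : E) : reflect (forall i : 'I_n, (i < m)%N -> (al i < d)%N) (box m al).
Proof.
by apply: (iffP forallP) => h i; [exact/implyP|exact/implyP/h].
Qed.

(** The exponents from position m on are those of al, and only positions below m
    are permuted: chi_m commutes with such permutations, and leading terms in
    x_m are not disturbed by the reduction. *)
Definition is_red (m : nat) (al : E) (a : A) := is_chi_term m a \/
  exists (al' : E) r q, [/\ a = xmon al' * rr r * pp q, box m al',
    forall i : 'I_n, (m <= i)%N -> al' i = al i & fixes m q].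

Lemma is_red_rp m (al : E) a r q : fixes m q -> add_span (is_red m al) a ->
  add_span (is_red m al) (a * rr r * pp q).
Proof.
move=> fq; rewrite -mulrA; apply: add_span_mulr => y [Ky|]; rewrite mulrA.
  have : chi_span m (y * rr r * pp q) by apply/chi_span_pr/chi_span_rr/add_span_gen.
  by apply: add_spanS => y' Ky'; apply: add_span_gen; left.
case=> [be [r1 [q1 [-> be1 be2 fq1]]]]; apply: add_span_gen; right.
exists be, (r1 * wd_act D q1 r), (q * q1)%g; split=> //; last exact: fixesM.
exact: rp_mul.
Qed.

(** Division: replace x_m^d by chi_m and terms of lower degree in x_m, and
    repeat.  Each step stays within the first m + 1 positions. *)
Lemma box_reduce m (al : E) : (m <= n)%N -> add_span (is_red m al) (xmon al).
Proof.
elim: m al => [|m IHm] al le_mn.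
  apply: add_span_gen; right; exists al, 1, 1%g; split=> //.
  - by rewrite rmorph1 ad_p1 !mulr1.
  - by apply/boxP.
  - exact: fixes1.
pose j := Ordinal le_mn.
have [N] := ubnP (al j); elim: N al => // N IHN al; rewrite ltnS => le_alN.
have [lt_ald|le_dal] := ltnP (al j) d.
  apply: add_spanS (IHm al (ltnW le_mn)) => y [[be [i [r [p [lt_im ->]]]]]|].
    by apply: add_span_gen; left; exists be, i, r, p; split=> //; exact: leqW.
  case=> [be [r [q [-> /boxP be1 be2 fq]]]]; apply: add_span_gen; right.
  exists be, r, q; split=> //; last exact: fixes_le fq.
    apply/boxP => i; rewrite ltnS leq_eqVlt => /orP[/eqP im|]; last exact: be1.
    by have -> : i = j by [exact: val_inj]; rewrite be2.
  by move=> i /ltnW; exact: be2.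
pose al1 : E := [ffun i => if i == j then (al i - d)%N else al i].
have -> : al = expo_add al1 (expo_at j d).
  apply/ffunP => i; rewrite !ffunE; case: eqP => [->|_]; last by rewrite addn0.
  by rewrite subnK.
have al1j : (expo_add al1 (expo_at j d)) j = al j by rewrite !ffunE eqxx subnK.
rewrite xmonD xmon_at -[x j ^+ d](subKr (chi_at j)) mulrBr; apply: add_spanB.
  apply: add_span_gen; left; exists al1, j, 1, 1%g; split=> //.
  by rewrite rmorph1 ad_p1 !mulr1.
apply: add_span_mull (chi_at_low j) => _ [be [r [q [-> bej beh fq]]]].
rewrite !mulrA -xmonD; apply: is_red_rp => //.
apply: add_spanS (IHN (expo_add al1 be) _) => [y [Ky|]|].
- by apply: add_span_gen; left.
- case=> [ga [r' [q' [-> ga1 ga2 fq']]]]; apply: add_span_gen; right.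
  exists ga, r', q'; split=> // i lt_mi; rewrite ga2 // !ffunE beh // .
  by rewrite eq_sym (negPf (ltn_neq_ord (lt_mi : (j < i)%N))).
- by rewrite !ffunE eqxx; lia.
Qed.

Definition in_box m a := forall al : E, ~~ box m al -> coef al a = 0.

Lemma in_boxB m a b : in_box m a -> in_box m b -> in_box m (a - b).
Proof. by move=> ha hb al nal; rewrite ad_coefB ha ?hb ?subrr. Qed.
Lemma in_box0 m : in_box m 0.
Proof. by move=> al _; rewrite ad_coef0. Qed.
Lemma in_box_xrp m al r p : box m al -> in_box m (xmon al * rr r * pp p).
Proof.
by move=> bal be; rewrite coef_xmon; case: eqP => // ->; rewrite bal.
Qed.

Lemma coef_xpow j k al a :
  coef (expo_add al (expo_at j k)) (x j ^+ k * a) = coef al a.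
Proof.
elim: (span_xrp X a) => [|_ [be [r [p ->]]]|b c _ hb _ hc].
- by rewrite mulr0 !ad_coef0.
- rewrite -xmon_at !mulrA -xmonD !coef_xmon; congr (if _ then _ else _).
  apply/eqP/eqP => [|->]; last by apply/ffunP => i; rewrite !ffunE addnC.
  move/ffunP => h; apply/ffunP => i; move: (h i); rewrite !ffunE addnC.
  by move/addnI.
- by rewrite mulrBr !ad_coefB hb hc.
Qed.

Lemma coef_xpow_lt (j : 'I_n) k (al : E) a : (al j < k)%N -> coef al (x j ^+ k * a) = 0.
Proof.
move=> lt_alk; elim: (span_xrp X a) => [|_ [be [r [p ->]]]|b c _ hb _ hc].
- by rewrite mulr0 !ad_coef0.
- rewrite -xmon_at !mulrA -xmonD !coef_xmon; case: eqP => // al_eq.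
  by move: lt_alk; rewrite al_eq !ffunE eqxx; lia.
- by rewrite mulrBr !ad_coefB hb hc subrr.
Qed.

Lemma in_box_xpow (j : 'I_n) k a : in_box j a -> in_box j (x j ^+ k * a).
Proof.
move=> ha al nal; have [lt|le] := ltnP (al j) k; first exact: coef_xpow_lt.
pose al1 : E := [ffun i => if i == j then (al i - k)%N else al i].
have E1 : al = expo_add al1 (expo_at j k).
  apply/ffunP => i; rewrite !ffunE; case: eqP => [->|_]; last by rewrite addn0.
  by rewrite subnK.
rewrite {1}E1 coef_xpow; apply: ha; apply: contra nal => /boxP h.
apply/boxP => i lt_ij; have := h i lt_ij.
by rewrite ffunE (negPf (ltn_neq_ord lt_ij)).
Qed.

(** The exponents of x^al in x^al chi_m w may be reduced first: what is lost lies
    in the right ideal chi_span m, and the permutations that appear commute with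
    chi_m. *)
Lemma chi_span_step (j : 'I_n) a : chi_span j.+1 a -> exists2 q, in_box j q &
  chi_span j (a - xlift X (fun al => xmon al * chi_at j) q).
Proof.
set Th := xlift X _.
elim=> [|_ [al [i [r [p [lt_ij ->]]]]]|b c _ [q qb hq] _ [q' qb' hq']].
- exists 0; first exact: in_box0.
  by rewrite -(subrr 0) /Th xliftB !subrr; apply: add_span0.
- move: lt_ij; rewrite ltnS leq_eqVlt => /orP[/eqP/val_inj ->|lt_ij]; last first.
    exists 0; first exact: in_box0.
    rewrite (_ : Th 0 = 0) ?subr0; last by rewrite -(subrr 0) /Th xliftB !subrr.
    by apply: add_span_gen; exists al, i, r, p.
  have := box_reduce al (ltnW (ltn_ord j)).
  elim=> [|y hy|b c _ [q qb hq] _ [q' qb' hq']].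
  + exists 0; first exact: in_box0.
    rewrite !mul0r sub0r; apply: add_spanN.
    by rewrite -(subrr 0) /Th xliftB subrr; apply: add_span0.
  + case: hy => [Ky|[be [s [q [-> be1 be2 fq]]]]].
      exists 0; first exact: in_box0.
      rewrite (_ : Th 0 = 0) ?subr0; last by rewrite -(subrr 0) /Th xliftB !subrr.
      by rewrite -!mulrA; apply: chi_span_mulr; apply: add_span_gen.
    have [s' Es'] := r_chi_at j s.
    exists (xmon be * rr (s' * wd_act D q r) * pp (p * q)%g); first exact: in_box_xrp.
    rewrite /Th xlift_xrp rmorphM [X in X - _](_ : _ = xmon be * chi_at j *
      (rr s' * rr (wd_act D q r)) * pp (p * q)%g).
      by rewrite subrr; apply: add_span0.
    rewrite ad_pM -!mulrA; congr (_ * _); rewrite (mulrA (pp q)) p_chi_at fq //.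
    by rewrite -mulrA mulrA Es' -!mulrA; congr (_ * (_ * _)); rewrite mulrA ad_pr mulrA.
  + exists (q - q'); first exact: in_boxB.
    by rewrite !mulrBl /Th xliftB [X in _ + X]opprD addrACA -opprD; apply: add_spanB.
- exists (q - q'); first exact: in_boxB.
  by rewrite /Th xliftB [X in _ + X]opprD addrACA -opprD; apply: add_spanB.
Qed.

Lemma in_box_le m m' a : (m <= m')%N -> in_box m' a -> in_box m a.
Proof.
move=> le_mm' ha al nal; apply: ha; apply: contra nal => /boxP h.
by apply/boxP => i lt_im; apply: h; exact: leq_trans le_mm'.
Qed.

(** The reduction of the lower terms of chi_m does not change the exponent of
    x_m, which stays below N + d. *)
Lemma chi_at_lead (j : 'I_n) N (al : E) r p : box j al -> (al j <= N)%N ->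
  exists u, [/\ in_box j u, forall be : E, (N + d <= be j)%N -> coef be u = 0 &
    chi_span j (xmon al * (chi_at j - x j ^+ d) * rr r * pp p - u)].
Proof.
move=> bal le_alN.
pose P y := exists u, [/\ in_box j u,
  forall be : E, (N + d <= be j)%N -> coef be u = 0 & chi_span j (y - u)].
have P0 : P 0.
  by exists 0; rewrite subrr; split=> [|be _|];
    [exact: in_box0|rewrite ad_coef0|exact: add_span0].
have PB y y' : P y -> P y' -> P (y - y').
  move=> [u [u1 u2 u3]] [v [v1 v2 v3]]; exists (u - v); split.
  - exact: in_boxB.
  - by move=> be hbe; rewrite ad_coefB u2 ?v2 ?subrr.
  - by rewrite [X in _ + X]opprD addrACA -opprD; apply: add_spanB.
have PK y : chi_span j y -> P y.
  move=> Ky; exists 0; rewrite subr0; split=> // [|be _]; first exact: in_box0.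
  by rewrite ad_coef0.
have PX ga s q : box j ga -> (ga j < N + d)%N -> P (xmon ga * rr s * pp q).
  move=> bga lt_ga; exists (xmon ga * rr s * pp q); rewrite subrr.
  split=> [|de hde|]; [exact: in_box_xrp| |exact: add_span0].
  by rewrite coef_xmon; case: eqP => // de_ga; move: hde; rewrite de_ga; lia.
suff h y : add_span (is_low j) y -> P (xmon al * y * rr r * pp p).
  by apply: h; exact: chi_at_low.
elim=> [|_ [be [s [q [-> bej beh fq]]]]|b c _ hb _ hc]; last first.
- by rewrite mulrBr !mulrBl; apply: PB.
- have := box_reduce (expo_add al be) (ltnW (ltn_ord j)).
  rewrite !mulrA -xmonD; elim=> [|y' [Ky|]|b c _ hb _ hc].
  + by rewrite !mul0r.
  + by apply: PK; do 2!apply/chi_span_pr/chi_span_rr; apply: add_span_gen.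
  + case=> [ga [r1 [q1 [-> bga gah fq1]]]]; rewrite !rp_mul.
    by apply: PX => //; rewrite gah // ffunE; lia.
  + by rewrite !mulrBl; apply: PB.
- by rewrite mulr0 !mul0r.
Qed.

Lemma xlift_lead (j : 'I_n) N q : in_box j q ->
  (forall al : E, (N < al j)%N -> coef al q = 0) ->
  exists u, [/\ in_box j u, forall be : E, (N + d <= be j)%N -> coef be u = 0 &
    chi_span j (xlift X (fun al => xmon al * chi_at j) q - x j ^+ d * q - u)].
Proof.
move=> qb qN; rewrite -{2}[q](xlift_id X) /xlift mulr_sumr -sumrB.
elim: (supp X q) => [|al L [u [u1 u2 u3]]].
  exists 0; split=> [|be _|]; first exact: in_box0.
    by rewrite ad_coef0.
  by rewrite big_nil subrr; apply: add_span0.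
rewrite big_cons.
suff [v [v1 v2 v3]]: exists v, [/\ in_box j v,
    forall be : E, (N + d <= be j)%N -> coef be v = 0 &
    chi_span j (xmon al * chi_at j * of_smash (coef al q) -
      x j ^+ d * (xmon al * of_smash (coef al q)) - v)].
  exists (u + v); split=> [be nbe|be hbe|].
  - by rewrite ad_coefD u1 ?v1 ?addr0.
  - by rewrite ad_coefD u2 ?v2 ?addr0.
  - by rewrite [X in _ - X]addrC opprD addrACA; apply: add_spanD.
have zero : coef al q = 0 -> exists v, [/\ in_box j v,
    forall be : E, (N + d <= be j)%N -> coef be v = 0 &
    chi_span j (xmon al * chi_at j * of_smash (coef al q) -
      x j ^+ d * (xmon al * of_smash (coef al q)) - v)].
  move=> ->; exists 0; split=> [|be _|]; first exact: in_box0.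
    by rewrite ad_coef0.
  by rewrite of_smash0 !mulr0 !subrr; apply: add_span0.
have [bal|/qb/zero//] := boolP (box j al).
have [le_alN|/qN/zero//] := leqP (al j) N.
have -> : xmon al * chi_at j * of_smash (coef al q) -
      x j ^+ d * (xmon al * of_smash (coef al q)) =
    \sum_p xmon al * (chi_at j - x j ^+ d) * rr (coef al q p) * pp p.
  rewrite mulrA -[x j ^+ d]xmon_at [xmon (expo_at _ _) * _]xmonC -mulrBl -mulrBr xmon_at.
  by rewrite /of_smash mulr_sumr; apply: eq_bigr => p _; rewrite mulrA.
elim: (index_enum _) => [|p s [v [v1 v2 v3]]].
  exists 0; split=> [|be _|]; first exact: in_box0.
    by rewrite ad_coef0.
  by rewrite big_nil subrr; apply: add_span0.
have [w [w1 w2 w3]] := chi_at_lead (coef al q p) p bal le_alN.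
rewrite big_cons; exists (w + v); split=> [be nbe|be hbe|].
- by rewrite ad_coefD w1 ?v1 ?addr0.
- by rewrite ad_coefD w2 ?v2 ?addr0.
- by rewrite opprD addrACA; apply: add_spanD.
Qed.

(** An element a of chi_span (m + 1) is xlift q modulo chi_span m, with q of some
    degree N in x_m.  The part of xlift q of degree N + d in x_m is x_m^d times
    that of q, while a has degree below d in x_m: hence the top part of q
    vanishes.  Descending to q = 0 puts a into chi_span m. *)
Lemma chi_span_box m a : (m <= n)%N -> chi_span m a -> in_box m a -> a = 0.
Proof.
elim: m a => [|m IHm] a le_mn.
  move=> K0a _; elim: K0a => [|y [al [i [r [p [lt_i0 _]]]]]|b c _ -> _ ->].
  - by [].
  - by rewrite ltn0 in lt_i0.
  - exact: subrr.
pose j := Ordinal le_mn => Ka; have [q qb hq] := chi_span_step (j := j) Ka.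
move=> ab; have abj : in_box j a by apply: in_box_le ab.
set Th := xlift X _ in hq.
have Th0 : Th 0 = 0 by rewrite -(subrr 0) /Th xliftB !subrr.
suff main N : forall q, in_box j q -> (forall al : E, (N <= al j)%N -> coef al q = 0) ->
    chi_span j (a - Th q) -> a = 0.
  apply: (main (\max_(al <- supp X q) al j).+1 q) => // al lt_al.
  apply/coef_supp/negP => al_q; move: lt_al; apply/negP; rewrite -ltnNge ltnS.
  exact: leq_bigmax_seq.
elim: N => [|N IHN] {q qb hq} q qb qN hq.
  have q0 : q = 0 by apply: (coef_inj (X := X)) => al; exact: qN.
  by apply: IHm (ltnW le_mn) _ abj; rewrite -[a]subr0 -Th0 -q0.
have [u [u1 u2 u3]] := xlift_lead qb qN.
have aE : a - x j ^+ d * q - u = 0.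
  apply: IHm; first exact: ltnW.
    have -> : a - x j ^+ d * q - u = (a - Th q) + (Th q - x j ^+ d * q - u).
      by rewrite !addrA subrK.
    exact: add_spanD.
  by apply: in_boxB => //; apply: in_boxB => //; exact: (@in_box_xpow j).
apply: IHN hq => // al; rewrite leq_eqVlt => /orP[/eqP alN|]; last exact: qN.
have := congr1 (coef (expo_add al (expo_at j d))) aE.
have alj : (expo_add al (expo_at j d)) j = (N + d)%N by rewrite !ffunE eqxx alN.
rewrite ad_coef0 !ad_coefB coef_xpow u2 ?alj // ab ?sub0r ?subr0.
  by move/eqP; rewrite oppr_eq0 => /eqP.
by apply/negP => /boxP/(_ j (leqnn _)); rewrite alj ltnNge leq_addl.
Qed.

Definition expo_of_box (al : {ffun 'I_n -> 'I_d}) : E := [ffun i => al i : nat].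

Lemma expo_of_box_inj : injective expo_of_box.
Proof.
move=> al be /ffunP h; apply/ffunP => i; apply: val_inj.
by have := h i; rewrite !ffunE.
Qed.

Lemma cyclotomic_span a : exists w : {ffun 'I_n -> 'I_d} -> {ffun 'S_n -> R},
  ideal_gen z (a - \sum_al xmon (expo_of_box al) * of_smash (w al)).
Proof.
suff [w hw] : exists w : {ffun 'I_n -> 'I_d} -> {ffun 'S_n -> R},
    chi_span n (a - \sum_al xmon (expo_of_box al) * of_smash (w al)).
  by exists w; apply/ideal_gen_chi_span.
have P0 y : chi_span n y -> exists w : {ffun 'I_n -> 'I_d} -> {ffun 'S_n -> R},
    chi_span n (y - \sum_al xmon (expo_of_box al) * of_smash (w al)).
  by move=> Ky; exists (fun=> 0); rewrite big1 ?subr0 // => al _; rewrite of_smash0 mulr0.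
elim: (span_xrp X a) => [|_ [al [r [p ->]]]|b c _ [w hw] _ [w' hw']].
- by apply: P0; apply: add_span0.
- have fp : fixes n p by move=> i; rewrite leqNgt ltn_ord.
  elim: (is_red_rp r fp (box_reduce al (leqnn n))) => [|y [Ky|]|b c _ [w hw] _ [w' hw']].
  + by apply: P0; apply: add_span0.
  + by apply: P0; apply: add_span_gen.
  + case=> [be [s [q [-> /boxP hbe _ _]]]].
    pose be' : {ffun 'I_n -> 'I_d} := [ffun i => Ordinal (hbe i (ltn_ord i))].
    have be'E : expo_of_box be' = be by apply/ffunP => i; rewrite !ffunE.
    exists (fun al' => if al' == be' then smash_delta q s else 0).
    rewrite (bigD1 be') //= eqxx be'E of_smash_delta big1 ?addr0.
      by rewrite mulrA subrr; apply: add_span0.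
    by move=> i /negPf ->; rewrite of_smash0 mulr0.
  + exists (fun al' => w al' - w' al'); under eq_bigr do rewrite of_smashB mulrBr.
    by rewrite sumrB [X in _ + X]opprD addrACA -opprD; apply: add_spanB.
- exists (fun al' => w al' - w' al'); under eq_bigr do rewrite of_smashB mulrBr.
  by rewrite sumrB [X in _ + X]opprD addrACA -opprD; apply: add_spanB.
Qed.

Lemma cyclotomic_free (w : {ffun 'I_n -> 'I_d} -> {ffun 'S_n -> R}) :
  ideal_gen z (\sum_al xmon (expo_of_box al) * of_smash (w al)) -> forall al, w al = 0.
Proof.
move=> /ideal_gen_chi_span Kw al.
have coefw be : coef be (\sum_al xmon (expo_of_box al) * of_smash (w al)) =
    \sum_al (if be == expo_of_box al then w al else 0).
  by rewrite ad_coef_sum; apply: eq_bigr => al' _; rewrite coef_xmon_smash.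
have /(congr1 (coef (expo_of_box al))) :
    \sum_al xmon (expo_of_box al) * of_smash (w al) = 0.
  apply: chi_span_box Kw _ => // be nbe; rewrite coefw big1 // => al' _.
  case: eqP => // be_al'; case/negP: nbe; rewrite be_al'.
  by apply/boxP => i _; rewrite ffunE.
rewrite coefw ad_coef0 (bigD1 al) //= eqxx big1 ?addr0 // => al' ne.
by rewrite (inj_eq expo_of_box_inj) eq_sym (negPf ne).
Qed.

End Cyclotomic.

(** * Tensor powers of a superalgebra as rings *)

Section Signs.
Variable n : nat.
Implicit Types e : 'I_n -> bool.

(** Signs of rearranged tensors are exclusive ors over pairs of positions. *)
Definition xorsum (g : 'I_n -> 'I_n -> bool) : bool :=
  \big[addb/false]_(i < n) \big[addb/false]_(j < n) g i j.

Lemma odd_sum (I : Type) (s : seq I) (P : pred I) (f : I -> nat) :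
  odd (\sum_(i <- s | P i) f i) = \big[addb/false]_(i <- s | P i) odd (f i).
Proof. by apply: (big_morph odd) => // a b; rewrite oddD. Qed.

Lemma odd_sum2 (c : 'I_n -> 'I_n -> bool) (g : 'I_n -> 'I_n -> bool) :
  odd (\sum_(i < n) \sum_(j < n | c i j) g i j) = xorsum (fun i j => c i j && g i j).
Proof.
rewrite odd_sum; apply: eq_bigr => i _; rewrite odd_sum big_mkcond /=.
by apply: eq_bigr => j _; case: (c i j); rewrite // oddb.
Qed.

Lemma eq_xorsum g g' : (forall i j, g i j = g' i j) -> xorsum g = xorsum g'.
Proof. by move=> h; apply: eq_bigr => i _; apply: eq_bigr. Qed.

Lemma xorsumD g g' : xorsum g (+) xorsum g' = xorsum (fun i j => g i j (+) g' i j).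
Proof. by rewrite -big_split; apply: eq_bigr => i _; rewrite -big_split. Qed.

Lemma xorsum_perm (p : 'S_n) g : xorsum g = xorsum (fun i j => g (p i) (p j)).
Proof.
rewrite {1}/xorsum (reindex_inj (@perm_inj _ p)); apply: eq_bigr => i _.
by rewrite (reindex_inj (@perm_inj _ p)).
Qed.

Lemma xorsum_tr g : xorsum g = xorsum (fun i j => g j i).
Proof. exact: exchange_big. Qed.

Lemma xorsum0 g : (forall i j, g i j = false) -> xorsum g = false.
Proof. by move=> h; rewrite /xorsum big1 // => i _; rewrite big1. Qed.

(** Every unordered pair is counted twice. *)
Lemma xorsum_sym g : (forall i j, g i j = g j i) -> (forall i, g i i = false) ->
  xorsum g = false.
Proof.
move=> gC g0.
rewrite (@eq_xorsum _ (fun i j => ((i < j)%N && g i j) (+) ((j < i)%N && g i j))).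
  rewrite -xorsumD [X in _ (+) X]xorsum_tr.
  under [X in _ (+) X]eq_xorsum do rewrite gC.
  exact: addbb.
move=> i j; case: (ltngtP i j) => [|_|/val_inj ->]; rewrite /= ?addbF ?addFb //.
Qed.

Definition koszul e e' := xorsum (fun i j => (j < i)%N && (e i && e' j)).
Definition inversions (p : 'S_n) e :=
  xorsum (fun i j => ((i < j) && (p j < p i))%N && (e i && e j)).

Lemma koszul_addl e1 e2 e' :
  koszul (fun i => e1 i (+) e2 i) e' = koszul e1 e' (+) koszul e2 e'.
Proof.
by rewrite xorsumD; apply: eq_xorsum => i j; rewrite -andb_addr -andb_addl.
Qed.
Lemma koszul_addr e e1 e2 :
  koszul e (fun i => e1 i (+) e2 i) = koszul e e1 (+) koszul e e2.
Proof.
by rewrite xorsumD; apply: eq_xorsum => i j; rewrite -!andb_addr.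
Qed.

Lemma ltn_xor (i j : 'I_n) : i != j -> (j < i)%N = ~~ (i < j)%N.
Proof. by rewrite -(inj_eq val_inj) -leqNgt => ne_ij; rewrite ltn_neqAle eq_sym ne_ij. Qed.

(** A pair is inverted by the product if exactly one of the two permutations
    inverts it, the second one after the first has been applied. *)
Lemma inversionsM (p q : 'S_n) e :
  inversions (q * p)%g e = inversions q e (+) inversions p (fun i => e (q^-1%g i)).
Proof.
rewrite [inversions p _](xorsum_perm q).
have xor_eq (a b : bool) : a (+) b = false -> a = b by case: a; case: b.
apply: xor_eq.
rewrite !xorsumD; apply: xorsum_sym => [i j|i]; rewrite !permM !permK ?ltnn //.
have [->//|ne_ij] := eqVneq i j.
rewrite (ltn_xor ne_ij) (@ltn_xor (q i)) ?(inj_eq perm_inj) //.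
rewrite (@ltn_xor (p (q i))) ?(inj_eq perm_inj) // [e j && _]andbC.
by case: (i < j)%N; case: (q i < q j)%N; case: (p (q i) < p (q j))%N; case: (e i && e j).
Qed.

(** Two ways to sort factors of two tensors, multiplying before or after
    permuting.  A pair of one factor from each tensor is counted differently on
    the two sides exactly when p inverts it. *)
Lemma koszul_perm (p : 'S_n) e e' :
  koszul e e' (+) inversions p (fun i => e i (+) e' i) =
  inversions p e (+) inversions p e' (+)
  koszul (fun i => e (p^-1%g i)) (fun i => e' (p^-1%g i)).
Proof.
rewrite [koszul (fun i => e (p^-1%g i)) _](xorsum_perm p).
have -> : inversions p (fun i => e i (+) e' i) =
    inversions p e (+) inversions p e' (+)
    xorsum (fun i j => (((i < j) && (p j < p i)) (+) ((j < i) && (p i < p j)))%N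
                       && (e i && e' j)).
  have -> : xorsum (fun i j => (((i < j) && (p j < p i)) (+)
                                ((j < i) && (p i < p j)))%N && (e i && e' j)) =
      xorsum (fun i j => ((i < j) && (p j < p i))%N && (e i && e' j)) (+)
      xorsum (fun i j => ((i < j) && (p j < p i))%N && (e j && e' i)).
    by rewrite [X in _ (+) X]xorsum_tr xorsumD; apply: eq_xorsum => i j; rewrite andb_addl.
  rewrite !xorsumD; apply: eq_xorsum => i j.
  by case: ((i < j) && (p j < p i))%N; case: (e i); case: (e j); case: (e' i); case: (e' j).
rewrite [LHS]addbC -!addbA; congr (_ (+) (_ (+) _)).
rewrite xorsumD; apply: eq_xorsum => i j; rewrite !permK.
have [->|ne_ij] := eqVneq i j; first by rewrite !ltnn.
rewrite (ltn_xor ne_ij) (@ltn_xor (p i)) ?(inj_eq perm_inj) //.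
by case: (i < j)%N; case: (p i < p j)%N; case: (e i && e' j).
Qed.

End Signs.

Section Coordinates.
Variables (k : comNzRingType) (F : gradedSuperalgebra k) (B : homogBasis F).
Local Notation coord := (hb_coord B).

Lemma hb_coordE f : f = \sum_b coord f b *: hb_vec b.
Proof. by rewrite /hb_coord; case: cid => c []. Qed.

Lemma hb_coord_uniq f (c : {ffun B -> k}) : f = \sum_b c b *: hb_vec b -> coord f = c.
Proof. by rewrite /hb_coord; case: cid => c' /= [_ h] /h. Qed.

Lemma hb_coord_lin a f g b : coord (a *: f + g) b = a * coord f b + coord g b.
Proof.
have -> : coord (a *: f + g) = [ffun b => a * coord f b + coord g b].
  apply: hb_coord_uniq; rewrite {1}[f]hb_coordE {1}[g]hb_coordE scaler_sumr.
  rewrite -big_split; apply: eq_bigr => c _ /=.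
  by rewrite ffunE scalerDl scalerA.
by rewrite ffunE.
Qed.

Lemma hb_coord0 b : coord 0 b = 0.
Proof. by have := hb_coord_lin (-1) 0 0 b; rewrite scaler0 addr0 mulN1r addNr. Qed.

Lemma hb_coordZ a f b : coord (a *: f) b = a * coord f b.
Proof. by rewrite -[_ *: f]addr0 hb_coord_lin hb_coord0 addr0. Qed.
Lemma hb_coordD f g b : coord (f + g) b = coord f b + coord g b.
Proof. by rewrite -[f in LHS]scale1r hb_coord_lin mul1r. Qed.
Lemma hb_coord_sum (I : Type) (s : seq I) (f : I -> F) b :
  coord (\sum_(i <- s) f i) b = \sum_(i <- s) coord (f i) b.
Proof.
elim: s => [|i s IHs]; first by rewrite !big_nil hb_coord0.
by rewrite !big_cons hb_coordD IHs.
Qed.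

Lemma hb_coord_vec b c : coord (hb_vec b) c = (b == c)%:R.
Proof.
have -> : coord (hb_vec b) = [ffun c => (b == c)%:R].
  apply: hb_coord_uniq; rewrite (bigD1 b) //= ffunE eqxx scale1r big1 ?addr0 //.
  by move=> c' /negPf; rewrite eq_sym => h; rewrite ffunE h scale0r.
by rewrite ffunE.
Qed.

Lemma gs_par_vec e (b : B) :
  gs_par F e (hb_vec b) = if e == hb_par b then hb_vec b else 0.
Proof.
by rewrite -{1}[hb_vec b](hb_parP b) gs_par_proj; case: eqP => // ->; exact: hb_parP.
Qed.

Lemma hb_coord_par e f b : has_parity e f -> coord f b != 0 -> hb_par b = e.
Proof.
move=> ef; apply: contraNeq => ne.
have -> : coord f = [ffun b => if e == hb_par b then coord f b else 0].
  apply: hb_coord_uniq; rewrite -{1}[f]ef {1}[f]hb_coordE linear_sum /=.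
  apply: eq_bigr => c _; rewrite linearZ /= gs_par_vec ffunE.
  by case: eqP => // _; rewrite scaler0 scale0r.
by rewrite ffunE [e == _]eq_sym (negPf ne).
Qed.

Lemma parity_M e e' (f g : F) :
  has_parity e f -> has_parity e' g -> has_parity (e (+) e') (f * g).
Proof. exact: gs_parM. Qed.

(** What happens to f when an element of parity e moves past it. *)
Definition parity_sign (e : bool) (f : F) : F :=
  if e then gs_par F false f - gs_par F true f else f.

Lemma parity_sign_linear e : linear (parity_sign e).
Proof.
move=> a f g; rewrite /parity_sign; case: e => //.
by rewrite !linearP /= addrACA -scalerDr.
Qed.

Lemma parity_sign_vec e (b : B) :
  parity_sign e (hb_vec b) = (-1) ^+ (e && hb_par b) *: hb_vec b.
Proof.
rewrite /parity_sign; case: e; last by rewrite scale1r.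
by rewrite !gs_par_vec; case: (hb_par b); rewrite /= ?sub0r ?subr0 ?scaleN1r ?scale1r.
Qed.

End Coordinates.

Section Tensor.
Variables (k : comNzRingType) (F : gradedSuperalgebra k) (B : homogBasis F).
Variable n : nat.
Local Notation coord := (hb_coord B).
Local Notation T := (tensorPower B n).
Local Notation idx := {ffun 'I_n -> B}.
Local Notation tens := (@tens k F B n).
Local Notation btens := (@btens k F B n).
Implicit Types (u v w : T) (J K L : idx) (e : 'I_n -> bool).

Lemma btensE J K : btens J K = (J == K)%:R.
Proof.
rewrite ffunE; case: eqVneq => [->|ne].
  by rewrite big1 // => i _; rewrite hb_coord_vec eqxx.
have [i ne_i] : exists i, J i != K i.
  by apply/existsP; apply: contraR ne; rewrite negb_exists => /forallP h;
    apply/eqP/ffunP => i; apply/eqP; rewrite -[_ == _]negbK.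
by rewrite (bigD1 i) //= hb_coord_vec (negPf ne_i) mul0r.
Qed.

Lemma tensorE u : u = \sum_J u J *: btens J.
Proof.
apply/ffunP => K; rewrite sum_ffunE (bigD1 K) //= big1 ?addr0.
  by rewrite ffunE btensE eqxx [RHS]mulr1.
by move=> J /negPf ne; rewrite ffunE btensE ne [LHS]mulr0.
Qed.

Lemma tensor_ind (P : T -> Prop) : (forall u v, P u -> P v -> P (u + v)) ->
  (forall a u, P u -> P (a *: u)) -> P 0 -> (forall J, P (btens J)) -> forall u, P u.
Proof.
by move=> PD PZ P0 Pb u; rewrite [u]tensorE; apply: big_ind => // J _; apply: PZ.
Qed.

(** Multilinearity, in the form in which tensors of homogeneous vectors are
    reduced to basis tensors below. *)
Lemma tens_expand (phi : 'I_n -> F -> F) (g : 'I_n -> F) :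
  (forall i, linear (phi i)) ->
  tens (fun i => phi i (g i)) =
  \sum_(J : idx) (\prod_i coord (g i) (J i)) *: tens (fun i => phi i (hb_vec (J i))).
Proof.
move=> phi_lin; apply/ffunP => L; rewrite sum_ffunE ffunE.
under eq_bigr => i _.
  have -> : coord (phi i (g i)) (L i) =
      \sum_b coord (g i) b * coord (phi i (hb_vec b)) (L i).
    have phiD f f' : phi i (f + f') = phi i f + phi i f'.
      by rewrite -[f in LHS]scale1r phi_lin scale1r.
    have phi0 : phi i 0 = 0.
      by have := phi_lin i (-1) 0 0; rewrite scaler0 addr0 scaleN1r addNr.
    have phiZ a f : phi i (a *: f) = a *: phi i f.
      by rewrite -[_ *: f]addr0 phi_lin phi0 addr0.
    rewrite {1}[g i](hb_coordE B) (big_morph (phi i) phiD phi0) hb_coord_sum.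
    by apply: eq_bigr => b _; rewrite phiZ hb_coordZ.
  over.
rewrite bigA_distr_bigA; apply: eq_bigr => J _.
by rewrite big_split !ffunE.
Qed.

Lemma eq_tens f g : f =1 g -> tens f = tens g.
Proof. by move=> h; apply/ffunP => J; rewrite !ffunE; apply: eq_bigr => i _; rewrite h. Qed.

Lemma tensZ (a : 'I_n -> k) f : tens (fun i => a i *: f i) = (\prod_i a i) *: tens f.
Proof.
apply/ffunP => J; rewrite !ffunE; under eq_bigr do rewrite hb_coordZ.
exact: big_split.
Qed.

Lemma tens_lin f : tens f = \sum_(J : idx) (\prod_i coord (f i) (J i)) *: btens J.
Proof. by apply: (@tens_expand (fun _ => id)). Qed.

(** Hence a sign that depends on the parities of basis vectors is constant on
    the expansion of a tensor of homogeneous vectors. *)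
Lemma tens_support e f J : (forall i, has_parity (e i) (f i)) -> tens f J != 0 ->
  forall i, hb_par (J i) = e i.
Proof.
move=> ef; rewrite ffunE => nz i; apply: hb_coord_par (ef i) _.
by apply: contraNneq nz => z; rewrite (bigD1 i) //= z mul0r.
Qed.

Lemma tmul_sign J K :
  (-1) ^+ (\sum_(i < n) \sum_(j < n | (j < i)%N) (hb_par (J i) && hb_par (K j))) =
  (-1) ^+ koszul (fun i => hb_par (J i)) (fun i => hb_par (K i)) :> k.
Proof. by rewrite -signr_odd odd_sum2. Qed.

Lemma tmul_tens e e' f g : (forall i, has_parity (e i) (f i)) ->
  (forall i, has_parity (e' i) (g i)) ->
  tmul (tens f) (tens g) = (-1) ^+ koszul e e' *: tens (fun i => f i * g i).
Proof.
move=> ef eg.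
rewrite (@tens_expand (fun i x => x * g i) f) => [|i a x y]; last first.
  by rewrite mulrDl scalerAl.
rewrite scaler_sumr; apply: eq_bigr => J _.
rewrite (@tens_expand (fun i x => hb_vec (J i) * x) g) => [|i a x y]; last first.
  by rewrite mulrDr scalerAr.
rewrite !scaler_sumr; apply: eq_bigr => K _; rewrite tmul_sign !scalerA.
have -> : \prod_i coord (f i) (J i) = tens f J by rewrite ffunE.
have -> : \prod_i coord (g i) (K i) = tens g K by rewrite ffunE.
have [->|nz_fJ] := eqVneq (tens f J) 0; first by rewrite !(mul0r, mulr0, scale0r).
have [->|nz_gK] := eqVneq (tens g K) 0; first by rewrite !(mul0r, mulr0, scale0r).
congr (_ *: _); rewrite mulrC !mulrA; congr (_ ^+ _ * _ * _).
congr nat_of_bool; apply: eq_xorsum => i j.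
by rewrite (tens_support ef nz_fJ) (tens_support eg nz_gK).
Qed.

Lemma tmulDl u v w : tmul (u + v) w = tmul u w + tmul v w.
Proof.
rewrite /tmul -big_split; apply: eq_bigr => J _; rewrite -big_split.
by apply: eq_bigr => K _; rewrite ffunE !mulrDl scalerDl.
Qed.
Lemma tmulDr u v w : tmul u (v + w) = tmul u v + tmul u w.
Proof.
rewrite /tmul -big_split; apply: eq_bigr => J _; rewrite -big_split.
by apply: eq_bigr => K _; rewrite ffunE mulrDr mulrDl scalerDl.
Qed.
Lemma tmulZl a u v : tmul (a *: u) v = a *: tmul u v.
Proof.
rewrite /tmul scaler_sumr; apply: eq_bigr => J _; rewrite scaler_sumr.
by apply: eq_bigr => K _; rewrite ffunE scalerA -!mulrA.
Qed.
Lemma tmulZr a u v : tmul u (a *: v) = a *: tmul u v.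
Proof.
rewrite /tmul scaler_sumr; apply: eq_bigr => J _; rewrite scaler_sumr.
apply: eq_bigr => K _; rewrite ffunE scalerA; congr (_ *: _).
by rewrite -[a *: v K]/((a : k) * v K) !mulrA [u J * a]mulrC.
Qed.
Lemma tmul0l u : tmul 0 u = 0.
Proof. by rewrite -(scale0r 0) tmulZl !scale0r. Qed.
Lemma tmul0r u : tmul u 0 = 0.
Proof. by rewrite -(scale0r 0) tmulZr !scale0r. Qed.

Local Notation par J := (fun i => hb_par (J i)).

Lemma par_vec J i : has_parity (hb_par (J i)) (hb_vec (J i)).
Proof. exact: hb_parP. Qed.

Lemma tmulA : associative (@tmul k F B n).
Proof.
move=> u v w; elim/tensor_ind: u => [u u' h h'|a u h||J].
- by rewrite !tmulDl h h'.
- by rewrite !tmulZl h.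
- by rewrite !tmul0l.
elim/tensor_ind: v => [v v' h h'|a v h||K].
- by rewrite tmulDl !tmulDr tmulDl h h'.
- by rewrite tmulZl !tmulZr tmulZl h.
- by rewrite tmul0l !tmul0r tmul0l.
elim/tensor_ind: w => [w w' h h'|a w h||L].
- by rewrite !tmulDr h h'.
- by rewrite !tmulZr h.
- by rewrite !tmul0r.
rewrite /btens (tmul_tens (par_vec J) (par_vec K)) (tmul_tens (par_vec K) (par_vec L)).
rewrite tmulZl tmulZr.
have pM I I' i : has_parity (hb_par ((I : idx) i) (+) hb_par ((I' : idx) i))
    (hb_vec (I i) * hb_vec (I' i)) by apply: parity_M; exact: par_vec.
rewrite (tmul_tens (pM J K) (par_vec L)) (tmul_tens (par_vec J) (pM K L)).
rewrite !scalerA -!signr_addb koszul_addl koszul_addr [in RHS]addbA.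
rewrite [in LHS]addbC; congr (_ *: _).
by apply: eq_tens => i; rewrite mulrA.
Qed.

Lemma par1 : has_parity false (1 : F). Proof. exact: gs_par1. Qed.

Lemma tmul1l : left_id (@tone k F B n) (@tmul k F B n).
Proof.
move=> u; elim/tensor_ind: u => [u v h h'|a u h||J].
- by rewrite tmulDr h h'.
- by rewrite tmulZr h.
- exact: tmul0r.
rewrite /tone /btens (tmul_tens (fun=> par1) (par_vec J)).
rewrite /koszul xorsum0 ?scale1r => [|i j]; last by rewrite andbF.
by apply: eq_tens => i; rewrite mul1r.
Qed.
Lemma tmul1r : right_id (@tone k F B n) (@tmul k F B n).
Proof.
move=> u; elim/tensor_ind: u => [u v h h'|a u h||J].
- by rewrite tmulDl h h'.
- by rewrite tmulZl h.
- exact: tmul0l.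
rewrite /tone /btens (tmul_tens (par_vec J) (fun=> par1)).
rewrite /koszul xorsum0 ?scale1r => [|i j]; last by rewrite !andbF.
by apply: eq_tens => i; rewrite mulr1.
Qed.

End Tensor.

HB.instance Definition _ (k : comNzRingType) (F : gradedSuperalgebra k)
    (B : homogBasis F) (n : nat) :=
  GRing.Zmodule_isPzRing.Build (tensorPower B n) (@tmulA k F B n)
    (@tmul1l k F B n) (@tmul1r k F B n)
    (fun u v w => tmulDl u v w) (fun u v w => tmulDr u v w).

(** * Permutations, twists and single factors *)

Section TensorAction.
Variables (k : comNzRingType) (F : gradedSuperalgebra k) (B : homogBasis F).
Variable n : nat.
Local Notation T := (tensorPower B n).
Local Notation idx := {ffun 'I_n -> B}.
Local Notation tens := (@tens k F B n).
Local Notation btens := (@btens k F B n).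
Local Notation tat := (@tat k F B n).
Implicit Types (u v w : T) (J K L : idx) (e : 'I_n -> bool).

Lemma tscaleAl (a : k) u v : a *: (u * v) = (a *: u) * v.
Proof. exact/esym/tmulZl. Qed.
Lemma tscaleAr (a : k) u v : a *: (u * v) = u * (a *: v).
Proof. exact/esym/tmulZr. Qed.

Lemma tens_mul e e' f g : (forall i, has_parity (e i) (f i)) ->
  (forall i, has_parity (e' i) (g i)) ->
  tens f * tens g = (-1) ^+ koszul e e' *: tens (fun i => f i * g i).
Proof. exact: tmul_tens. Qed.

Lemma linear_tensor_ext (V : lmodType k) (f g : T -> V) : linear f -> linear g ->
  (forall J, f (btens J) = g (btens J)) -> f =1 g.
Proof.
move=> flin glin h u.
have lin0 (f' : T -> V) : linear f' -> f' 0 = 0.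
  by move=> l; have := l (-1) 0 0; rewrite scaler0 addr0 scaleN1r addNr.
elim/tensor_ind: u => [u v hu hv|a u hu||//].
- by rewrite -[u]scale1r flin glin hu hv.
- by rewrite -[_ *: u]addr0 flin glin hu !lin0.
- by rewrite !lin0.
Qed.

Lemma tperm_act_linear (p : 'S_n) : linear (@tperm_act k F B n p).
Proof.
move=> a u v; rewrite /tperm_act scaler_sumr -big_split; apply: eq_bigr => J _ /=.
by rewrite !ffunE scalerA mulrDl scalerDl -mulrA.
Qed.

Lemma tmap_at_linear (psi : F -> F) i : linear (@tmap_at k F B n psi i).
Proof.
move=> a u v; rewrite /tmap_at scaler_sumr -big_split; apply: eq_bigr => J _ /=.
by rewrite !ffunE scalerA scalerDl.
Qed.

Lemma tperm_act_tens p e f : (forall i, has_parity (e i) (f i)) ->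
  tperm_act p (tens f) =
  (-1) ^+ inversions p e *: tens (fun l => f (p^-1%g l)).
Proof.
move=> ef; rewrite (@tens_expand _ _ B _ (fun _ => id) (fun l => f (p^-1%g l))) //.
pose h J : idx := [ffun l => J (p^-1%g l)].
have h_bij : bijective h.
  exists (fun J : idx => [ffun l => J (p l)]) => J; apply/ffunP => l;
    by rewrite !ffunE ?permK ?permKV.
rewrite (reindex h) /=; last exact: onW_bij.
rewrite scaler_sumr; apply: eq_bigr => J _; rewrite scalerA.
have -> : \prod_i hb_coord B (f (p^-1%g i)) (h J i) = tens f J.
  rewrite [RHS]ffunE (reindex_inj (@perm_inj _ p)).
  by apply: eq_bigr => i _; rewrite ffunE permK.
have -> : tens (fun i => hb_vec (h J i)) = tens (fun l => hb_vec (J (p^-1%g l))).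
  by apply: eq_tens => i; rewrite ffunE.
have [->|nz] := eqVneq (tens f J) 0; first by rewrite mul0r mulr0 !scale0r.
congr (_ *: _); rewrite mulrC; congr (_ * _).
rewrite -signr_odd odd_sum2; congr (_ ^+ nat_of_bool _).
by apply: eq_xorsum => i j; rewrite !(tens_support ef nz).
Qed.

Lemma tmap_at_tens (psi : {linear F -> F}) i f :
  tmap_at psi i (tens f) = tens (fun l => if l == i then psi (f l) else f l).
Proof.
rewrite (@tens_expand _ _ B _ (fun l x => if l == i then psi x else x) f); last first.
  by move=> l a x y; case: eqP => // _; rewrite linearP.
by apply: eq_bigr => J _; rewrite ffunE.
Qed.

Lemma tperm_act1 u : tperm_act 1%g u = u.
Proof.
move: u; apply: linear_tensor_ext => [|//|J]; first exact: tperm_act_linear.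
rewrite (tperm_act_tens _ (par_vec J)).
rewrite /inversions xorsum0 ?scale1r => [|i j].
  by apply: eq_tens => i; rewrite invg1 perm1.
by rewrite !perm1; case: ltngtP.
Qed.

Lemma tperm_actM p q u : tperm_act (q * p)%g u = tperm_act p (tperm_act q u).
Proof.
move: u; apply: linear_tensor_ext => [||J]; first exact: tperm_act_linear.
  by move=> a u v; rewrite !tperm_act_linear.
rewrite (tperm_act_tens _ (par_vec J)) (tperm_act_tens q (par_vec J)).
rewrite -[_ *: _ in RHS]addr0 tperm_act_linear.
have -> : tperm_act p 0 = 0 :> T.
  by have := tperm_act_linear p (-1) 0 0; rewrite scaler0 addr0 scaleN1r addNr.
rewrite addr0 (@tperm_act_tens p (fun i => hb_par (J (q^-1%g i)))); last first.
  by move=> i; exact: par_vec.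
rewrite scalerA -signr_addb -inversionsM; congr (_ *: _).
by apply: eq_tens => i; rewrite invMg permM.
Qed.

Lemma tperm_act_mul p u v : tperm_act p (u * v) = tperm_act p u * tperm_act p v.
Proof.
move: u; apply: linear_tensor_ext => [a u w|a u w|J].
- by rewrite mulrDl -tscaleAl tperm_act_linear.
- by rewrite tperm_act_linear mulrDl -tscaleAl.
move: v; apply: linear_tensor_ext => [a u w|a u w|K].
- by rewrite mulrDr -tscaleAr tperm_act_linear.
- by rewrite tperm_act_linear mulrDr -tscaleAr.
have pM i : has_parity (hb_par (J i) (+) hb_par (K i)) (hb_vec (J i) * hb_vec (K i)).
  exact: parity_M (par_vec J i) (par_vec K i).
rewrite (tens_mul (par_vec J) (par_vec K)).
rewrite -[_ *: _ in LHS]addr0 tperm_act_linear.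
have -> : tperm_act p 0 = 0 :> T.
  by have := tperm_act_linear p (-1) 0 0; rewrite scaler0 addr0 scaleN1r addNr.
rewrite addr0 (tperm_act_tens p pM) (tperm_act_tens p (par_vec J)).
rewrite (tperm_act_tens p (par_vec K)) -tscaleAl -tscaleAr !scalerA.
rewrite (@tens_mul (fun i => hb_par (J (p^-1%g i)))
  (fun i => hb_par (K (p^-1%g i)))); first last.
- by move=> i; exact: par_vec.
- by move=> i; exact: par_vec.
by rewrite scalerA -!signr_addb (koszul_perm p).
Qed.

Lemma tperm_act_1 p : tperm_act p 1 = 1 :> T.
Proof.
rewrite [1]/(tone B n) /tone (@tperm_act_tens p (fun=> false)) => [|i]; last exact: par1.
by rewrite /inversions xorsum0 ?scale1r // => i j; rewrite !andbF.
Qed.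

(** The parities of the factors of a tensor with one nontrivial factor. *)
Definition at1 (i : 'I_n) (b : bool) : 'I_n -> bool := fun l => (l == i) && b.

Lemma par_tat b (f : F) i : has_parity b f ->
  forall l, has_parity (at1 i b l) (if l == i then f else 1).
Proof. by move=> bf l; rewrite /at1; case: eqP => // _; exact: par1. Qed.

Lemma tat_linear i : linear (tat i).
Proof.
move=> a f g; apply/ffunP => J; rewrite !ffunE.
rewrite (bigD1 i) //= eqxx hb_coord_lin mulrDl.
rewrite [X in _ = a *: X + _](bigD1 i) //= [X in _ = _ + X](bigD1 i) //= !eqxx.
congr (_ + _); last by congr (_ * _); apply: eq_bigr => l /negPf ->.
rewrite -mulrA; congr (_ * (_ * _)); by apply: eq_bigr => l /negPf ->.
Qed.

Lemma tat_sum (I : Type) (s : seq I) (a : I -> k) (f : I -> F) i :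
  tat i (\sum_(j <- s) a j *: f j) = \sum_(j <- s) a j *: tat i (f j).
Proof.
elim: s => [|j s IHs]; last by rewrite !big_cons tat_linear IHs.
by rewrite !big_nil; have := tat_linear i (-1) 0 0; rewrite scaler0 addr0 scaleN1r addNr.
Qed.

Lemma tat_mul i b b' f g : has_parity b f -> has_parity b' g ->
  tat i f * tat i g = tat i (f * g).
Proof.
move=> bf bg; rewrite (tens_mul (par_tat i bf) (par_tat i bg)).
rewrite /koszul xorsum0 ?scale1r => [|j l].
  by apply: eq_tens => l; case: eqP; rewrite // mulr1.
rewrite /at1; case: eqP => [->|]; rewrite ?andbF //=.
by case: eqP => [->|]; rewrite ?ltnn ?andbF.
Qed.

Lemma tat_comm i j b b' f g : i != j -> has_parity b f -> has_parity b' g ->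
  tat i f * tat j g = (-1) ^+ (b && b') *: (tat j g * tat i f).
Proof.
move=> ne_ij bf bg; rewrite (tens_mul (par_tat i bf) (par_tat j bg)).
rewrite (tens_mul (par_tat j bg) (par_tat i bf)) scalerA -signr_addb.
have one_term (a c : 'I_n) (d d' : bool) : a != c ->
    koszul (at1 a d) (at1 c d') = (c < a)%N && (d && d').
  move=> ne_ac; rewrite /koszul /xorsum (bigD1 a) //= (bigD1 c) //= /at1 !eqxx /=.
  rewrite big1 => [|l /negPf ->]; last by rewrite !andbF.
  rewrite addbF big1 ?addbF // => l /negPf ne; rewrite big1 // => m _.
  by rewrite ne andbF.
rewrite !one_term // 1?eq_sym //; congr (_ *: _).
  rewrite (ltn_xor ne_ij); by case: (i < j)%N; case: b {bf}; case: b' {bg}.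
apply: eq_tens => l; case: eqP => [->|_]; last by rewrite mul1r; case: eqP; rewrite ?mulr1.
by rewrite (negPf ne_ij) mul1r mulr1.
Qed.

Lemma tperm_act_tat p i b f : has_parity b f ->
  tperm_act p (tat i f) = tat (p i) f.
Proof.
move=> bf; rewrite (tperm_act_tens p (par_tat i bf)).
rewrite /inversions xorsum0 ?scale1r => [|j l].
  by apply: eq_tens => l; rewrite (canF_eq (permKV p)).
rewrite /at1; case: eqP => [->|]; rewrite ?andbF //=.
by case: eqP => [->|]; rewrite ?ltnn ?andbF.
Qed.

(** In increasing order of position, no factor has to move past another one. *)
Lemma tens_prod e f (s : seq 'I_n) : (forall i, has_parity (e i) (f i)) ->
  sorted ltn (map val s) ->
  \prod_(i <- s) tat i (f i) = tens (fun l => if l \in s then f l else 1).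
Proof.
move=> ef; elim: s => [|i s IHs] /=; first by rewrite big_nil.
move=> srt; rewrite big_cons IHs ?(path_sorted srt) //.
have lt_s l : l \in s -> (i < l)%N.
  by move=> ls; apply: (allP (order_path_min ltn_trans srt)); exact: map_f.
have es l : has_parity ((l \in s) && e l) (if l \in s then f l else 1).
  by case: (l \in s); [exact: ef|exact: par1].
rewrite (tens_mul (par_tat i (ef i)) es) /koszul xorsum0 ?scale1r => [|l m].
  apply: eq_tens => l; rewrite inE; case: eqP => [->|_] /=; last by rewrite mul1r.
  by case: ifP => [/lt_s|]; rewrite ?ltnn ?mulr1.
rewrite /at1; case: eqP => [->|]; rewrite ?andbF //=.
case: ltnP => //= lt_mi; case ms: (m \in s); rewrite ?andbF //.
by have := ltn_trans lt_mi (lt_s _ ms); rewrite ltnn.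
Qed.

(** Multiplicative identities, such as telt_comm and F1_comm below, thus only
    have to be checked on single factors. *)
Lemma tensor_gen (P : T -> Prop) : P 1 -> (forall u v, P u -> P v -> P (u + v)) ->
  (forall a u, P u -> P (a *: u)) -> (forall u v, P u -> P v -> P (u * v)) ->
  (forall i (b : B), P (tat i (hb_vec b))) -> forall u, P u.
Proof.
move=> P1 PD PZ PM Pat; apply: tensor_ind => //.
  by rewrite -(scale0r (1 : T)); exact: PZ.
move=> J; have -> : btens J = \prod_(i <- enum 'I_n) tat i (hb_vec (J i)).
  rewrite (tens_prod (par_vec J)); last by rewrite val_enum_ord iota_ltn_sorted.
  by apply: eq_tens => i; rewrite mem_enum.
by elim: (enum _) => [|i s IHs]; rewrite ?big_nil // big_cons; apply: PM.
Qed.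

End TensorAction.

(** * Frobenius superalgebras *)

Section Parity.
Variables (k : comNzRingType) (F : gradedSuperalgebra k).

Lemma has_parity_par e (f : F) : has_parity e (gs_par F e f).
Proof. by rewrite /has_parity gs_par_proj eqxx. Qed.

Lemma gs_par_hom e e' (f : F) : has_parity e f -> gs_par F e' f = if e' == e then f else 0.
Proof. by move=> <-; rewrite gs_par_proj; case: eqP => // ->. Qed.

Lemma superize_hom (V : zmodType) (h : F -> F -> V) e e' f g :
  (forall x, h 0 x = 0) -> (forall x, h x 0 = 0) ->
  has_parity e f -> has_parity e' g ->
  superize h f g = if e && e' then - h f g else h f g.
Proof.
move=> h0 h0' ef eg; rewrite /superize !big_bool /= !(gs_par_hom _ ef) !(gs_par_hom _ eg).
by case: e {ef}; case: e' {eg}; rewrite /= ?h0 ?h0' ?oppr0 ?addr0 ?add0r.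
Qed.
End Parity.

Section Frobenius.
Variables (k : comNzRingType) (F : frobeniusSuperalgebra k).
Variables (psi : {lrmorphism F -> F}) (psi_nakayama : is_nakayama psi).
Variables (psi_inj : injective psi).
Variables (B : homogBasis F) (bd : B -> F) (bd_dual : is_left_dual bd).
Local Notation tr := (fr_tr F).

Lemma tr_odd e (f g : F) : has_parity e f -> has_parity (~~ e) g -> tr (f * g) = 0.
Proof.
by move=> ef eg; apply: fr_tr_parity; have := parity_M ef eg; rewrite addbN addbb.
Qed.

Lemma nakayama_hom e e' (f g : F) : has_parity e f -> has_parity e' g ->
  tr (f * g) = (-1) ^+ (e && e') * tr (g * psi f).
Proof.
move=> ef eg; rewrite psi_nakayama (superize_hom _ _ ef eg) => [|x|x].
- by case: (e && e'); rewrite ?mulN1r ?mul1r.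
- by rewrite linear0 mulr0 linear0.
- by rewrite mul0r linear0.
Qed.

(** The pairing in fr_tr_iso carries signs, which disappear on homogeneous
    parts. *)
Lemma tr_nondeg_r f : (forall g, tr (g * f) = 0) -> f = 0.
Proof.
move=> h; have [f0 [_ uniq0]] := fr_tr_iso (\0 : {linear F -> k^o}).
rewrite -[f]uniq0 => [|g]; last first.
  rewrite /superize big1 // => e _; rewrite big1 // => e' _.
  suff -> : tr (gs_par F e' g * gs_par F e f) = 0 by rewrite oppr0; case: ifP.
  have [<-|ne] := eqVneq e e'; last first.
    apply: (tr_odd (e := e')); first exact: has_parity_par.
    by have -> : ~~ e' = e by [case: e e' ne => [] []]; exact: has_parity_par.
  rewrite -[RHS](h (gs_par F e g)) {2}[f](gs_par_sum f) mulrDr linearD /=.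
  case: e.
    by rewrite [X in _ = X + _](@tr_odd true) ?add0r //; exact: has_parity_par.
  by rewrite [X in _ = _ + X](@tr_odd false) ?addr0 //; exact: has_parity_par.
apply: uniq0 => g; rewrite /superize big1 // => e _; rewrite big1 // => e' _.
by rewrite linear0 mulr0 linear0 oppr0; case: ifP.
Qed.

(** The component of psi f of the other parity is orthogonal to everything,
    because the trace kills odd products. *)
Lemma psi_par e f : has_parity e f -> has_parity e (psi f).
Proof.
move=> ef.
have split_par g : g = gs_par F e g + gs_par F (~~ e) g.
  by rewrite {1}[g](gs_par_sum g); case: e {ef}; rewrite // addrC.
suff h : gs_par F (~~ e) (psi f) = 0 by rewrite /has_parity [RHS]split_par h addr0.
apply: tr_nondeg_r => g; rewrite (split_par g) mulrDl linearD /=.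
rewrite (@tr_odd e) ?add0r; [|exact: has_parity_par..].
have -> : gs_par F (~~ e) (psi f) = psi f - gs_par F e (psi f).
  by rewrite {2}[psi f]split_par addrC addKr.
rewrite mulrBr linearB /= [X in _ - X](@tr_odd (~~ e)) ?negbK ?subr0;
  [|exact: has_parity_par..].
have := nakayama_hom ef (has_parity_par (~~ e) g).
rewrite (tr_odd ef (has_parity_par _ _)) => /esym/eqP.
by case: e {ef split_par}; rewrite /= ?mulN1r ?mul1r ?oppr_eq0 => /eqP.
Qed.

Lemma tr_nondeg_l f : (forall g, tr (f * g) = 0) -> f = 0.
Proof.
move=> h; apply: psi_inj; rewrite linear0; apply: tr_nondeg_r => g.
have split_tr x y : tr (x * y) =
    tr (gs_par F false x * gs_par F false y) + tr (gs_par F true x * gs_par F true y).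
  rewrite {1}[x]gs_par_sum {1}[y]gs_par_sum mulrDl !mulrDr !linearD /=.
  rewrite [X in _ + X + _](@tr_odd false) ?addr0; [|exact: has_parity_par..].
  by rewrite [X in _ + (X + _)](@tr_odd true) ?add0r; [|exact: has_parity_par..].
have tr0 e : tr (gs_par F e f * gs_par F e g) = 0.
  rewrite -[RHS](h (gs_par F e g)) split_tr !(gs_par_hom _ (has_parity_par e g)).
  by case: e; rewrite /= ?mulr0 ?linear0 ?addr0 ?add0r.
have tr0' e : tr (gs_par F e g * gs_par F e (psi f)) = 0.
  have -> : gs_par F e (psi f) = psi (gs_par F e f).
    rewrite {1}[f]gs_par_sum 2!linearD /=.
    rewrite !(gs_par_hom _ (psi_par (has_parity_par _ f))).
    by case: e; rewrite /= ?addr0 ?add0r.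
  have := nakayama_hom (has_parity_par e f) (has_parity_par e g).
  rewrite tr0 => /esym/eqP.
  by case: e; rewrite /= ?mulN1r ?mul1r ?oppr_eq0 => /eqP.
by rewrite split_tr !tr0' addr0.
Qed.

Lemma tr_vec_ext (f : F) : (forall b : B, tr (f * hb_vec b) = 0) -> f = 0.
Proof.
move=> h; apply: tr_nondeg_l => g; rewrite [g](hb_coordE B) mulr_sumr linear_sum.
by apply: big1 => b _; rewrite -scalerAr linearZ /= h; exact: mulr0.
Qed.

(** The component of the other parity pairs to zero with every basis vector. *)
Lemma bd_par b : has_parity (hb_par b) (bd b).
Proof.
set e := hb_par b.
have split_par g : g = gs_par F e g + gs_par F (~~ e) g.
  by rewrite {1}[g](gs_par_sum g); case: e; rewrite // addrC.
suff h : gs_par F (~~ e) (bd b) = 0 by rewrite /has_parity [RHS]split_par h addr0.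
apply: tr_vec_ext => c; have [ec|ne] := eqVneq (hb_par c) e.
  by apply: (@tr_odd (~~ e)); rewrite ?negbK -?ec; [exact: has_parity_par|exact: hb_parP].
have neq_negb (a a' : bool) : a != a' -> a = ~~ a' by case: a; case: a'.
have ec := neq_negb _ _ ne.
have -> : gs_par F (~~ e) (bd b) = bd b - gs_par F e (bd b).
  by rewrite {2}[bd b]split_par addrC addKr.
rewrite mulrBl linearB /= bd_dual (@tr_odd e (gs_par F e _)) ?subr0.
- by case: eqP => // bc; rewrite -bc eqxx in ne.
- exact: has_parity_par.
- by rewrite -ec; exact: hb_parP.
Qed.

Lemma vec_expand f : f = \sum_c tr (bd c * f) *: hb_vec c.
Proof.
rewrite {1}[f](hb_coordE B); apply: eq_bigr => c _; congr (_ *: _).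
rewrite [f in RHS](hb_coordE B) mulr_sumr linear_sum (bigD1 c) //= big1 ?addr0.
  by rewrite -scalerAr linearZ /= bd_dual eqxx [RHS]mulr1.
by move=> b /negPf ne; rewrite -scalerAr linearZ /= bd_dual eq_sym ne [LHS]mulr0.
Qed.

Lemma bd_expand f : f = \sum_c tr (f * hb_vec c) *: bd c.
Proof.
apply/eqP; rewrite -subr_eq0; apply/eqP/tr_vec_ext => b.
rewrite mulrBl linearB /= mulr_suml linear_sum (bigD1 b) //= big1 ?addr0.
  by rewrite -scalerAl linearZ /= bd_dual eqxx [X in _ - X]mulr1 subrr.
by move=> c /negPf ne; rewrite -scalerAl linearZ /= bd_dual ne [LHS]mulr0.
Qed.

End Frobenius.

(** * The wreath datum of a Frobenius superalgebra *)

Section TensorDatum.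
Variables (k : comNzRingType) (F : frobeniusSuperalgebra k).
Variables (psi : {lrmorphism F -> F}) (psi_nakayama : is_nakayama psi).
Variables (psi_inj : injective psi).
Variables (B : homogBasis F) (bd : B -> F) (bd_dual : is_left_dual bd).
Variable n : nat.
Local Notation tr := (fr_tr F).
Local Notation T := (tensorPower B n).
Local Notation idx := {ffun 'I_n -> B}.
Local Notation tens := (@tens k F B n).
Local Notation btens := (@btens k F B n).
Local Notation tat := (@tat k F B n).
Implicit Types (u v w : T) (J K L : idx) (e : 'I_n -> bool).

Lemma tperm_actB (p : 'S_n) : {morph @tperm_act k F B n p : u v / u - v}.
Proof.
by move=> u v; rewrite addrC -scaleN1r tperm_act_linear scaleN1r addrC.
Qed.
Lemma tperm_act_monoid (p : 'S_n) : GRing.monoid_morphism (@tperm_act k F B n p).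
Proof. by split=> [|u v]; [exact: tperm_act_1|exact: tperm_act_mul]. Qed.
Definition tperm_morph (p : 'S_n) : {rmorphism T -> T} :=
  HB.pack_for {rmorphism T -> T} (@tperm_act k F B n p)
    (GRing.isZmodMorphism.Build T T _ (tperm_actB p))
    (GRing.isMonoidMorphism.Build T T _ (tperm_act_monoid p)).

Lemma tmap_atB i : {morph @tmap_at k F B n psi i : u v / u - v}.
Proof.
by move=> u v; rewrite addrC -scaleN1r tmap_at_linear scaleN1r addrC.
Qed.

Lemma par_twist e i f : (forall l, has_parity (e l) (f l)) ->
  forall l, has_parity (e l) (if l == i then psi (f l) else f l).
Proof. by move=> ef l; case: eqP => // _; apply: psi_par. Qed.

Lemma tmap_at_monoid i : GRing.monoid_morphism (@tmap_at k F B n psi i).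
Proof.
split=> [|u v].
  rewrite [1 in LHS]/(tone B n) /tone tmap_at_tens; apply: eq_tens => l.
  by case: eqP; rewrite // rmorph1.
move: u; apply: linear_tensor_ext => [a u w|a u w|J].
- by rewrite mulrDl -tscaleAl tmap_at_linear.
- by rewrite tmap_at_linear mulrDl -tscaleAl.
move: v; apply: linear_tensor_ext => [a u w|a u w|K].
- by rewrite mulrDr -tscaleAr tmap_at_linear.
- by rewrite tmap_at_linear mulrDr -tscaleAr.
rewrite (tens_mul B (par_vec J) (par_vec K)) -[_ *: _ in LHS]addr0 tmap_at_linear.
have -> : tmap_at psi i 0 = 0 :> T by rewrite -(subrr 0) tmap_atB !subrr.
rewrite addr0 !tmap_at_tens.
rewrite (tens_mul B (par_twist i (par_vec J)) (par_twist i (par_vec K))).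
by congr (_ *: _); apply: eq_tens => l; case: eqP => // _; rewrite rmorphM.
Qed.
Definition twist_morph i : {rmorphism T -> T} :=
  HB.pack_for {rmorphism T -> T} (@tmap_at k F B n psi i)
    (GRing.isZmodMorphism.Build T T _ (tmap_atB i))
    (GRing.isMonoidMorphism.Build T T _ (tmap_at_monoid i)).

Lemma tperm_act_sum (p : 'S_n) (I : Type) (s : seq I) (f : I -> T) :
  tperm_act p (\sum_(i <- s) f i) = \sum_(i <- s) tperm_act p (f i).
Proof. exact: (raddf_sum (tperm_morph p)). Qed.
Lemma tmap_at_sum i (I : Type) (s : seq I) (f : I -> T) :
  tmap_at psi i (\sum_(i <- s) f i) = \sum_(j <- s) tmap_at psi i (f j).
Proof. exact: (raddf_sum (twist_morph i)). Qed.
Lemma tmap_atM i u v : tmap_at psi i (u * v) = tmap_at psi i u * tmap_at psi i v.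
Proof. exact: (rmorphM (twist_morph i)). Qed.

Lemma twist_tat i j (f : F) :
  tmap_at psi i (tat j f) = tat j (if j == i then psi f else f).
Proof.
rewrite tmap_at_tens; apply: eq_tens => l.
by have [->//|_] := eqVneq l j; rewrite rmorph1 if_same.
Qed.

Lemma twist_commute i j u :
  tmap_at psi i (tmap_at psi j u) = tmap_at psi j (tmap_at psi i u).
Proof.
move: u; apply: linear_tensor_ext => [a u w|a u w|J].
- by rewrite !tmap_at_linear.
- by rewrite !tmap_at_linear.
rewrite !tmap_at_tens; apply: eq_tens => l.
by case: eqP => // ->; case: eqP.
Qed.

Lemma tperm_act_twist p i u :
  tperm_act p (tmap_at psi i u) = tmap_at psi (p i) (tperm_act p u).
Proof.
move: u; apply: linear_tensor_ext => [a u w|a u w|J].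
- by rewrite tmap_at_linear tperm_act_linear.
- by rewrite tperm_act_linear tmap_at_linear.
rewrite tmap_at_tens (tperm_act_tens B p (par_twist i (par_vec J))).
rewrite (tperm_act_tens B p (par_vec J)) -[_ *: _ in RHS]addr0 tmap_at_linear.
have -> : tmap_at psi (p i) 0 = 0 :> T by rewrite -(subrr 0) tmap_atB !subrr.
rewrite addr0 tmap_at_tens; congr (_ *: _); apply: eq_tens => l.
by rewrite (canF_eq (permKV p)).
Qed.

Local Notation te := (@t_elt k F B bd n).

Lemma t_eltE i j : te i j = \sum_b tat i (hb_vec b) * tat j (bd b) :> T.
Proof. by []. Qed.

Local Notation bdp := (bd_par psi_nakayama psi_inj bd_dual).

Lemma tperm_act_telt p i j : i != j -> tperm_act p (te i j) = te (p i) (p j).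
Proof.
move=> ne_ij; rewrite !t_eltE tperm_act_sum; apply: eq_bigr => b _.
by rewrite /= tperm_act_mul (tperm_act_tat B _ _ (hb_parP b)) (tperm_act_tat B _ _ (bdp b)).
Qed.

Lemma twist_telt i j l : i != j -> l != i -> l != j -> tmap_at psi l (te i j) = te i j.
Proof.
move=> ne_ij ne_li ne_lj; rewrite !t_eltE tmap_at_sum.
apply: eq_bigr => b _; rewrite tmap_atM !twist_tat.
by rewrite ![_ == l]eq_sym (negPf ne_li) (negPf ne_lj).
Qed.

(** In the basis, both sides have the coefficients tr (c^v psi (b^v)), by the
    definition of psi. *)
Lemma twist_telt_tr i j : i != j -> tmap_at psi j (te i j) = te j i.
Proof.
move=> ne_ij; rewrite !t_eltE tmap_at_sum.
under eq_bigr => b _.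
  rewrite tmap_atM !twist_tat eqxx (negPf ne_ij).
  rewrite [psi (bd b)](vec_expand bd_dual) tat_sum mulr_sumr.
  over.
rewrite exchange_big /=; apply: eq_bigr => c _.
rewrite [in RHS](tat_comm B _ (hb_parP c) (bdp c)); last by rewrite eq_sym.
rewrite andbb [bd c in RHS](vec_expand bd_dual) tat_sum mulr_suml scaler_sumr.
apply: eq_bigr => b _; rewrite -tscaleAr -tscaleAl scalerA; congr (_ *: _).
rewrite (nakayama_hom psi_nakayama (bdp b) (bdp c)) mulrA -signr_addb.
have [ebc|ne_bc] := eqVneq (hb_par b) (hb_par c).
  by rewrite ebc andbb addbb mul1r.
have ne_par : hb_par c = ~~ hb_par b by move: ne_bc; case: (hb_par b); case: (hb_par c).
have pc : has_parity (~~ hb_par b) (bd c) by rewrite -ne_par; exact: bdp.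
have pb : has_parity (~~ ~~ hb_par b) (psi (bd b)).
  by rewrite negbK; apply: psi_par => //; exact: bdp.
by rewrite (tr_odd pc pb) mulr0.
Qed.

(** The sums of f b (x) b^v and of b (x) b^v f have the same coefficients
    tr (c^v f b). *)
Lemma telt_at i j (b : bool) (f : F) : i != j -> has_parity b f ->
  tat i f * te i j = te i j * tat j f.
Proof.
move=> ne_ij bf; rewrite !t_eltE mulr_sumr mulr_suml.
under eq_bigr => c _.
  rewrite mulrA (tat_mul B _ bf (hb_parP c)) [f * _](vec_expand bd_dual) tat_sum mulr_suml.
  over.
rewrite exchange_big /=; apply: eq_bigr => c _.
rewrite -mulrA (tat_mul B _ (bdp c) bf).
rewrite [bd c * f](bd_expand psi_nakayama psi_inj bd_dual) tat_sum mulr_sumr.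
by apply: eq_bigr => a _; rewrite -tscaleAl -tscaleAr mulrA.
Qed.

(** The automorphism psi enters because f moves around the trace. *)
Lemma telt_at_tr i j (e : bool) (f : F) : i != j -> has_parity e f ->
  tat j f * te i j = te i j * tat i (psi f).
Proof.
move=> ne_ij ef; have ne_ji : j != i by rewrite eq_sym.
have epf : has_parity e (psi f) by apply: psi_par.
rewrite !t_eltE mulr_sumr mulr_suml.
under eq_bigr => b _.
  rewrite mulrA (tat_comm B ne_ji ef (hb_parP b)) -tscaleAl -mulrA.
  rewrite (tat_mul B _ ef (bdp b)) [f * _](bd_expand psi_nakayama psi_inj bd_dual).
  rewrite tat_sum mulr_sumr scaler_sumr.
  over.
rewrite exchange_big /=; apply: eq_bigr => c _.
rewrite -mulrA (tat_comm B ne_ji (bdp c) epf) -tscaleAr mulrA.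
rewrite (tat_mul B _ (hb_parP c) epf).
rewrite [hb_vec c * psi f](vec_expand bd_dual) tat_sum mulr_suml scaler_sumr.
apply: eq_bigr => b _; rewrite -tscaleAr -tscaleAl !scalerA; congr (_ *: _).
have pfb : has_parity (e (+) hb_par b) (f * bd b) by apply: parity_M => //; exact: bdp.
have pbc : has_parity (hb_par b (+) hb_par c) (bd b * hb_vec c).
  by apply: parity_M; [exact: bdp|exact: hb_parP].
rewrite -[f * bd b * _]mulrA (nakayama_hom psi_nakayama ef pbc) !mulrA -signr_addb.
congr (_ ^+ nat_of_bool _ * _).
by case: e {ef epf pfb}; case: (hb_par b); case: (hb_par c).
Qed.

Lemma telt_at_other i j l (e : bool) (f : F) :
  i != j -> l != i -> l != j -> has_parity e f ->
  tat l f * te i j = te i j * tat l f.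
Proof.
move=> ne_ij ne_li ne_lj ef; rewrite !t_eltE mulr_sumr mulr_suml.
apply: eq_bigr => b _; rewrite mulrA (tat_comm B ne_li ef (hb_parP b)).
rewrite -tscaleAl -mulrA (tat_comm B ne_lj ef (bdp b)) -tscaleAr scalerA.
by rewrite -signr_addb addbb scale1r mulrA.
Qed.

Lemma telt_comm i j u : i != j ->
  u * te i j = te i j * tperm_act (tperm i j) (tmap_at psi j u).
Proof.
move=> ne_ij; elim/tensor_gen: u => [|u v hu hv|a u hu|u v hu hv|l b].
- have -> : tmap_at psi j 1 = 1 :> T by exact: (rmorph1 (twist_morph j)).
  by rewrite tperm_act_1 mulr1 mul1r.
- rewrite -[u]scale1r tmap_at_linear tperm_act_linear mulrDl -tscaleAl hu hv.
  by rewrite mulrDr -tscaleAr.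
- rewrite -[a *: u]addr0 tmap_at_linear tperm_act_linear mulrDl -tscaleAl hu.
  have -> : tmap_at psi j 0 = 0 :> T by exact: (rmorph0 (twist_morph j)).
  have -> : tperm_act (tperm i j) 0 = 0 :> T by exact: (rmorph0 (tperm_morph _)).
  by rewrite addr0 mul0r addr0 tscaleAr.
- by rewrite tmap_atM tperm_act_mul -mulrA hv mulrA hu !mulrA.
have ef := hb_parP b.
rewrite twist_tat; have [->|ne_lj] := eqVneq l j.
  by rewrite (tperm_act_tat B _ _ (psi_par psi_nakayama ef)) tpermR (telt_at_tr _ ef).
rewrite (tperm_act_tat B _ _ ef); have [->|ne_li] := eqVneq l i.
  by rewrite tpermL (telt_at _ ef).
by rewrite tpermD 1?eq_sym // (telt_at_other _ _ _ ef) // eq_sym.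
Qed.

Definition tensor_datum : wreathDatum n T :=
  @WreathDatum n T tperm_morph twist_morph te
    (@tperm_act1 _ _ B n) (@tperm_actM _ _ B n) twist_commute tperm_act_twist
    tperm_act_telt (fun i j r => @telt_comm i j r) twist_telt twist_telt_tr.

End TensorDatum.

(** * The coefficients of the presented algebra *)

Section Presented.
Variables (k : comNzRingType) (G : Type) (rel : term k G -> term k G -> Prop).
Local Notation A := (presAlg rel).

Definition tpi (s : term k G) : A := \pi_(presAlg rel) s.

Lemma tpiP s t : tpi s = tpi t <-> teq rel s t.
Proof. exact: presAlg_eqP. Qed.
Lemma tpiW (P : A -> Prop) : (forall s, P (tpi s)) -> forall a, P a.
Proof. exact: presW. Qed.
Lemma tpiM s t : tpi s * tpi t = tpi (Tmul s t).
Proof. exact: pi_mulE. Qed.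
Lemma tpiD s t : tpi s + tpi t = tpi (Tadd s t).
Proof. exact: pi_addE. Qed.
Lemma tpiN s : - tpi s = tpi (Topp s).
Proof. exact: pi_oppE. Qed.
Lemma tpiZ a s : a *: tpi s = tpi (Tscale a s).
Proof. exact: pi_scaleE. Qed.
Lemma tpi0 : 0 = tpi Tzero. Proof. by []. Qed.
Lemma tpi1 : 1 = tpi Tone. Proof. by []. Qed.

(** Every element is a combination of words in the generators, which are built
    by left multiplications. *)
Lemma presAlg_ind (Q : A -> Prop) : Q 1 ->
  (forall a b, Q a -> Q b -> Q (a - b)) -> (forall c a, Q a -> Q (c *: a)) ->
  (forall g a, Q a -> Q (pgen rel g * a)) -> forall a, Q a.
Proof.
move=> Q1 QB QZ Qg.
have Q0 : Q 0 by rewrite -(subrr 1); apply: QB.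
suff main s : forall a, Q a -> Q (tpi s * a).
  by elim/tpiW => s; rewrite -[tpi s]mulr1; apply: main.
elim: s => [g||| s IHs|s IHs t IHt|s IHs t IHt|c s IHs] a Qa.
- exact: Qg.
- by rewrite -tpi0 mul0r.
- by rewrite -tpi1 mul1r.
- by rewrite -tpiN mulNr -sub0r; apply: QB => //; apply: IHs.
- rewrite -tpiD mulrDl -[tpi t * a]opprK; apply: (QB); first exact: IHs.
  by rewrite -sub0r; apply: QB => //; apply: IHt.
- by rewrite -tpiM -mulrA; apply/IHs/IHt.
- by rewrite -tpiZ -pres_scaleAl; apply/QZ/IHs.
Qed.
End Presented.

Section AffineWreathDatum.
Variables (k : comNzRingType) (F : frobeniusSuperalgebra k).
Variables (psi : {lrmorphism F -> F}) (psi_nakayama : is_nakayama psi).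
Variables (psi_inj : injective psi).
Variables (B : homogBasis F) (bd : B -> F) (bd_dual : is_left_dual bd).
Variable n : nat.
Local Notation T := (tensorPower B n).
Local Notation D := (tensor_datum psi_nakayama psi_inj bd_dual n).
Local Notation smash := {ffun 'S_n -> T}.
Local Notation Phi := (seq 'I_n -> smash).
Local Notation A := (presAlg (@awp_rel k F B psi bd n)).
Local Notation gen := (awp_gen B n).

(** A right action: in a product, the left factor acts first. *)
Fixpoint term_op (s : term k gen) (phi : Phi) : Phi :=
  match s with
  | Tgen (Gx i) => x_op i phi
  | Tgen (Gtens u) => r_op D u phi
  | Tgen (Gperm p) => p_op D p phi
  | Tzero => 0
  | Tone => phi
  | Topp s => - term_op s phi
  | Tadd s t => term_op s phi + term_op t phi
  | Tmul s t => term_op t (term_op s phi)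
  | Tscale a s => a *: term_op s phi
  end.

Lemma scaleB (a : k) : {morph (fun w : smash => a *: w) : v w / v - w}.
Proof. by move=> v w; rewrite scalerBr. Qed.
Lemma smash_rZ (a : k) (w : smash) r : a *: smash_r D w r = smash_r D (a *: w) r.
Proof. by apply/ffunP => q; rewrite !ffunE tscaleAl. Qed.
Lemma smash_pZ (a : k) (w : smash) p : a *: smash_p w p = smash_p (a *: w) p.
Proof. by apply/ffunP => q; rewrite !ffunE. Qed.

Lemma r_opZ (a : k) r phi : r_op D r (a *: phi) = a *: r_op D r phi.
Proof. by apply: (@r_op_comm n T D ( *:%R a)) => w s; exact: smash_rZ. Qed.
Lemma p_opZ (a : k) p phi : p_op D p (a *: phi) = a *: p_op D p phi.
Proof.
apply: (@p_op_comm n T D ( *:%R a)) => [|w s|w q].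
- exact: scaleB.
- exact: smash_rZ.
- exact: smash_pZ.
Qed.

Lemma foldl_twistZ a (r : T) (u : seq 'I_n) :
  foldl (fun s i => wd_twist D i s) (a *: r) u = a *: foldl (fun s i => wd_twist D i s) r u.
Proof.
elim: u r => //= i u IHu r; rewrite -IHu; congr foldl.
rewrite -[a *: r]addr0 [LHS]tmap_at_linear (_ : tmap_at psi i 0 = 0) ?addr0 //.
exact: (rmorph0 (wd_twist D i)).
Qed.

Lemma r_opZl a r phi : r_op D (a *: r) phi = a *: r_op D r phi.
Proof.
apply/funext => u; rewrite /r_op foldl_twistZ; apply/ffunP => q.
rewrite !ffunE tscaleAr; congr (_ * _); rewrite -[a *: foldl _ _ _]addr0.
rewrite [LHS]tperm_act_linear (_ : tperm_act q 0 = 0) ?addr0 //.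
exact: (rmorph0 (wd_act D q)).
Qed.

Lemma term_opB s : {morph term_op s : f g / f - g}.
Proof.
elim: s => [[i|u|p]||| s IHs|s IHs t IHt|s IHs t IHt|c s IHs] f g //=.
- exact: (raddfB (r_op D u)).
- exact: (raddfB (p_op D p)).
- by rewrite subrr.
- by rewrite IHs opprD.
- by rewrite IHs IHt [in RHS]opprD addrACA.
- by rewrite IHs IHt.
- by rewrite IHs scalerBr.
Qed.
Lemma term_op0 s : term_op s 0 = 0.
Proof. by rewrite -(subrr 0) term_opB !subrr. Qed.
Lemma term_opN s phi : term_op s (- phi) = - term_op s phi.
Proof. by rewrite -sub0r term_opB term_op0 sub0r. Qed.
Lemma term_opD s f g : term_op s (f + g) = term_op s f + term_op s g.
Proof. by rewrite -{1}[g]opprK term_opB term_opN opprK. Qed.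

Lemma term_opZ (a : k) s phi : term_op s (a *: phi) = a *: term_op s phi.
Proof.
elim: s phi => [[i|u|p]||| s IHs|s IHs t IHt|s IHs t IHt|c s IHs] phi //=.
- exact: r_opZ.
- exact: p_opZ.
- by rewrite scaler0.
- by rewrite IHs scalerN.
- by rewrite IHs IHt scalerDr.
- by rewrite IHs IHt.
- by rewrite IHs !scalerA mulrC.
Qed.

Local Notation sym := (@symmetric_fun n T).

Lemma term_op_sym s phi : sym phi -> sym (term_op s phi).
Proof.
elim: s phi => [[i|u|p]||| s IHs|s IHs t IHt|s IHs t IHt|c s IHs] phi sphi //=.
- exact: symmetric_x.
- exact: symmetric_r.
- exact: symmetric_p.
- exact/symmetric_N/IHs.
- by apply: symmetric_D; [exact: IHs|exact: IHt].
- exact/IHt/IHs.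
- by move=> w i j u; have := IHs _ sphi w i j u; rewrite scalrfctE => ->.
Qed.

Lemma term_op_rel s t phi : awp_rel psi bd s t -> sym phi -> term_op s phi = term_op t phi.
Proof.
move=> st sphi; case: st => [i j|u v|a u|u v||p q||u i|i i' j i'E ji ji'|i i' i'E|p u] /=.
- exact: symmetric_xx.
- exact: r_opD.
- exact: r_opZl.
- exact: r_opM.
- exact: r_op1.
- by rewrite p_opM.
- exact: p_op1.
- exact: x_r_op.
- exact: x_s_op.
- exact: x_s_op_l.
- exact: r_p_op.
Qed.

(** Among the relations, x_i x_j = x_j x_i is the one that needs symmetry. *)
Lemma term_op_teq s t phi : teq (@awp_rel k F B psi bd n) s t -> sym phi ->
  term_op s phi = term_op t phi.
Proof.
move=> st; elim: st phi => {s t} /=.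
- by move=> s t st phi; exact: term_op_rel.
- by [].
- by move=> s t _ IH phi sphi; rewrite IH.
- by move=> s t u _ IH1 _ IH2 phi sphi; rewrite IH1 ?IH2.
- by move=> s s' _ IH phi sphi; rewrite IH.
- by move=> s s' t t' _ IH1 _ IH2 phi sphi; rewrite IH1 ?IH2.
- by move=> s s' t t' _ IH1 _ IH2 phi sphi; rewrite IH1 ?IH2 //; exact: term_op_sym.
- by move=> a s s' _ IH phi sphi; rewrite IH.
- by move=> s t u phi _; rewrite addrA.
- by move=> s t phi _; rewrite addrC.
- by move=> s phi _; rewrite add0r.
- by move=> s phi _; rewrite addNr.
- by [].
- by [].
- by [].
- by move=> s t u phi _; rewrite term_opD.
- by [].
- by move=> a b s phi _; rewrite scalerA.
- by move=> s phi _; rewrite scale1r.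
- by move=> a s t phi _; rewrite scalerDr.
- by move=> a b s phi _; rewrite scalerDl.
- by move=> a s t phi _; rewrite term_opZ.
- by [].
Qed.

Definition alg_op (a : A) (phi : Phi) : Phi := term_op (repr a) phi.

Lemma alg_op_tpi s phi : sym phi -> alg_op (tpi _ s) phi = term_op s phi.
Proof. by move=> sphi; apply: term_op_teq sphi; exact: teq_repr. Qed.

Lemma alg_op_sym a phi : sym phi -> sym (alg_op a phi).
Proof. exact: term_op_sym. Qed.

Lemma alg_op_gen g phi : sym phi -> alg_op (pgen _ g) phi = term_op (Tgen k g) phi.
Proof. exact: alg_op_tpi. Qed.

Lemma alg_op1 phi : sym phi -> alg_op 1 phi = phi.
Proof. by move=> sphi; rewrite tpi1 alg_op_tpi. Qed.

Lemma alg_opM a b phi : sym phi -> alg_op (a * b) phi = alg_op b (alg_op a phi).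
Proof.
move=> sphi; elim/tpiW: a => s; elim/tpiW: b => t.
by rewrite tpiM !alg_op_tpi //; exact: term_op_sym.
Qed.

Lemma alg_opB a b phi : sym phi -> alg_op (a - b) phi = alg_op a phi - alg_op b phi.
Proof.
move=> sphi; elim/tpiW: a => s; elim/tpiW: b => t.
by rewrite tpiN tpiD !alg_op_tpi.
Qed.

Local Notation E := {ffun 'I_n -> nat}.

Definition content (u : seq 'I_n) : E := [ffun i => count_mem i u].

(** For be = 0 this is the coefficient of x^al, as a function on words; in
    general be counts the letters that x_op has consumed. *)
Definition dual_fun (al be : E) : Phi :=
  fun u => if al == expo_add be (content u) then smash_delta 1%g 1 else 0.

Lemma dual_fun_sym al be : sym (dual_fun al be).
Proof.
move=> w i j u; rewrite /dual_fun; congr (if _ == expo_add be _ then _ else _).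
by apply/ffunP => l; rewrite !ffunE !count_cat /= [X in (_ + X)%N]addnCA.
Qed.

Definition shifts (a : A) (ga : E) :=
  forall al be, alg_op a (dual_fun al be) = dual_fun al (expo_add be ga).

Lemma shifts1 : shifts 1 expo0.
Proof.
move=> al be; rewrite alg_op1; last exact: dual_fun_sym.
by congr dual_fun; apply/ffunP => i; rewrite !ffunE addn0.
Qed.
Lemma shiftsM a b ga de : shifts a ga -> shifts b de -> shifts (a * b) (expo_add ga de).
Proof.
move=> ha hb al be; rewrite alg_opM; last exact: dual_fun_sym.
by rewrite ha hb; congr dual_fun; apply/ffunP => i; rewrite !ffunE addnA.
Qed.

Local Notation x := (@aw_x k F B psi bd n).
Local Notation pp := (@aw_perm k F B psi bd n).
Local Notation rr := (@aw_tens k F B psi bd n).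

Lemma shifts_x i : shifts (x i) (expo_at i 1).
Proof.
move=> al be; rewrite alg_op_gen; last exact: dual_fun_sym.
apply/funext => u; rewrite /= /x_op /dual_fun; congr (if _ == _ then _ else _).
by apply/ffunP => j; rewrite !ffunE /= addnA [i == j]eq_sym; case: (j == i).
Qed.

Lemma eq_shifts a ga de : ga = de -> shifts a ga -> shifts a de.
Proof. by move=> ->. Qed.

Lemma shifts_xpow i m : shifts (x i ^+ m) (expo_at i m).
Proof.
elim: m => [|m IHm].
  apply: eq_shifts shifts1; apply/ffunP => j; rewrite !ffunE; case: eqP => //.
rewrite exprS; apply: eq_shifts (shiftsM (shifts_x i) IHm).
by apply/ffunP => j; rewrite !ffunE; case: eqP.
Qed.

Lemma shifts_prod (ga : E) : shifts (\prod_i x i ^+ ga i) ga.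
Proof.
suff main (s : seq 'I_n) : uniq s ->
    shifts (\prod_(i <- s) x i ^+ ga i) [ffun i => if i \in s then ga i else 0%N].
  apply: eq_shifts (main _ (index_enum_uniq _)).
  by apply/ffunP => i; rewrite ffunE mem_index_enum.
elim: s => [_|i s IHs /andP[i_s us]].
  by rewrite big_nil; apply: eq_shifts shifts1; apply/ffunP => i; rewrite !ffunE.
rewrite big_cons; apply: eq_shifts (shiftsM (shifts_xpow i (ga i)) (IHs us)).
apply/ffunP => j; rewrite !ffunE inE; case: eqP => [->|_] //=.
by rewrite (negPf i_s) addn0.
Qed.

Lemma aw_tensB : {morph rr : u v / u - v}.
Proof.
have rD u v : rr (u + v) = rr u + rr v.
  by rewrite /aw_tens /pgen -!/(tpi _ _) tpiD; apply/tpiP/teq_rel; constructor.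
move=> u v; apply/eqP; rewrite eq_sym subr_eq -rD subrK; exact: eqxx.
Qed.
Lemma aw_tensZ a u : rr (a *: u) = a *: (rr u : A).
Proof. by rewrite /aw_tens /pgen -!/(tpi _ _) tpiZ; apply/tpiP/teq_rel; constructor. Qed.
Lemma aw_tens_monoid : GRing.monoid_morphism (rr : T -> A).
Proof.
split=> [|u v]; rewrite /aw_tens /pgen -!/(tpi _ _).
  by rewrite tpi1; apply/tpiP/teq_rel; constructor.
by rewrite tpiM; apply/tpiP/teq_rel; constructor.
Qed.
Definition aw_tens_morph : {rmorphism T -> A} :=
  HB.pack_for {rmorphism T -> A} (rr : T -> A)
    (GRing.isZmodMorphism.Build T A _ aw_tensB)
    (GRing.isMonoidMorphism.Build T A _ aw_tens_monoid).

Definition aw_coef (al : E) (a : A) : smash := alg_op a (dual_fun al expo0) [::].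

Lemma aw_coefE (al be : E) r p : aw_coef al ((\prod_i x i ^+ be i) * rr r * pp p) =
  if al == be then [ffun q => if q == p then r else 0] else 0.
Proof.
have sd := dual_fun_sym al expo0.
have sX := alg_op_sym (\prod_i x i ^+ be i) sd.
rewrite /aw_coef !alg_opM // (alg_op_gen (Gperm B p)); last exact: alg_op_sym.
rewrite (alg_op_gen (Gtens r)) // shifts_prod /= /p_op /= /r_op /=.
have -> : dual_fun al (expo_add expo0 be) [::] = if al == be then smash_delta 1%g 1 else 0.
  rewrite /dual_fun; congr (if _ == _ then _ else _).
  by apply/ffunP => i; rewrite !ffunE addn0.
case: eqP => _; apply/ffunP => q; rewrite !ffunE; last by rewrite mul0r.
rewrite -(inj_eq (mulgI p)) mulKVg mulg1; case: eqP => [->|_]; last by rewrite mul0r.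
by rewrite mulVg wd_act1 mul1r.
Qed.

Lemma aw_ind (Q : A -> Prop) : Q 1 -> (forall a b, Q a -> Q b -> Q (a - b)) ->
  (forall i a, Q a -> Q (x i * a)) -> (forall r a, Q a -> Q (rr r * a)) ->
  (forall p a, Q a -> Q (pp p * a)) -> forall a, Q a.
Proof.
move=> Q1 QB Qx Qr Qp; apply: presAlg_ind => // [c a Qa|[i|u|p] a Qa].
- rewrite -[a]mul1r pres_scaleAl -(rmorph1 aw_tens_morph) -aw_tensZ; exact: Qr.
- exact: Qx.
- exact: Qr.
- exact: Qp.
Qed.

Definition affine_datum : affineDatum D A.
Proof.
apply: (@AffineDatum n T D A x aw_tens_morph pp aw_coef).
- by move=> i j; rewrite tpiM [RHS]tpiM; apply/tpiP/teq_rel; constructor.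
- by move=> p q; rewrite [RHS]tpiM; apply/tpiP/teq_rel; constructor.
- by rewrite [RHS]tpi1; apply/tpiP/teq_rel; constructor.
- by move=> r i; rewrite tpiM [RHS]tpiM; apply/tpiP/teq_rel; constructor.
- move=> i i' j i'E ji ji'; rewrite tpiM [RHS]tpiM.
  by apply/tpiP/teq_rel; constructor.
- move=> i i' i'E; rewrite tpiM [X in _ = X - _]tpiM tpiN [RHS]tpiD.
  by apply/tpiP/teq_rel; constructor.
- by move=> p r; rewrite tpiM [RHS]tpiM; apply/tpiP/teq_rel; constructor.
- exact: aw_ind.
- by move=> al a b; rewrite /aw_coef alg_opB //; exact: dual_fun_sym.
- exact: aw_coefE.
Defined.

End AffineWreathDatum.

(** * The cyclotomic quotient *)

Section Products.
Variables (n : nat) (R : pzRingType) (D : wreathDatum n R) (A : pzRingType).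
Variable X : affineDatum D A.
Variable i0 : 'I_n.
Local Notation x := (ad_x X).
Local Notation rr := (ad_r X).
Local Notation pp := (ad_p X).
Local Notation cpoly := (cyclotomicPoly X i0).

Lemma cyclotomicPoly1 : cpoly 0 1.
Proof.
split.
- by move=> j; rewrite mul1r mulr1.
- by move=> r; exists r; rewrite mul1r mulr1.
- by move=> p _; rewrite mul1r mulr1.
- by rewrite expr0 subrr; apply: add_span0.
Qed.

Lemma r_xpow r i m : exists r', rr r * x i ^+ m = x i ^+ m * rr r'.
Proof. by rewrite -xmon_at; exact: r_xmon. Qed.

Lemma cyclotomicPolyM d d' z z' : cpoly d z -> cpoly d' z' -> cpoly (d + d') (z * z').
Proof.
move=> zP zP'; split.
- by move=> j; rewrite -mulrA (cp_x zP') mulrA (cp_x zP) mulrA.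
- move=> r; have [s Es] := cp_r zP r; have [s' Es'] := cp_r zP' s.
  by exists s'; rewrite mulrA Es -mulrA Es' mulrA.
- by move=> p p0; rewrite mulrA (cp_p zP) // -!mulrA (cp_p zP').
have -> : z * z' - x i0 ^+ (d + d') =
    z * (z' - x i0 ^+ d') + (z - x i0 ^+ d) * x i0 ^+ d'.
  by rewrite mulrBr mulrBl -exprD addrA subrK.
apply: add_spanD.
  apply: add_span_mull (cp_lead zP') => _ [j [r [lt_jd ->]]].
  have -> : z * (x i0 ^+ j * rr r) =
      x i0 ^+ j * (z - x i0 ^+ d) * rr r + x i0 ^+ (j + d) * rr r.
    rewrite mulrBr -exprD mulrBl subrK mulrA; congr (_ * _).
    by apply: commrX; exact: (cp_x zP).
  apply: add_spanD; last by apply: add_span_gen; exists (j + d)%N, r; split=> //; lia.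
  apply: add_span_mul (cp_lead zP) => _ [i [s [lt_id ->]]]; apply: add_span_gen.
  exists (j + i)%N, (s * r); split; first lia.
  by rewrite exprD rmorphM !mulrA.
apply: add_span_mulr (cp_lead zP) => _ [j [r [lt_jd ->]]].
have [r' Er'] := r_xpow r i0 d'; apply: add_span_gen; exists (j + d')%N, r'.
by split; [lia|rewrite -mulrA Er' exprD mulrA].
Qed.

Lemma cyclotomicPoly_prod (s : seq nat) (d : nat -> nat) (z : nat -> A) :
  (forall i, i \in s -> cpoly (d i) (z i)) ->
  cpoly (\sum_(i <- s) d i) (\prod_(i <- s) z i).
Proof.
elim: s => [|i s IHs] zP; first by rewrite !big_nil; exact: cyclotomicPoly1.
rewrite !big_cons; apply: cyclotomicPolyM; first by apply: zP; rewrite inE eqxx.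
by apply: IHs => j js; apply: zP; rewrite inE js orbT.
Qed.

Hypothesis i0E : i0 = 0%N :> nat.

Lemma p_x0 (p : 'S_n) : p i0 = i0 -> pp p * x i0 = x i0 * pp p.
Proof.
move=> p0; rewrite pp_x p0.
have -> : jucys_murphy X i0 = 0 by rewrite /jucys_murphy big1 // => j; rewrite i0E.
by rewrite mulr0 mul0r subrr addr0.
Qed.

Lemma cyclotomicPoly_factor m (c : R) : (0 < m)%N ->
  (forall j, wd_twist D j c = c) ->
  (forall r, r * c = c * iter m (wd_twist D i0) r) ->
  (forall p : 'S_n, p i0 = i0 -> wd_act D p c = c) ->
  cpoly m (x i0 ^+ m - rr c).
Proof.
move=> m_gt0 c_twist c_comm c_act; split.
- move=> j; rewrite mulrBl mulrBr ad_rx c_twist; congr (_ - _).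
  by apply/commr_sym/commrX; exact: ad_xx.
- move=> r; exists (iter m (wd_twist D i0) r).
  rewrite mulrBl mulrBr -!rmorphM c_comm; congr (_ - _).
  elim: m {m_gt0 c_comm} r => [|m IHm] r; first by rewrite !expr0 mulr1 mul1r.
  by rewrite iterSr exprS mulrA ad_rx -!mulrA IHm.
- move=> p p0; rewrite mulrBl mulrBr ad_pr c_act //; congr (_ - _).
  by apply: commrX; exact: p_x0.
- rewrite addrC addKr; apply: add_span_gen; exists 0%N, (- c).
  by rewrite m_gt0 expr0 mul1r rmorphN.
Qed.

End Products.

Section TwistedCentral.
Variables (k : comNzRingType) (F : frobeniusSuperalgebra k).
Variables (psi : {lrmorphism F -> F}) (psi_nakayama : is_nakayama psi).
Variables (B : homogBasis F) (n : nat).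
Local Notation T := (tensorPower B n).
Local Notation idx := {ffun 'I_n -> B}.
Local Notation tens := (@tens k F B n).
Local Notation btens := (@btens k F B n).
Local Notation tat := (@tat k F B n).

Lemma iter_psi0 r : iter r psi 0 = 0.
Proof. by elim: r => //= r ->; rewrite linear0. Qed.

Lemma iter_psi_par r e f : has_parity e f -> has_parity e (iter r psi f).
Proof. by move=> ef; elim: r => //= r IHr; apply: psi_par. Qed.

Lemma in_F_hom r (f g : F) e : in_F psi r f -> has_parity e g ->
  g * f = parity_sign e f * iter r psi g.
Proof.
move=> fr eg; rewrite fr /superize !big_bool /= !(gs_par_hom _ eg) /parity_sign.
case: e {eg} => /=; rewrite !iter_psi0 !mulr0 ?oppr0 ?addr0 ?add0r.
  by rewrite addrC mulrBl.
by rewrite -mulrDl addrC -gs_par_sum.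
Qed.

Lemma parity_signK e : involutive (@parity_sign k F e).
Proof.
move=> f; rewrite /parity_sign; case: e => //; rewrite !linearB /= !gs_par_proj /=.
by rewrite subr0 oppr0 add0r opprK -gs_par_sum.
Qed.

Lemma hb_coord_sign e f (b : B) :
  hb_coord B (parity_sign e f) b = (-1) ^+ (e && hb_par b) * hb_coord B f b.
Proof.
have sgn_sum (I : Type) (s : seq I) (g : I -> F) :
    parity_sign e (\sum_(i <- s) g i) = \sum_(i <- s) parity_sign e (g i).
  by rewrite /parity_sign; case: (e); rewrite // !linear_sum -big_split.
have sgnZ (a : k) (g : F) : parity_sign e (a *: g) = a *: parity_sign e g.
  by rewrite /parity_sign; case: (e); rewrite // !linearZ /= -scalerDr.
rewrite [f in LHS](hb_coordE B) sgn_sum.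
under eq_bigr do rewrite sgnZ parity_sign_vec scalerA.
rewrite hb_coord_sum (bigD1 b) //= big1 ?addr0.
  by rewrite hb_coordZ hb_coord_vec eqxx mulr1 mulrC.
by move=> c /negPf ne; rewrite hb_coordZ hb_coord_vec ne mulr0.
Qed.

Lemma prod_sign (g : 'I_n -> bool) :
  \prod_i (-1) ^+ g i = (-1) ^+ (\big[addb/false]_i g i) :> k.
Proof.
by apply/esym/(big_morph (fun b : bool => (-1) ^+ b : k)) => // b b'; rewrite signr_addb.
Qed.

Lemma tat_tens l e f g : has_parity e f -> tat l f * tens g =
  tens (fun i => if (i < l)%N then parity_sign e (g i)
                 else if i == l then f * g i else g i).
Proof.
move=> ef.
rewrite (@tens_expand _ _ B n (fun i y => if (i < l)%N then parity_sign e y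
  else if i == l then f * y else y)); last first.
  move=> i a y y'; case: ifP => _; first exact: parity_sign_linear.
  by case: ifP => // _; rewrite mulrDr scalerAr.
rewrite (tens_lin B g) mulr_sumr; apply: eq_bigr => J _; rewrite -tscaleAr.
congr (_ *: _); rewrite (tens_mul B (par_tat l ef) (par_vec J)).
rewrite [X in _ = tens X](_ : _ = (fun i : 'I_n =>
    (if (i < l)%N then (-1) ^+ (e && hb_par (J i)) else 1) *:
    ((if i == l then f else 1) * hb_vec (J i)))).
  rewrite tensZ; congr (_ *: _).
  under eq_bigr => i _.
    rewrite (_ : (if _ then _ else _) = (-1) ^+ ((i < l)%N && (e && hb_par (J i))));
      last by case: ifP.
    over.
  rewrite prod_sign; congr (_ ^+ nat_of_bool _); rewrite /koszul /xorsum (bigD1 l) //=.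
  rewrite [X in _ (+) X]big1 ?addbF.
    by apply: eq_bigr => j _; rewrite /at1 eqxx.
  by move=> i /negPf ne; rewrite big1 // => j _; rewrite /at1 ne andbF.
apply/funext => i; case: ltnP => lt.
  by rewrite parity_sign_vec (negPf (ltn_neq_ord lt)) mul1r.
by rewrite scale1r; case: eqP => // _; rewrite mul1r.
Qed.

Lemma tens_tat l e f g : has_parity e f -> tens g * tat l f =
  tens (fun i => if (l < i)%N then parity_sign e (g i)
                 else if i == l then g i * f else g i).
Proof.
move=> ef.
rewrite (@tens_expand _ _ B n (fun i y => if (l < i)%N then parity_sign e y
  else if i == l then y * f else y)); last first.
  move=> i a y y'; case: ifP => _; first exact: parity_sign_linear.
  by case: ifP => // _; rewrite mulrDl scalerAl.
rewrite (tens_lin B g) mulr_suml; apply: eq_bigr => J _; rewrite -tscaleAl.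
congr (_ *: _); rewrite (tens_mul B (par_vec J) (par_tat l ef)).
rewrite [X in _ = tens X](_ : _ = (fun i : 'I_n =>
    (if (l < i)%N then (-1) ^+ (e && hb_par (J i)) else 1) *:
    (hb_vec (J i) * (if i == l then f else 1)))).
  rewrite tensZ; congr (_ *: _).
  under eq_bigr => i _.
    rewrite (_ : (if _ then _ else _) = (-1) ^+ ((l < i)%N && (e && hb_par (J i))));
      last by case: ifP.
    over.
  rewrite prod_sign; congr (_ ^+ nat_of_bool _); rewrite /koszul; apply: eq_bigr => i _.
  rewrite (bigD1 l) //= big1 ?addbF; first by rewrite /at1 eqxx andbC [e && _]andbC andbC.
  by move=> j /negPf ne; rewrite /at1 ne !andbF.
apply/funext => i; case: ltnP => lt.
  by rewrite parity_sign_vec [i == l]eq_sym (negPf (ltn_neq_ord lt)) mulr1.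
by rewrite scale1r; case: eqP => // _; rewrite mulr1.
Qed.

Lemma tens_parity_sign e g (J : idx) :
  tens (fun i => parity_sign e (g i)) J =
  (-1) ^+ (e && \big[addb/false]_i hb_par (J i)) * tens g J.
Proof.
rewrite !ffunE; under eq_bigr do rewrite hb_coord_sign.
rewrite big_split /= prod_sign; congr (_ ^+ nat_of_bool _ * _).
by case: e; rewrite //= big1.
Qed.

Lemma even_parity_sign e (u : T) m (f : 'I_m -> 'I_n -> F) :
  t_even u -> u = \sum_l tens (f l) ->
  \sum_l tens (fun i => parity_sign e (f l i)) = u.
Proof.
move=> u_even uE; apply/ffunP => J; rewrite sum_ffunE.
under eq_bigr do rewrite tens_parity_sign.
have [uJ|nz] := eqVneq (u J) 0.
  rewrite -mulr_sumr -sum_ffunE -uE uJ; exact: mulr0.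
have even_J : \big[addb/false]_i hb_par (J i) = false.
  have := u_even J (elimN eqP nz); rewrite odd_sum => /negbTE sum0; rewrite -[RHS]sum0.
  by apply: eq_bigr => i _; rewrite oddb.
under eq_bigr do rewrite even_J andbF expr0 mul1r.
by rewrite -sum_ffunE -uE.
Qed.

Lemma F1_twist i0 r (u : T) j : in_F1 psi i0 r u -> tmap_at psi j u = u.
Proof.
case=> [[m [f [fF ->]]] _]; rewrite (tmap_at_sum psi_nakayama); apply: eq_bigr => l _.
rewrite tmap_at_tens; apply: eq_tens => i; case: eqP => // _.
by have [_] := fF l i.
Qed.

(** A factor f in any position can be moved across u by applying the parity
    involution to u, which fixes u as u is even, and psi^r to f in position i0,
    where the defining property of F^(r) is used. *)
Lemma F1_comm i0 r (u v : T) : in_F1 psi i0 r u -> t_even u ->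
  v * u = u * iter r (tmap_at psi i0) v.
Proof.
move=> [[m [f [fF uE]]] _] u_even.
pose it := iter r (@tmap_at k F B n psi i0).
have it1 : it 1 = 1.
  rewrite /it; elim: r {fF it} => //= r ->.
  exact: (rmorph1 (twist_morph psi_nakayama B i0)).
have itM w w' : it (w * w') = it w * it w'.
  by rewrite /it; elim: r {fF it it1} => //= r ->; exact: (tmap_atM psi_nakayama).
have itP a w w' : it (a *: w + w') = a *: it w + it w'.
  by rewrite /it; elim: r {fF it it1 itM} => //= r ->; exact: tmap_at_linear.
have it0 : it 0 = 0 by have := itP (-1) 0 0; rewrite scaler0 addr0 scaleN1r addNr.
rewrite -/it; elim/tensor_gen: v => [|v w hv hw|a v hv|v w hv hw|l b].
- by rewrite it1 mul1r mulr1.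
- by rewrite -[v]scale1r itP mulrDl -tscaleAl hv hw mulrDr -tscaleAr.
- by rewrite -[a *: v]addr0 itP it0 !addr0 -tscaleAl hv tscaleAr.
- by rewrite -mulrA hw mulrA hv itM mulrA.
set e := hb_par b; have eb : has_parity e (hb_vec b) by exact: hb_parP.
pose r' := if l == i0 then r else 0%N.
have -> : it (tat l (hb_vec b)) = tat l (iter r' psi (hb_vec b)).
  rewrite /it /r'; elim: (r) => [|q IHq] /=; first by rewrite if_same.
  by rewrite IHq twist_tat; case: eqP.
rewrite -{2}(even_parity_sign e u_even uE) mulr_suml uE mulr_sumr.
apply: eq_bigr => s _; rewrite (tat_tens _ _ eb).
rewrite (tens_tat _ _ (iter_psi_par r' eb)); apply: eq_tens => i.
rewrite parity_signK; case: (ltngtP i l) => [lt|lt|/val_inj eil].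
- by rewrite (negPf (ltn_neq_ord lt)).
- by rewrite eq_sym (negPf (ltn_neq_ord lt)).
rewrite eil eqxx; have [Fl _] := fF s l.
by rewrite (in_F_hom Fl eb).
Qed.

End TwistedCentral.

Section CyclotomicBasis.
Variables (k : comNzRingType) (F : frobeniusSuperalgebra k).
Variables (psi : {lrmorphism F -> F}) (psi_nakayama : is_nakayama psi).
Variables (psi_inj : injective psi).
Variables (B : homogBasis F) (bd : B -> F) (bd_dual : is_left_dual bd).
Variables (n : nat) (i0 : 'I_n) (i0E : i0 = 0%N :> nat).
Variables (theta : nat) (e : nat -> nat) (c : nat -> nat -> tensorPower B n).
Hypothesis c_F1 : forall r j, (1 <= r <= theta)%N -> (j < e r)%N ->
  in_F1 psi i0 r (c r j) /\ t_even (c r j).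
Local Notation T := (tensorPower B n).
Local Notation D := (tensor_datum psi_nakayama psi_inj bd_dual n).
Local Notation X := (affine_datum psi_nakayama psi_inj bd_dual n).
Local Notation A := (presAlg (@awp_rel k F B psi bd n)).
Local Notation z := (chi psi bd i0 theta e c : A).
Local Notation d := (level theta e).
Local Notation idx := {ffun 'I_n -> B}.
Local Notation smash := {ffun 'S_n -> T}.

Lemma chi_cyclotomicPoly : cyclotomicPoly X i0 d z.
Proof.
apply: (cyclotomicPoly_prod (X := X)) => r; rewrite mem_index_iota ltnS => r_theta.
rewrite -(big_mkord xpredT (fun j => aw_x psi bd i0 ^+ r - aw_tens (c r j))).
have -> : (r * e r = \sum_(0 <= j < e r) r)%N by rewrite sum_nat_const_nat subn0 mulnC.
apply: (cyclotomicPoly_prod (X := X)) => j; rewrite mem_index_iota => /= j_e.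
have [cF ce] := c_F1 r_theta j_e; have [_ c_perm] := cF.
apply: (cyclotomicPoly_factor X i0E); first by case/andP: r_theta.
- by move=> l; exact: F1_twist cF.
- by move=> u; exact: F1_comm cF ce.
- exact: c_perm.
Qed.

Definition coef_fun (w : {ffun {ffun 'I_n -> 'I_d} * idx * 'S_n -> k})
  (al : {ffun 'I_n -> 'I_d}) : smash := [ffun p => [ffun J => w (al, J, p)]].

Lemma sum_monomials (w : {ffun {ffun 'I_n -> 'I_d} * idx * 'S_n -> k}) :
  \sum_a w a *: cw_monomial psi bd i0 theta e c a =
  qpi z (\sum_al xmon X (expo_of_box al) * of_smash X (coef_fun w al)).
Proof.
have qpi_sum (I : Type) (s : seq I) (f : I -> A) :
    qpi z (\sum_(i <- s) f i) = \sum_(i <- s) qpi z (f i).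
  apply: (big_morph (qpi z)) => [a b|]; first exact: qpiD.
  by apply: (addrI (qpi z 0)); rewrite -qpiD !addr0.
have qpiZ a (b : A) : a *: qpi z b = qpi z (a *: b) by exact: quot_scaleE.
transitivity (qpi z (\sum_a w a *: (aw_monomial psi bd a.1.1 a.1.2 a.2 : A))).
  by rewrite qpi_sum; apply: eq_bigr => a _; rewrite -qpiZ.
congr qpi; transitivity (\sum_al \sum_p \sum_(J : idx)
    w (al, J, p) *: (aw_monomial psi bd al J p : A)).
  under [RHS]eq_bigr do rewrite exchange_big /=.
  by rewrite pair_bigA pair_bigA; apply: eq_bigr => [[[al J] p]] _.
apply: eq_bigr => al _; rewrite /of_smash mulr_sumr; apply: eq_bigr => p _.
rewrite [coef_fun w al p](tensorE (B := B)) raddf_sum mulr_suml mulr_sumr.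
apply: eq_bigr => J _; rewrite !ffunE /=.
rewrite [aw_tens (_ *: _)](@aw_tensZ k F psi B bd n (w (al, J, p))).
rewrite -pres_scaleAl -pres_scaleAr.
congr (_ *: _); rewrite mulrA; congr (_ * _ * _).
by apply: eq_bigr => i _; rewrite ffunE.
Qed.

Lemma cyclotomic_basis : is_basis (cw_monomial psi bd i0 theta e c).
Proof.
elim/qpiW => a; have [w hw] := cyclotomic_span i0E chi_cyclotomicPoly a.
pose c0 := [ffun b : {ffun 'I_n -> 'I_d} * idx * 'S_n => w b.1.1 b.2 b.1.2].
have c0E al : coef_fun c0 al = w al.
  by apply/ffunP => p; rewrite ffunE; apply/ffunP => J; rewrite !ffunE.
exists c0; split.
  by rewrite sum_monomials; apply/qpi_eqP; under eq_bigr do rewrite c0E.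
move=> c1; rewrite sum_monomials => /qpi_eqP hc1.
have := cyclotomic_free i0E chi_cyclotomicPoly
  (w := fun al => coef_fun c0 al - coef_fun c1 al).
have -> : \sum_al xmon X (expo_of_box al) * of_smash X (coef_fun c0 al - coef_fun c1 al) =
    (a - \sum_al xmon X (expo_of_box al) * of_smash X (coef_fun c1 al)) -
    (a - \sum_al xmon X (expo_of_box al) * of_smash X (w al)).
  under eq_bigr do rewrite of_smashB mulrBr; rewrite sumrB.
  under eq_bigr do rewrite c0E.
  by rewrite opprB [RHS]addrC addrA subrK.
move=> /(_ (Defs.idealB (ideal_genP _) hc1 hw)) eq_c.
apply/ffunP => [[[al J] p]]; have /ffunP/(_ p)/ffunP/(_ J) := eq_c al.
by rewrite !ffunE /= => /eqP; rewrite subr_eq0 => /eqP.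
Qed.

End CyclotomicBasis.

Theorem theorem6p11
  (k : comNzRingType) (char_k : nat)
  (k_char : has_characteristic k char_k) (k_char2 : char_k <> 2%N)
  (F : frobeniusSuperalgebra k)
  (psi : {lrmorphism F -> F}) (psi_nakayama : is_nakayama psi)
  (delta : nat) (delta_max : is_max_degree F delta)
  (theta : nat) (psi_order : has_order psi theta)
  (char_theta : ~~ (char_k %| theta)%N)
  (psi_eigen : has_eigenbasis psi)
  (B : homogBasis F) (bd : B -> F) (bd_dual : is_left_dual bd)
  (n : nat) (n_gt0 : (0 < n)%N)
  (e : nat -> nat) (c : nat -> nat -> tensorPower B n)
  (c_cond : forall r j, (1 <= r <= theta)%N -> (j < e r)%N ->
     [/\ in_F1 psi (Ordinal n_gt0) r (c r j),
         t_even (c r j) & t_has_degree (r * delta) (c r j)]) :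
  is_basis (cw_monomial psi bd (Ordinal n_gt0) theta e c).
Proof.
have psi_inj : injective psi.
  have [theta_gt0 psiK _] := psi_order.
  apply: (can_inj (g := iter theta.-1 psi)) => f.
  by rewrite -iterSr prednK // psiK.
refine (cyclotomic_basis psi_nakayama psi_inj bd_dual _ _) => // r j hr hj.
by have [] := c_cond r j hr hj.
Qed.
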